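(* Let $f,\psi\in L^2(\mathbb R)$ and $\zeta\in\mathbb R^+$, let $\mathcal A^{\psi}_{\Lambda_S}[f](t,\zeta)$ be the continuous novel special affine wavelet transform of $f$ with respect to the wavelet $\psi$, and let $\mathcal F_{SAFT}[f](\omega)=\widehat f_{\Lambda_S}(\omega)$ be the special affine Fourier transform (SAFT) of $f$. Then, the SAFT on the left being taken with respect to the variable $t$, $$\mathcal F_{SAFT}\big[\mathcal A^{\psi}_{\Lambda_S}[f](t,\zeta)\big](\omega)=\sqrt{\zeta}\,\exp\left\{\frac{i}{2B}\big(2\omega\zeta(Dp-Bq)-D\omega^2\zeta^2\big)\right\}\widehat f_{\Lambda_S}(\omega)\,\widehat\Psi_{\Lambda_S}(\zeta\omega,\zeta),$$ where $$\Psi(x,\zeta)=\exp\left\{\frac{i}{2B}\big(Ax^2(\zeta^2-1)+2xp(\zeta-1)\big)\right\}\psi^*(-x)$$ and $\widehat\Psi_{\Lambda_S}(\zeta\omega,\zeta)$ denotes the SAFT of $x\mapsto\Psi(x,\zeta)$ evaluated at the point $\zeta\omega$.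
   Context: Fix real parameters $A,B,C,D,p,q$ with $AD-BC=1$ and $B\neq0$ (collected in $\Lambda_S$). $z^*$ denotes the complex conjugate of $z$, and $\mathbb R^+=(0,\infty)$. Put $K_B=\frac1{\sqrt{2\pi B}}$ and $$\mathcal K_{\Lambda_S}(x,\omega)=K_B^*\exp\left\{\frac{i}{2B}\big(Ax^2+2x(p-\omega)-2\omega(Dp-Bq)+D\omega^2\big)\right\}.$$ The special affine Fourier transform (SAFT) of $f$ is $\mathcal F_{SAFT}[f](\omega)=\widehat f_{\Lambda_S}(\omega)=\int_{\mathbb R}f(x)\,\mathcal K_{\Lambda_S}(x,\omega)\,dx$; it satisfies the Parseval formula $\langle f,g\rangle=\langle\widehat f_{\Lambda_S},\widehat g_{\Lambda_S}\rangle$ for $f,g\in L^2(\mathbb R)$, where $\langle f,g\rangle=\int_{\mathbb R}fg^*\,dx$. For $\psi\in L^2(\mathbb R)$, $t\in\mathbb R$, $\zeta\in\mathbb R^+$, put $$\psi^{\Lambda_S}_{t,\zeta}(x)=\frac{K_B}{\sqrt\zeta}\,\psi\left(\frac{x-t}{\zeta}\right)\exp\left\{\frac{iAx(t-x)}{B}\right\}.$$ The continuous novel special affine wavelet transform of $f\in L^2(\mathbb R)$ with respect to $\psi$ is $\mathcal A^{\psi}_{\Lambda_S}[f](t,\zeta)=\int_{\mathbb R}f(x)\,\big(\psi^{\Lambda_S}_{t,\zeta}(x)\big)^*dx$. *)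

(* Defs.v *)
From HB Require Import structures.
From mathcomp Require Import all_boot all_order all_algebra.
From mathcomp Require Import complex.
From mathcomp Require Import all_classical all_reals all_analysis.

Set Implicit Arguments.
Unset Strict Implicit.
Unset Printing Implicit Defensive.
Import Order.TTheory GRing.Theory Num.Theory.
Import numFieldNormedType.Exports.

Local Open Scope classical_set_scope.
Local Open Scope ring_scope.
Local Open Scope complex_scope.

(* Functions R -> R[i] are treated componentwise: the libraries provide neither
   a Borel structure nor an integral on R[i].  [complex.Re], [complex.Im] and
   [Normc.normc] take values in R. *)
Section complex_functions.
Variable R : realType.
Local Notation mu := (@lebesgue_measure R).

Definition expi (x : R) : R[i] := cos x +i* sin x.

Definition cintegral (E : set R) (h : R -> R[i]) : R[i] :=
  Rintegral mu E (@complex.Re R \o h) +i* Rintegral mu E (@complex.Im R \o h).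

Definition cLnorm (p : \bar R) (h : R -> R[i]) : \bar R :=
  Lnorm mu p (fun x => (Normc.normc (h x))%:E).

Definition cLp (p : \bar R) (h : R -> R[i]) : Prop :=
  [/\ measurable_fun [set: R] (@complex.Re R \o h),
      measurable_fun [set: R] (@complex.Im R \o h) &
      (cLnorm p h < +oo)%E].

Definition cinner (g h : R -> R[i]) : R[i] :=
  cintegral [set: R] (fun x => g x * (h x)^*).

End complex_functions.

(* [sC] occurs in no formula below, only in the condition A D - B C = 1. *)
Record saft_params (R : realType) := SaftParams {
  sA : R; sB : R; sC : R; sD : R; sp : R; sq : R }.

Section saft.
Variables (R : realType) (L : saft_params R).
Local Notation mu := (@lebesgue_measure R).
Local Notation A := (sA L).
Local Notation B := (sB L).
Local Notation D := (sD L).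
Local Notation p := (sp L).
Local Notation q := (sq L).

(* B may be negative, so the square root is the complex one: K_B is
   nonreal when B < 0. *)
Definition saft_KB : R[i] := (sqrtc (2 * pi * B)%:C)^-1.

Definition saft_kernel (x w : R) : R[i] :=
  saft_KB^* * expi ((2 * B)^-1 *
    (A * x ^+ 2 + 2 * x * (p - w) - 2 * w * (D * p - B * q) + D * w ^+ 2)).

Definition saft_integral (E : set R) (g : R -> R[i]) (w : R) : R[i] :=
  cintegral E (fun x => g x * saft_kernel x w).

(* Every Schwartz function is such a test function. *)
Definition saft_test (phi : R -> R[i]) : Prop :=
  [/\ cLp 1%:E phi, exists M : R, forall x, Normc.normc (phi x) <= M &
      cLp 1%:E (saft_integral [set: R] phi)].

(* [is_saft g F]: F represents the SAFT of g (which is only determined almost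
   everywhere).  For integrable g it is the integral; for square-integrable g
   the integral in general diverges and is, as usual, the limit in the mean of
   the integrals over [-n, n].  A wavelet transform in the variable t is
   continuous and bounded but need be neither integrable nor
   square-integrable; the last clause, the Parseval formula against all test
   functions, covers this case (the SAFT in the sense of tempered
   distributions).  It determines F up to a null set, and the three clauses
   agree wherever several of them apply. *)
Definition is_saft (g F : R -> R[i]) : Prop :=
  [/\ cLp 1%:E g -> \forall w \ae mu, F w = saft_integral [set: R] g w,
      cLp 2%:E g -> cLp 2%:E F /\
        cLnorm 2%:E (fun w => F w - saft_integral `[- n%:R, n%:R] g w)
          @[n --> \oo] --> 0%E &
      forall phi, saft_test phi ->
        let phihat := saft_integral [set: R] phi in
        [/\ cLp 1%:E (fun x => g x * (phi x)^*),
            cLp 1%:E (fun w => F w * (phihat w)^*) &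
            cinner g phi = cinner F phihat]].

Definition sa_wavelet (psi : R -> R[i]) (t zeta x : R) : R[i] :=
  saft_KB / (Num.sqrt zeta)%:C * psi ((x - t) / zeta) *
  expi (A * x * (t - x) / B).

Definition sa_wavelet_transform (psi f : R -> R[i]) (t zeta : R) : R[i] :=
  cinner f (sa_wavelet psi t zeta).

Definition sa_Psi (psi : R -> R[i]) (x zeta : R) : R[i] :=
  expi ((2 * B)^-1 *
    (A * x ^+ 2 * (zeta ^+ 2 - 1) + 2 * x * p * (zeta - 1))) * (psi (- x))^*.

End saft.

(* Main.v *)
Require Import Defs.
From HB Require Import structures.
From mathcomp Require Import all_boot all_order all_algebra.
From mathcomp Require Import complex.
From mathcomp Require Import all_classical all_reals all_analysis.
From mathcomp Require Import ring lra measurable_realfun.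

(* When [psi] is integrable, the theorem is the Parseval formula for [f] tested
   against [eta x = \int phi(t) psi_{t,zeta}(x) dt]: by Fubini the left side is
   [<A f, phi>], while the SAFT of [eta] factors, after the substitution
   x = t - zeta y and a recombination of the chirps, into the SAFT of [phi] times
   the conjugate of the multiplier and of the SAFT of [Psi] at zeta w. For [psi] in L2, truncate to
   [-n, n] and pass to the limit, the SAFT of the truncations of [Psi] converging
   in L2 to [Psihat].

   The pointwise and L2 readings follow from this weak one. Testing against
   exp(-e|x|/|B|) times a conjugated kernel, whose SAFT is a Poisson kernel,
   shows that the SAFT of A f exp(-e|x|/|B|) is a (twisted) Poisson average of the
   right-hand side, hence tends to it in L1 as e tends to 0. Dominated convergence
   gives the L1 case, and the inequality [||saft u||_2 <= ||u||_2] for integrable u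
   gives the L2 case. *)

Set Implicit Arguments.
Unset Strict Implicit.
Unset Printing Implicit Defensive.
Import Order.TTheory GRing.Theory Num.Theory.
Import numFieldNormedType.Exports.

Local Open Scope classical_set_scope.
Local Open Scope ring_scope.
Local Open Scope complex_scope.

(** * Complex-valued functions and their integrals *)

(** The argument rests on an asymmetry. The transform of [f] is merely bounded, so its SAFT integral
    may diverge, whereas the right-hand side is a bounded factor times a product of two
    square-integrable functions, hence integrable. Poisson averages of an integrable function
    converge in L1 norm, so Abel summation on the divergent side recovers the right-hand side in
    norm and not only weakly. The exponential weight is chosen because its transform is an explicit
    positive kernel of mass 1: this gives Schur's test in Plancherel's inequality as well as the
    approximate identity, without any inversion theorem. Truncating [psi] is forced by the notion of
    test function: [eta] has to be bounded and integrable with integrable SAFT, which integrability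
    of [psi] secures. In the L2 reading nothing says beforehand that the right-hand side is
    square-integrable, and the Abel means approach it only in L1. The L1 error is turned into an L2
    estimate where the unknown difference is bounded, and Fatou's lemma then removes the bound. *)

Section complex_measurability.
Context {d : measure_display} {T : measurableType d} {R : realType}.
Implicit Types h k : T -> R[i].

Definition cmeasurable h := measurable_fun [set: T] (@complex.Re R \o h) /\
  measurable_fun [set: T] (@complex.Im R \o h).

Lemma cmeasurableD h k : cmeasurable h -> cmeasurable k ->
  cmeasurable (fun x => h x + k x).
Proof.
move=> [h1 h2] [k1 k2]; split.
  rewrite (_ : _ \o _ = (@complex.Re R \o h) \+ (@complex.Re R \o k)).
    exact: measurable_funD.
  by apply/funext => x /=; case: (h x) (k x) => a b [c e].
rewrite (_ : _ \o _ = (@complex.Im R \o h) \+ (@complex.Im R \o k)).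
  exact: measurable_funD.
by apply/funext => x /=; case: (h x) (k x) => a b [c e].
Qed.

Lemma cmeasurableM h k : cmeasurable h -> cmeasurable k ->
  cmeasurable (fun x => h x * k x).
Proof.
move=> [h1 h2] [k1 k2]; split.
  rewrite (_ : _ \o _ = ((@complex.Re R \o h) \* (@complex.Re R \o k)) \-
    ((@complex.Im R \o h) \* (@complex.Im R \o k))).
    by apply: measurable_funB; exact: measurable_funM.
  by apply/funext => x /=; case: (h x) (k x) => a b [c e].
rewrite (_ : _ \o _ = ((@complex.Re R \o h) \* (@complex.Im R \o k)) \+
    ((@complex.Im R \o h) \* (@complex.Re R \o k))).
  by apply: measurable_funD; exact: measurable_funM.
by apply/funext => x /=; case: (h x) (k x) => a b [c e].
Qed.

Lemma cmeasurableN h : cmeasurable h -> cmeasurable (fun x => - h x).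
Proof.
move=> [h1 h2]; split.
  rewrite (_ : _ \o _ = \- (@complex.Re R \o h)); first exact: measurable_funN.
  by apply/funext => x /=; case: (h x).
rewrite (_ : _ \o _ = \- (@complex.Im R \o h)); first exact: measurable_funN.
by apply/funext => x /=; case: (h x).
Qed.

Lemma cmeasurableB h k : cmeasurable h -> cmeasurable k ->
  cmeasurable (fun x => h x - k x).
Proof. by move=> mh mk; apply: cmeasurableD => //; exact: cmeasurableN. Qed.

Lemma cmeasurable_conj h : cmeasurable h -> cmeasurable (fun x => (h x)^*).
Proof.
move=> [h1 h2]; split.
  by rewrite (_ : _ \o _ = @complex.Re R \o h)//; apply/funext => x /=; case: (h x).
rewrite (_ : _ \o _ = \- (@complex.Im R \o h)); first exact: measurable_funN.
by apply/funext => x /=; case: (h x).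
Qed.

Lemma cmeasurable_cst (c : R[i]) : cmeasurable (fun=> c).
Proof. by split; exact: measurable_cst. Qed.

Lemma cmeasurable_real (f : T -> R) :
  measurable_fun setT f -> cmeasurable (fun x => (f x)%:C).
Proof. by move=> mf; split => //; exact: measurable_cst. Qed.

Lemma cmeasurable_expi (f : T -> R) :
  measurable_fun setT f -> cmeasurable (fun x => expi (f x)).
Proof.
move=> mf; split.
  apply: (@measurableT_comp _ _ _ _ _ _ (@cos R)) => //.
  by apply: continuous_measurable_fun; exact: continuous_cos.
apply: (@measurableT_comp _ _ _ _ _ _ (@sin R)) => //.
by apply: continuous_measurable_fun; exact: continuous_sin.
Qed.

Lemma measurable_normc h : cmeasurable h ->
  measurable_fun setT (fun x => Normc.normc (h x)).
Proof.
move=> [h1 h2].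
rewrite (_ : (fun _ => _) = @Num.sqrt R \o ((fun x => complex.Re (h x) ^+ 2) \+
   (fun x => complex.Im (h x) ^+ 2))).
  apply: measurableT_comp.
    apply: continuous_measurable_fun; exact: sqrt_continuous.
  by apply: measurable_funD; exact: measurable_funX.
by apply/funext => x /=; case: (h x) => a b.
Qed.

End complex_measurability.

Lemma cmeasurableT_comp d1 d2 (T1 : measurableType d1) (T2 : measurableType d2)
    (R : realType) (h : T2 -> R[i]) (g : T1 -> T2) :
  cmeasurable h -> measurable_fun setT g -> cmeasurable (fun x => h (g x)).
Proof.
move=> [h1 h2] mg; split.
  exact: (@measurableT_comp _ _ _ _ _ _ (@complex.Re R \o h)).
exact: (@measurableT_comp _ _ _ _ _ _ (@complex.Im R \o h)).
Qed.

Section normc_theory.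
Context {R : realType}.
Implicit Types z w : R[i].
Local Notation nc := (@Normc.normc R).

Lemma normc_ge0 z : 0 <= nc z.
Proof. by case: z => a b; exact: sqrtr_ge0. Qed.

Lemma sqr_normc z : nc z ^+ 2 = complex.Re z ^+ 2 + complex.Im z ^+ 2.
Proof. by case: z => a b /=; rewrite sqr_sqrtr// addr_ge0// sqr_ge0. Qed.

Lemma normc_conj z : nc z^* = nc z.
Proof. by case: z => a b /=; rewrite sqrrN. Qed.

Lemma normc_real (x : R) : nc x%:C = `|x|.
Proof. by rewrite /= expr0n/= addr0 sqrtr_sqr. Qed.

Lemma normc_expi (x : R) : nc (expi x) = 1.
Proof. by rewrite /= cos2Dsin2 sqrtr1. Qed.

Lemma normr_Re_le z : `|complex.Re z| <= nc z.
Proof.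
rewrite -(ler_pXn2r (n := 2))// ?nnegrE ?normc_ge0//.
by rewrite sqr_normc real_normK ?num_real// lerDl sqr_ge0.
Qed.

Lemma normr_Im_le z : `|complex.Im z| <= nc z.
Proof.
rewrite -(ler_pXn2r (n := 2))// ?nnegrE ?normc_ge0//.
by rewrite sqr_normc real_normK ?num_real// lerDr sqr_ge0.
Qed.

Lemma normc_le_ReIm z : nc z <= `|complex.Re z| + `|complex.Im z|.
Proof.
rewrite -(ler_pXn2r (n := 2))// ?nnegrE ?normc_ge0// ?addr_ge0//.
rewrite sqr_normc sqrrD !real_normK ?num_real//.
by rewrite addrAC lerDl mulrn_wge0// mulr_ge0.
Qed.

Lemma normcB_le z w : nc (z - w) <= nc z + nc w.
Proof. by rewrite -(normcN w); exact: le_normcD. Qed.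

Lemma normcBC z w : nc (z - w) = nc (w - z).
Proof. by rewrite -normcN opprB. Qed.

Lemma normc_sum3 u v z : nc (u - z) <= nc (u - v) + nc (v - z).
Proof. by apply: le_trans (le_normcD _ _); rewrite addrA subrK. Qed.

Lemma normc_eq0 z : nc z = 0 -> z = 0. Proof. exact: Normc.eq0_normc. Qed.

Lemma mulr_le_sqrD (a b : R) : 0 <= a -> 0 <= b -> a * b <= a ^+ 2 + b ^+ 2.
Proof. by move=> a0 b0; nra. Qed.

Lemma expiD (x y : R) : expi (x + y) = expi x * expi y.
Proof. rewrite /expi cosD sinD; congr Complex; ring. Qed.

Lemma expi0 : expi (0 : R) = 1.
Proof. by rewrite /expi cos0 sin0. Qed.

Lemma conjc_expi (x : R) : (expi x)^* = expi (- x).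
Proof. by rewrite /expi cosN sinN. Qed.

End normc_theory.

(** * Fubini's theorem for real iterated integrals *)

Section real_fubini.
Context {R : realType}.
Local Notation mu := (@lebesgue_measure R).
Implicit Types (k : R * R -> R).

Lemma measurable_ge0_integral_prod (f : R * R -> \bar R) :
  measurable_fun setT f -> (forall z, (0 <= f z)%E) ->
  measurable_fun setT (fun x : R => (\int[mu]_y f (x, y))%E).
Proof. by move=> mf f0; exact: measurable_fun_fubini_tonelli_F. Qed.

(** Holds for every measurable [k]: the extended integral is the difference of the Tonelli integrals
    of the positive and negative parts, and [fine] is measurable. *)
Lemma measurable_Rintegral_prod k : measurable_fun setT k ->
  measurable_fun setT (fun x => Rintegral mu setT (fun y => k (x, y))).
Proof.
move=> mk; apply: measurableT_comp; first exact: fine_measurable.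
have mk' : measurable_fun setT (EFin \o k) by exact/measurable_EFinP.
rewrite (_ : (fun _ => _) = (fubini_F mu (EFin \o k)^\+) \- (fubini_F mu (EFin \o k)^\-))%E.
  apply: emeasurable_funB.
    apply: measurable_fun_fubini_tonelli_F => //; exact: measurable_funepos.
  apply: measurable_fun_fubini_tonelli_F => //; exact: measurable_funeneg.
apply/funext => x; rewrite integralE; congr (_ - _)%E;
  by apply: eq_integral => y _; rewrite ?funeposE ?funenegE.
Qed.

Lemma integrable_Rintegral_prod k : measurable_fun setT k ->
  (\int[mu]_x \int[mu]_y `|(k (x, y))%:E| < +oo)%E ->
  mu.-integrable setT (fun x => (Rintegral mu setT (fun y => k (x, y)))%:E) /\
  (Rintegral mu setT (fun x => Rintegral mu setT (fun y => k (x, y))))%:E =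
   (\int[mu \x mu]_z (k z)%:E)%E.
Proof.
move=> mk Hk.
have mk' : measurable_fun setT (EFin \o k) by exact/measurable_EFinP.
have ik : (mu \x mu)%E.-integrable setT (EFin \o k).
  by apply/integrable12ltyP.
have iF := integrable_fubini_F ik.
(* [fine] sends an infinite inner integral to 0, so the two functions agree only off the null set
   where the inner integral is infinite. *)
have eF : ae_eq mu setT (fubini_F mu (EFin \o k))
    (fun x => (Rintegral mu setT (fun y => k (x, y)))%:E).
  have := integrable_ae measurableT iF.
  apply: filterS => x h xT.
  by rewrite /Rintegral fineK//; exact: h.
have mF : measurable_fun setT (fun x => (Rintegral mu setT (fun y => k (x, y)))%:E).
  by apply/measurable_EFinP; exact: measurable_Rintegral_prod.
have iR : mu.-integrable setT (fun x => (Rintegral mu setT (fun y => k (x, y)))%:E).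
  apply/integrableP; split => //.
  have /integrableP[mG] := iF; apply: le_lt_trans.
  rewrite le_eqVlt; apply/orP; left; apply/eqP/ge0_ae_eq_integral => //; [exact: measurableT_comp..|].
  by move: eF; apply: filterS => x h xT; congr abse; apply/esym/h.
split => //.
rewrite /Rintegral fineK.
  rewrite -(integral12_prod_meas1 ik); apply: ae_eq_integral => //.
    exact: measurable_int iF.
  exact: ae_eq_sym.
exact: integrable_fin_num iR.
Qed.

Lemma Rintegral_fubini k : measurable_fun setT k ->
  (\int[mu]_x \int[mu]_y `|(k (x, y))%:E| < +oo)%E ->
  Rintegral mu setT (fun x => Rintegral mu setT (fun y => k (x, y))) =
  Rintegral mu setT (fun y => Rintegral mu setT (fun x => k (x, y))).
Proof.
move=> mk Hk.
have mk' : measurable_fun setT (EFin \o k) by exact/measurable_EFinP.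
have ik : (mu \x mu)%E.-integrable setT (EFin \o k).
  by apply/integrable12ltyP.
have ms : measurable_fun setT (fun z : R * R => k (z.2, z.1)).
  exact: (measurableT_comp mk (@measurable_swap _ _ _ _)).
have Hs : (\int[mu]_x \int[mu]_y `|(k (y, x))%:E| < +oo)%E.
  by apply/(integrable21ltyP mu mu mk').
have [_ e1] := integrable_Rintegral_prod mk Hk.
have [i2 _] := integrable_Rintegral_prod ms Hs.
apply: EFin_inj; rewrite e1 -(integral21_prod_meas1 ik).
rewrite [in RHS]/Rintegral fineK; last exact: integrable_fin_num i2.
have iG : mu.-integrable setT (fubini_G mu (EFin \o k)).
  have iks : (mu \x mu)%E.-integrable setT (EFin \o (fun z : R * R => k (z.2, z.1))).
    by apply/integrable12ltyP => //; exact/measurable_EFinP.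
  exact: (integrable_fubini_F iks).
apply: ae_eq_integral => //.
- exact: measurable_int iG.
- exact: measurable_int i2.
have := integrable_ae measurableT iG.
apply: filterS => x h xT.
by rewrite /Rintegral fineK//; exact: h.
Qed.

End real_fubini.

(** * Integration of complex-valued functions *)

Section complex_integral.
Context {R : realType}.
Local Notation mu := (@lebesgue_measure R).
Local Notation nc := (@Normc.normc R).
Implicit Types (h k : R -> R[i]) (g : R -> R).

Definition cintegrable h := cmeasurable h /\ (\int[mu]_x (nc (h x))%:E < +oo)%E.

Lemma le_cintegrable h g : cmeasurable h -> measurable_fun setT g ->
  (forall x, nc (h x) <= g x) -> (\int[mu]_x (g x)%:E < +oo)%E -> cintegrable h.
Proof.
move=> mh mg hg ig; split => //; apply: le_lt_trans ig.
apply: ge0_le_integral => //.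
- by move=> x _; rewrite lee_fin normc_ge0.
- by apply/measurable_EFinP; exact: measurable_normc.
- exact/measurable_EFinP.
- by move=> x _; rewrite lee_fin.
Qed.

Lemma integrable_normc h : cintegrable h ->
  mu.-integrable setT (fun x => (nc (h x))%:E).
Proof.
move=> [mh ih]; apply/integrableP; split.
  by apply/measurable_EFinP; exact: measurable_normc.
by under eq_integral do rewrite gee0_abs ?lee_fin ?normc_ge0//.
Qed.

Lemma integrable_Re h : cintegrable h ->
  mu.-integrable setT (EFin \o (@complex.Re R \o h)).
Proof.
move=> ih; apply: le_integrable (integrable_normc ih) => //.
  by apply/measurable_EFinP; exact: ih.1.1.
by move=> x _ /=; rewrite lee_fin (ger0_norm (normc_ge0 _)) normr_Re_le.
Qed.

Lemma integrable_Im h : cintegrable h ->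
  mu.-integrable setT (EFin \o (@complex.Im R \o h)).
Proof.
move=> ih; apply: le_integrable (integrable_normc ih) => //.
  by apply/measurable_EFinP; exact: ih.1.2.
by move=> x _ /=; rewrite lee_fin (ger0_norm (normc_ge0 _)) normr_Im_le.
Qed.

Lemma cintegrable_ReIm h : mu.-integrable setT (EFin \o (@complex.Re R \o h)) ->
  mu.-integrable setT (EFin \o (@complex.Im R \o h)) -> cintegrable h.
Proof.
move=> /[dup] i1 /integrableP[m1 _] /[dup] i2 /integrableP[m2 _].
have mh : cmeasurable h by split; exact/measurable_EFinP.
have iD := integrableD measurableT (integrable_abse i1) (integrable_abse i2).
split => //; have /integrableP[mD] := iD; apply: le_lt_trans.
apply: ge0_le_integral => //.
- by move=> x _; rewrite lee_fin normc_ge0.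
- by apply/measurable_EFinP; exact: measurable_normc.
- exact: measurableT_comp.
- move=> x _ /=; rewrite lee_fin ger0_norm ?addr_ge0//.
  exact: normc_le_ReIm.
Qed.

Lemma cintegrableD h k : cintegrable h -> cintegrable k ->
  cintegrable (fun x => h x + k x).
Proof.
move=> ih ik; apply: (@le_cintegrable _ (fun x => nc (h x) + nc (k x))).
- by apply: cmeasurableD; [exact: ih.1|exact: ik.1].
- by apply: measurable_funD; apply: measurable_normc; [exact: ih.1|exact: ik.1].
- by move=> x; exact: le_normcD.
under eq_integral do rewrite EFinD.
rewrite ge0_integralD//.
- by rewrite lte_add_pinfty//; [exact: ih.2|exact: ik.2].
- by move=> x _; rewrite lee_fin normc_ge0.
- by apply/measurable_EFinP; apply: measurable_normc; exact: ih.1.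
- by move=> x _; rewrite lee_fin normc_ge0.
- by apply/measurable_EFinP; apply: measurable_normc; exact: ik.1.
Qed.

Lemma integral_cst_normc h (c : R) : 0 <= c -> cmeasurable h ->
  (\int[mu]_x (c * nc (h x))%:E = c%:E * \int[mu]_x (nc (h x))%:E)%E.
Proof.
move=> c0 mh; under eq_integral do rewrite EFinM.
rewrite ge0_integralZl//.
- by apply/measurable_EFinP; exact: measurable_normc.
- by move=> x _; rewrite lee_fin normc_ge0.
Qed.

Lemma cintegrableM_bounded h k (c : R) : cmeasurable k ->
  (forall x, nc (k x) <= c) -> cintegrable h -> cintegrable (fun x => h x * k x).
Proof.
move=> mk kc ih.
have c0 : 0 <= c by apply: le_trans (kc 0); exact: normc_ge0.
apply: (@le_cintegrable _ (fun x => c * nc (h x))).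
- by apply: cmeasurableM => //; exact: ih.1.
- by apply: measurable_funM => //; apply: measurable_normc; exact: ih.1.
- by move=> x; rewrite Normc.normcM mulrC ler_wpM2r// normc_ge0.
rewrite integral_cst_normc//; last exact: ih.1.
rewrite lte_mul_pinfty// ?lee_fin//; exact: ih.2.
Qed.

Lemma cintegrableZ h (c : R[i]) : cintegrable h -> cintegrable (fun x => c * h x).
Proof.
move=> ih; rewrite (_ : (fun _ => _) = (fun x => h x * c)).
  by apply: (@cintegrableM_bounded _ _ (nc c)) => //; exact: cmeasurable_cst.
by apply/funext => x; rewrite mulrC.
Qed.

Lemma cintegrable_conj h : cintegrable h -> cintegrable (fun x => (h x)^*).
Proof.
move=> ih; apply: (@le_cintegrable _ (nc \o h)).
- by apply: cmeasurable_conj; exact: ih.1.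
- by apply: measurable_normc; exact: ih.1.
- by move=> x /=; rewrite normc_conj.
- exact: ih.2.
Qed.

Lemma cintegralD h k : cintegrable h -> cintegrable k ->
  cintegral setT (fun x => h x + k x) = cintegral setT h + cintegral setT k.
Proof.
move=> ih ik; rewrite /cintegral /=; congr Complex.
  rewrite -RintegralD//; [|exact: integrable_Re..].
  by apply: eq_Rintegral => x _ /=; case: (h x) (k x) => a b [c e].
rewrite -RintegralD//; [|exact: integrable_Im..].
by apply: eq_Rintegral => x _ /=; case: (h x) (k x) => a b [c e].
Qed.

Lemma cintegralZl h (c : R[i]) : cintegrable h ->
  cintegral setT (fun x => c * h x) = c * cintegral setT h.
Proof.
move=> ih; case: c => a b; rewrite /cintegral /=.
have i1 := integrable_Re ih; have i2 := integrable_Im ih.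
have Z1 e : mu.-integrable setT (EFin \o (fun x => e * complex.Re (h x))).
  exact: (@integrableZl _ _ _ mu setT measurableT e _ i1).
have Z2 e : mu.-integrable setT (EFin \o (fun x => e * complex.Im (h x))).
  exact: (@integrableZl _ _ _ mu setT measurableT e _ i2).
congr Complex.
  rewrite -(RintegralZl _ measurableT i1) -(RintegralZl _ measurableT i2).
  rewrite -(RintegralB measurableT (Z1 _) (Z2 _)).
  by apply: eq_Rintegral => x _ /=; case: (h x).
rewrite -(RintegralZl _ measurableT i1) -(RintegralZl _ measurableT i2).
rewrite -(RintegralD measurableT (Z2 _) (Z1 _)).
by apply: eq_Rintegral => x _ /=; case: (h x).
Qed.

Lemma cintegralB h k : cintegrable h -> cintegrable k ->
  cintegral setT (fun x => h x - k x) = cintegral setT h - cintegral setT k.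
Proof.
move=> ih ik.
rewrite (_ : (fun _ => _) = (fun x => h x + (-1) * k x)).
  rewrite cintegralD//; last exact: cintegrableZ.
  by rewrite cintegralZl// mulN1r.
by apply/funext => x; rewrite mulN1r.
Qed.

Lemma cintegrableB h k : cintegrable h -> cintegrable k ->
  cintegrable (fun x => h x - k x).
Proof.
move=> ih ik; rewrite (_ : (fun _ => _) = (fun x => h x + (-1) * k x)).
  by apply: cintegrableD => //; exact: cintegrableZ.
by apply/funext => x; rewrite mulN1r.
Qed.

Lemma cintegral_conj h : cintegrable h ->
  cintegral setT (fun x => (h x)^*) = (cintegral setT h)^*.
Proof.
move=> ih; rewrite /cintegral /=; congr Complex.
  by apply: eq_Rintegral => x _ /=; case: (h x).
rewrite -mulN1r -RintegralZl//; last exact: integrable_Im.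
by apply: eq_Rintegral => x _ /=; rewrite mulN1r; case: (h x).
Qed.

(** Multiplication by [I^*] rotates the integral onto the real axis: [nc I * nc I] is the integral
    of the real part of [I^* * h x], which is at most [nc I * nc (h x)]. Bounding the components
    separately would lose a constant. *)
Lemma normc_cintegral_le_R h : cintegrable h ->
  nc (cintegral setT h) <= Rintegral mu setT (nc \o h).
Proof.
move=> ih; set I := cintegral setT h.
have [I0|I0] := eqVneq (nc I) 0.
  by rewrite I0; apply: Rintegral_ge0 => x _ /=; exact: normc_ge0.
have Igt0 : 0 < nc I by rewrite lt_def I0 normc_ge0.
rewrite -(ler_pM2l Igt0) -RintegralZl//; last exact: integrable_normc.
have -> : nc I * nc I = complex.Re (I^* * I).
  by rewrite -expr2 sqr_normc; case: (I) => a b /=; rewrite !expr2; ring.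
rewrite [in X in complex.Re (_ * X)]/I -(cintegralZl _ ih).
have iZ := cintegrableZ (I^*) ih.
rewrite [leLHS](_ : _ = Rintegral mu setT (fun x => complex.Re (I^* * h x)))//.
apply: le_Rintegral => //.
- exact: integrable_Re.
- exact: (@integrableZl _ _ _ mu setT measurableT (nc I) _ (integrable_normc ih)).
- move=> x _; rewrite -(normc_conj I) -Normc.normcM.
  by apply: le_trans (normr_Re_le _); exact: ler_norm.
Qed.

Lemma normc_cintegral_le h : cintegrable h ->
  ((nc (cintegral setT h))%:E <= \int[mu]_x (nc (h x))%:E)%E.
Proof.
move=> ih; have := normc_cintegral_le_R ih; rewrite -lee_fin /Rintegral fineK//.
exact: integrable_fin_num (integrable_normc ih).
Qed.

Lemma cintegral_mkcond (E : set R) h :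
  cintegral E h = cintegral setT (fun x => h x * (\1_E x)%:C).
Proof.
rewrite /cintegral !(Rintegral_mkcond mu E); congr Complex.
  apply: eq_Rintegral => x _; rewrite patchE /= indicE.
  by case: (x \in E); case: (h x) => a b /=; rewrite ?mulr0 ?mulr1 ?subr0.
apply: eq_Rintegral => x _; rewrite patchE /= indicE.
by case: (x \in E); case: (h x) => a b /=; rewrite ?mulr0 ?mulr1 ?add0r.
Qed.

Lemma cmeasurable_cintegral_prod (F : R * R -> R[i]) : cmeasurable F ->
  cmeasurable (fun x => cintegral setT (fun y => F (x, y))).
Proof. by move=> [F1 F2]; split; [exact: (measurable_Rintegral_prod F1)|exact: (measurable_Rintegral_prod F2)]. Qed.

(** Here [p] stands for the real or the imaginary part, both dominated by the modulus, so that one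
    finiteness condition on the modulus serves both components. *)
Lemma fubini_comp_lty (F : R * R -> R[i]) (p : R[i] -> R) : cmeasurable F ->
  measurable_fun setT (p \o F) -> (forall z, `|p z| <= nc z) ->
  (\int[mu]_x \int[mu]_y (nc (F (x, y)))%:E < +oo)%E ->
  (\int[mu]_x \int[mu]_y `|((p \o F) (x, y))%:E| < +oo)%E.
Proof.
move=> mF mp pn; apply: le_lt_trans.
have m1 : measurable_fun setT (fun z => `|((p \o F) z)%:E|%E).
  by apply: measurableT_comp => //; exact/measurable_EFinP.
have m2 : measurable_fun setT (fun z => (nc (F z))%:E).
  by apply/measurable_EFinP; exact: measurable_normc.
apply: ge0_le_integral => //.
- by move=> x _; exact: integral_ge0.
- exact: (measurable_ge0_integral_prod m1).
- by apply: (measurable_ge0_integral_prod m2) => z; rewrite lee_fin normc_ge0.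
- move=> x _; apply: ge0_le_integral => //.
  + exact: (measurableT_comp m1 (measurable_pair1 x)).
  + exact: (measurableT_comp m2 (measurable_pair1 x)).
  + by move=> y _; rewrite abse_EFin lee_fin; exact: pn.
Qed.

Lemma cintegrable_cintegral_prod (F : R * R -> R[i]) : cmeasurable F ->
  (\int[mu]_x \int[mu]_y (nc (F (x, y)))%:E < +oo)%E ->
  cintegrable (fun x => cintegral setT (fun y => F (x, y))).
Proof.
move=> mF iF; have [F1 F2] := mF; apply: cintegrable_ReIm.
  apply: (integrable_Rintegral_prod F1 _).1.
  exact: (fubini_comp_lty mF F1 (@normr_Re_le R)).
apply: (integrable_Rintegral_prod F2 _).1.
exact: (fubini_comp_lty mF F2 (@normr_Im_le R)).
Qed.

Lemma cintegral_fubini (F : R * R -> R[i]) : cmeasurable F ->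
  (\int[mu]_x \int[mu]_y (nc (F (x, y)))%:E < +oo)%E ->
  cintegral setT (fun x => cintegral setT (fun y => F (x, y))) =
  cintegral setT (fun y => cintegral setT (fun x => F (x, y))).
Proof.
move=> mF iF; have [F1 F2] := mF; rewrite /cintegral; congr Complex.
  apply: (Rintegral_fubini F1).
  exact: (fubini_comp_lty mF F1 (@normr_Re_le R)).
apply: (Rintegral_fubini F2).
exact: (fubini_comp_lty mF F2 (@normr_Im_le R)).
Qed.

Lemma normc_tonelli (F : R * R -> R[i]) : cmeasurable F ->
  (\int[mu]_x \int[mu]_y (nc (F (x, y)))%:E =
   \int[mu]_y \int[mu]_x (nc (F (x, y)))%:E)%E.
Proof.
move=> mF; apply: (@fubini_tonelli _ _ _ _ R mu mu (fun z => (nc (F z))%:E)).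
  by apply/measurable_EFinP; exact: measurable_normc.
by move=> z; rewrite lee_fin normc_ge0.
Qed.

Lemma cdominated_convergence (u : nat -> R -> R[i]) h g :
  (forall n, cmeasurable (u n)) -> cmeasurable h ->
  mu.-integrable setT (EFin \o g) ->
  (forall n x, nc (u n x - h x) <= g x) ->
  (forall x, nc (u n x - h x) @[n --> \oo] --> (0 : R)) ->
  (\int[mu]_x (nc (u n x - h x))%:E)%E @[n --> \oo] --> (0 : \bar R).
Proof.
move=> mu_ mh ig ug uh.
have m1 n : measurable_fun setT (fun x => (nc (u n x - h x))%:E).
  by apply/measurable_EFinP; apply: measurable_normc; exact: cmeasurableB.
have m2 : measurable_fun setT (cst (0 : \bar R) : R -> _) by exact: measurable_cst.
have c1 : {ae mu, forall x, setT x -> (nc (u n x - h x))%:E @[n --> \oo] --> cst (0 : \bar R) x}.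
  by apply: nearW => x _; apply/fine_cvgP; split; [exact: nearW|exact: uh].
have b1 : {ae mu, forall x n, setT x -> (`|(nc (u n x - h x))%:E| <= (EFin \o g) x)%E}.
  by apply: nearW => x n _ /=; rewrite lee_fin ger0_norm ?normc_ge0.
have [_ _] := @dominated_convergence _ _ R mu setT measurableT _ _ _ m1 m2 c1 ig b1.
by rewrite integral0.
Qed.

End complex_integral.

(** * Affine changes of variables on the line *)

Section affine_change_of_variables.
Context {R : realType}.
Local Notation mu := (@lebesgue_measure R).
Local Notation nc := (@Normc.normc R).
Variables a b : R.
Hypothesis a0 : a != 0.

Let aff (x : R) : R := a * x + b.

Lemma measurable_affine : measurable_fun setT aff.
Proof.
by apply: measurable_funD => //; exact: mulrl_measurable.
Qed.

(** [mscale] expects a bundled measure; the existential provides one and remembers only its values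
    on sets. *)
Let pushforward_aff : exists m : {measure set (measurableTypeR R) -> \bar R},
  m = @pushforward _ _ (measurableTypeR R) (measurableTypeR R) R mu aff :> (set _ -> _).
Proof.
have maff : @measurable_fun _ _ (measurableTypeR R) (measurableTypeR R) setT aff.
  exact: measurable_affine.
by unshelve (eexists
  (@pushforward _ _ (measurableTypeR R) (measurableTypeR R) R mu aff)).
Qed.

(** By uniqueness of Lebesgue measure it suffices to compare half-open intervals. For [a < 0] the
    preimage is half open at the other end, which does not change its length. *)
Lemma lebesgue_measure_affine (A : set R) : measurable A ->
  mu A = (`|a|%:E * mu (aff @^-1` A))%E.
Proof.
have [m mE] := pushforward_aff.
pose nu : {measure set (measurableTypeR R) -> \bar R} :=
  mscale (NngNum (normr_ge0 a)) m.
have nuE X : nu X = (`|a|%:E * mu (aff @^-1` X))%E by congr (_ * _)%E; exact: (congr1 (fun f => f X) mE).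
move=> mA; rewrite -nuE.
apply: lebesgue_measure_unique => // X /ocitvP[->|[[c e] /= ce ->]].
  by rewrite !measure0.
rewrite nuE.
have [agt0|alt0] := ltP 0 a.
  rewrite (_ : aff @^-1` _ = `](c - b) / a, (e - b) / a]%classic); last first.
    apply/seteqP; split => x; rewrite /aff /= !in_itv/= => /andP[h1 h2].
      by rewrite ltr_pdivrMr// ler_pdivlMr// mulrC ltrBlDr h1 lerBrDr h2.
    move: h1 h2; rewrite ltr_pdivrMr// ler_pdivlMr// => h1 h2.
    by rewrite -ltrBlDr -lerBrDr mulrC h1.
  have h : (c - b) / a < (e - b) / a by rewrite ltr_pM2r ?invr_gt0// ltrD2r.
  rewrite !lebesgue_measure_itv/= !lte_fin ce h -!EFinD -EFinM gtr0_norm//.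
  by congr EFin; field; rewrite gt_eqF.
have {}alt0 : a < 0 by rewrite lt_neqAle a0.
rewrite (_ : aff @^-1` _ = `[(e - b) / a, (c - b) / a[%classic); last first.
  apply/seteqP; split => x; rewrite /aff /= !in_itv/= => /andP[h1 h2].
    by rewrite ltr_ndivlMr// ler_ndivrMr// mulrC lerBrDr h2 ltrBlDr h1.
  move: h1 h2; rewrite ltr_ndivlMr// ler_ndivrMr// => h1 h2.
  by rewrite -ltrBlDr -lerBrDr mulrC h1 h2.
have h : (e - b) / a < (c - b) / a by rewrite ltr_nM2r ?invr_lt0// ltrD2r.
rewrite !lebesgue_measure_itv/= !lte_fin ce h -!EFinD -EFinM ltr0_norm//.
by congr EFin; field.
Qed.

Lemma ge0_integral_affine (f : R -> \bar R) : measurable_fun setT f ->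
  (forall x, 0 <= f x)%E ->
  (\int[mu]_x f (a * x + b)%R = `|a|^-1%:E * \int[mu]_x f x)%E.
Proof.
move=> mf f0.
have maff : @measurable_fun _ _ (measurableTypeR R) (measurableTypeR R) setT aff.
  exact: measurable_affine.
have [m mE] := pushforward_aff.
pose nu : {measure set (measurableTypeR R) -> \bar R} :=
  mscale (NngNum (normr_ge0 a)) m.
have -> : (\int[mu]_x f x = \int[nu]_x f x)%E.
  apply: eq_measure_integral => A mA _; have e := lebesgue_measure_affine mA.
  by rewrite [LHS]e; congr (_ * _)%E; rewrite mE.
rewrite ge0_integral_mscale// mE ge0_integral_pushforward//.
by rewrite muleA -EFinM mulVf ?normr_eq0// mul1e.
Qed.

Lemma cintegrable_affine (h : R -> R[i]) : cintegrable h ->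
  cintegrable (fun x => h (a * x + b)).
Proof.
move=> [mh ih]; split; first exact: (cmeasurableT_comp mh measurable_affine).
rewrite (ge0_integral_affine (f := fun x => (nc (h x))%:E)).
- by rewrite lte_mul_pinfty// ?lee_fin ?invr_ge0.
- by apply/measurable_EFinP; exact: measurable_normc.
- by move=> x; rewrite lee_fin normc_ge0.
Qed.

Lemma Rintegral_affine (f : R -> R) : mu.-integrable setT (EFin \o f) ->
  Rintegral mu setT (fun x => f (a * x + b)) = `|a|^-1 * Rintegral mu setT f.
Proof.
move=> iF; have mf' := measurable_int _ iF.
rewrite /Rintegral -[RHS](@fineM _ (`|a|^-1%:E)) ?(integrable_fin_num _ iF)//.
congr fine; rewrite [in LHS]integralE [in RHS]integralE.
rewrite (_ : (\int[mu]_x (fun x => (f (a * x + b))%:E)^\+ x =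
   `|a|^-1%:E * \int[mu]_x (EFin \o f)^\+ x)%E); last first.
  rewrite -ge0_integral_affine//; [by apply: eq_integral => y _; rewrite ?funeposE ?funenegE|exact: (measurable_funepos mf')].
rewrite (_ : (\int[mu]_x (fun x => (f (a * x + b))%:E)^\- x =
   `|a|^-1%:E * \int[mu]_x (EFin \o f)^\- x)%E); last first.
  rewrite -ge0_integral_affine//; [by apply: eq_integral => y _; rewrite ?funeposE ?funenegE|exact: (measurable_funeneg mf')].
rewrite -muleBr//; apply: fin_num_adde_defr.
by apply: integrable_fin_num => //; exact: integrable_funepos.
Qed.

Lemma cintegral_affine (h : R -> R[i]) : cintegrable h ->
  cintegral setT (fun x => h (a * x + b)) = (`|a|^-1)%:C * cintegral setT h.
Proof.
move=> ih; rewrite /cintegral; simpc.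
congr Complex; rewrite -Rintegral_affine//; first exact: integrable_Re.
exact: integrable_Im.
Qed.

End affine_change_of_variables.

(** * The Poisson kernel as an approximate identity *)

Section poisson_kernel.
Context {R : realType}.
Local Notation mu := (@lebesgue_measure R).
Local Notation nc := (@Normc.normc R).

(** The weight of Abel summation; its Fourier transform is a multiple of the Cauchy density. *)
Definition expabs (c x : R) : R := expR (- (c * `|x|)).

Lemma expabs_ge0 c x : 0 <= expabs c x. Proof. exact: expR_ge0. Qed.

Lemma expabs_le1 c x : 0 <= c -> expabs c x <= 1.
Proof. by move=> c0; rewrite /expabs -expR0 ler_expR oppr_le0 mulr_ge0. Qed.

Lemma continuous_expabs c : continuous (expabs c).
Proof.
move=> x; apply: continuous_comp; last exact: continuous_expR.
apply: continuousN; apply: continuousM; first exact: cst_continuous.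
exact: norm_continuous.
Qed.

Lemma measurable_expabs c : measurable_fun setT (expabs c).
Proof. by apply: continuous_measurable_fun; exact: continuous_expabs. Qed.

Lemma continuous_cosM (s : R) : continuous (fun x => cos (s * x)).
Proof.
move=> x; apply: continuous_comp; last exact: continuous_cos.
by apply: continuousM; [exact: cst_continuous|exact: cvg_id].
Qed.

(** The summand 1 makes the integrand nonnegative, as the fundamental theorem on a half-line
    requires here. The cosine integral alone is later obtained by subtracting the case [s = 0]. *)
Lemma integral_expabs_1cos (c s : R) : 0 < c ->
  (\int[mu]_x (expabs c x * (1 + cos (s * x)))%:E =
    (2 * (c^-1 + c / (c ^+ 2 + s ^+ 2)))%:E)%E.
Proof.
move=> c0.
have cs0 : c ^+ 2 + s ^+ 2 != 0 by rewrite gt_eqF// ltr_pwDl ?exprn_gt0 ?sqr_ge0.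
have f0 x : 0 <= expabs c x * (1 + cos (s * x)).
  by rewrite mulr_ge0 ?expabs_ge0// -lerBlDl sub0r cos_geN1.
rewrite ge0_symfun_integralT//; first last.
- by move=> x /=; rewrite /expabs normrN mulrN cosN.
- move=> x; apply: continuousM; first exact: continuous_expabs.
  apply: continuousD; first exact: cst_continuous.
  exact: continuous_cosM.
rewrite EFinM; congr (_ * _)%E; rewrite -set_itvcy.
pose f x := expR (- (c * x)) * (1 + cos (s * x)).
(* The fraction is the antiderivative of the cosine part, and [- c^-1] that of the summand 1; both
   decay with the exponential, so only the value at 0 contributes. *)
pose F x := expR (- (c * x)) *
  ((s * sin (s * x) - c * cos (s * x)) / (c ^+ 2 + s ^+ 2) - c^-1).
transitivity (\int[mu]_(x in `[0%R, +oo[) (f x)%:E)%E.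
  apply: eq_integral => x; rewrite inE/= in_itv/= andbT => x0.
  by rewrite /f /expabs ger0_norm.
have F' (x : R) : is_derive x 1 F (f x).
  rewrite /F /f; apply: is_derive_eq.
  rewrite /GRing.scale/= !mulr1 !mulr0 ?add0r ?addr0.
  by field; rewrite gt_eqF.
have cf : continuous f.
  move=> x; apply: (@continuousM _ _ (fun x => expR (- (c * x)))).
    apply: continuous_comp; last exact: continuous_expR.
    apply: continuousN; apply: continuousM; first exact: cst_continuous.
    exact: cvg_id.
  apply: continuousD; first exact: cst_continuous.
  exact: continuous_cosM.
rewrite (@ge0_continuous_FTC2y R f F 0 0).
- rewrite sub0e /F; congr EFin; rewrite !mulr0 oppr0 expR0 sin0 cos0.
  by field; rewrite cs0 gt_eqF.
- by move=> x x0; rewrite mulr_ge0 ?expR_ge0// -lerBlDl sub0r cos_geN1.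
- exact: continuous_subspaceT.
- pose K := (`|s| + c) / (c ^+ 2 + s ^+ 2) + c^-1.
  have FK (x : R) : `|F x| <= K * expR (- (c * x)).
    rewrite /F normrM ger0_norm ?expR_ge0// mulrC ler_wpM2r ?expR_ge0//.
    apply: (le_trans (ler_normB _ _)).
    have c1 : 0 <= c^-1 by rewrite invr_ge0 ltW.
    rewrite /K (ger0_norm c1) lerD2r.
    rewrite normrM normfV (ger0_norm (_ : 0 <= c ^+ 2 + s ^+ 2)) ?addr_ge0 ?sqr_ge0//.
    rewrite ler_wpM2r ?invr_ge0 ?addr_ge0 ?sqr_ge0//.
    apply: (le_trans (ler_normB _ _)); apply: lerD.
      by rewrite normrM ler_piMr// ler_norml sin_geN1 sin_le1.
    by rewrite normrM (gtr0_norm c0) ler_piMr ?(ltW c0)// ler_norml cos_geN1 cos_le1.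
  have E0 : K * expR (- (c * x)) @[x --> +oo] --> (0 : R).
    rewrite -[X in _ --> X](mulr0 K); apply: cvgMr.
    have -> : (fun x => expR (- (c * x))) = (fun x : R => expR (- x)) \o ( *%R c) by [].
    apply: cvg_comp (@cvgr_expR R).
    exact: gt0_cvgMry.
  apply/norm_cvg0P.
  apply: (squeeze_cvgr _ (cvg_cst 0) E0).
  by apply: nearW => x; rewrite normr_ge0 FK.
- by move=> x _; case: (F' x).
- apply: cvg_at_right_filter; apply: differentiable_continuous.
  by apply/derivable1_diffP; case: (F' 0).
- by move=> x _; rewrite derive1E; apply: derive_val.
Qed.

Lemma cintegrable_expabs (c : R) : 0 < c -> cintegrable (fun x => (expabs c x)%:C).
Proof.
move=> c0; split; first by apply: cmeasurable_real; exact: measurable_expabs.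
under eq_integral do rewrite normc_real ger0_norm ?expabs_ge0//.
(* At [s = 0] the formula equates twice the integral with a real number, which rules out an infinite
   value. *)
have : ((1 + 1)%:E * \int[mu]_x (expabs c x)%:E =
    (2 * (c^-1 + c / (c ^+ 2 + 0 ^+ 2)))%:E)%E.
  rewrite -integral_expabs_1cos// -ge0_integralZl//.
  - by apply: eq_integral => x _; rewrite mul0r cos0 mulrC EFinM.
  - by apply/measurable_EFinP; exact: measurable_expabs.
  - by move=> x _; rewrite lee_fin expabs_ge0.
case: (\int[mu]_x (expabs c x)%:E)%E => // [r _|]; first by rewrite ltry.
by rewrite gt0_muley// lte_fin addr_gt0.
Qed.

Lemma Rintegral_expabs_1cos (c s : R) : 0 < c ->
  Rintegral mu setT (expabs c) +
  Rintegral mu setT (fun x => expabs c x * cos (s * x)) =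
  2 * (c^-1 + c / (c ^+ 2 + s ^+ 2)).
Proof.
move=> c0; rewrite -RintegralD//.
- rewrite /Rintegral -[RHS]/(fine (_%:E)) -integral_expabs_1cos//.
  by congr fine; apply: eq_integral => x _; rewrite mulrDr mulr1.
- exact: (integrable_Re (cintegrable_expabs c0)).
have : cintegrable (fun x => (expabs c x)%:C * expi (s * x)).
  apply: (@cintegrableM_bounded _ _ _ 1) (cintegrable_expabs c0).
    by apply: cmeasurable_expi; exact: mulrl_measurable.
  by move=> x; rewrite normc_expi.
by move=> /integrable_Re; apply: eq_integrable => // x _ /=; rewrite mul0r subr0.
Qed.

Lemma cintegral_expabs_expi (c s : R) : 0 < c ->
  cintegral setT (fun x => (expabs c x)%:C * expi (s * x)) =
  (2 * c / (c ^+ 2 + s ^+ 2))%:C.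
Proof.
move=> c0; pose h x := (expabs c x)%:C * expi (s * x).
have ih : cintegrable h.
  apply: (@cintegrableM_bounded _ _ _ 1) (cintegrable_expabs c0).
    by apply: cmeasurable_expi; exact: mulrl_measurable.
  by move=> x; rewrite normc_expi.
rewrite /cintegral; congr Complex.
  have h1 := Rintegral_expabs_1cos 0 c0.
  have h2 := Rintegral_expabs_1cos s c0.
  rewrite (_ : Rintegral _ _ (_ \o _) = Rintegral mu setT (fun x => expabs c x * cos (s * x))); last first.
    by apply: eq_Rintegral => x _ /=; rewrite mul0r subr0.
  have h3 : Rintegral mu setT (fun x => expabs c x * cos (0 * x)) = Rintegral mu setT (expabs c).
    by apply: eq_Rintegral => x _ /=; rewrite mul0r cos0 mulr1.
  rewrite h3 in h1.
  have {}h1 : Rintegral mu setT (expabs c) = 2 / c.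
    apply: (mulfI (_ : 2 != 0)); first by rewrite gt_eqF.
    by rewrite mulr_natl mulr2n h1; field; rewrite gt_eqF.
  have cs0 : c ^+ 2 + s ^+ 2 != 0 by rewrite gt_eqF// ltr_pwDl ?exprn_gt0 ?sqr_ge0.
  apply: (addrI (Rintegral mu setT (expabs c))); rewrite h2 h1.
  by field; rewrite cs0 gt_eqF.
(* The imaginary part is odd: the substitution of [- x] for [x] shows that its integral equals its
   own opposite. *)
have := @Rintegral_affine R (-1) 0 (_ : -1 != 0) _ (integrable_Im ih).
rewrite normrN1 invr1 mul1r => /(_ _) e.
set I := Rintegral _ _ _; suff : I = - I by lra.
rewrite {1}/I -e; last by rewrite oppr_eq0 oner_eq0.
rewrite /I -[RHS]mulN1r -RintegralZl//; last exact: integrable_Im ih.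
apply: eq_Rintegral => x _ /=.
by rewrite mulN1r addr0 /expabs normrN mulrN sinN cosN; ring.
Qed.

Definition poisson (e u : R) : R := e / (pi * (e ^+ 2 + u ^+ 2)).

Lemma poisson_ge0 e u : 0 <= e -> 0 <= poisson e u.
Proof.
by move=> e0; rewrite /poisson divr_ge0// mulr_ge0 ?pi_ge0// addr_ge0 ?sqr_ge0.
Qed.

Lemma poissonN e u : poisson e (- u) = poisson e u.
Proof. by rewrite /poisson sqrrN. Qed.

Lemma continuous_inv_sqr : continuous (fun x : R => (1 + x ^+ 2)^-1).
Proof.
move=> x; apply: cvgV; first by rewrite gt_eqF// ltr_pwDl ?sqr_ge0.
apply: cvgD; first exact: cvg_cst.
exact: exprn_continuous.
Qed.

(** A rescaled copy of the derivative of [atan]. The argument keeps the affine form, [+ 0] included,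
    that [measurable_affine] expects. *)
Lemma poissonE e u : 0 < e ->
  poisson e u = (pi * e)^-1 * (1 + (e^-1 * u + 0) ^+ 2)^-1.
Proof.
move=> e0; rewrite /poisson addr0 exprMn; move: (pi : R) (@pi_gt0 R) => P P0.
field; apply/and3P; split.
- by rewrite gt_eqF.
- by rewrite gt_eqF// ltr_pwDl ?exprn_gt0 ?sqr_ge0.
- by rewrite gt_eqF.
Qed.

Lemma measurable_poisson e : 0 < e -> measurable_fun setT (poisson e).
Proof.
move=> e0; rewrite (_ : poisson e = fun u => (pi * e)^-1 * (1 + (e^-1 * u + 0) ^+ 2)^-1).
  apply: measurable_funM => //.
  apply: (@measurableT_comp _ _ _ _ _ _ (fun x : R => (1 + x ^+ 2)^-1)).
    by apply: continuous_measurable_fun; exact: continuous_inv_sqr.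
  exact: measurable_affine.
by apply/funext => u; exact: poissonE.
Qed.

Lemma poisson_le e u : 0 < e -> poisson e u <= (pi * e)^-1.
Proof.
move=> e0; have pe0 : 0 <= (pi * e)^-1 by rewrite invr_ge0 mulr_ge0 ?pi_ge0 ?ltW.
rewrite poissonE// ler_piMr//.
by rewrite invf_le1 ?ltr_pwDl ?sqr_ge0// lerDl sqr_ge0.
Qed.

Lemma integral_inv_sqr : (\int[mu]_x ((1 + x ^+ 2)^-1)%:E = (@pi R)%:E)%E.
Proof.
rewrite ge0_symfun_integralT//; first last.
- by move=> x /=; rewrite sqrrN.
- exact: continuous_inv_sqr.
- by move=> x; rewrite invr_ge0 addr_ge0 ?sqr_ge0.
rewrite -set_itvcy (@ge0_continuous_FTC2y R _ atan 0 (pi / 2)).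
- by rewrite atan0 sube0 -EFinM mulrC divfK.
- by move=> x _; rewrite invr_ge0 addr_ge0 ?sqr_ge0.
- by apply: continuous_subspaceT; exact: continuous_inv_sqr.
- exact: cvgy_atan.
- by move=> x _; exact: derivable_atan.
- by apply: cvg_at_right_filter; exact: continuous_atan.
- by move=> x _; rewrite derive1_atan.
Qed.

Lemma integral_poisson e a : 0 < e -> (\int[mu]_x (poisson e (x - a))%:E = 1)%E.
Proof.
move=> e0.
have h (x : R) : (poisson e (x - a))%:E =
  ((pi * e)^-1%:E * ((1 + (e^-1 * x + (- a / e)) ^+ 2)^-1)%:E)%E.
  rewrite poissonE// -EFinM; congr (_ * (1 + _ ^+ 2)^-1)%:E.
  by field; rewrite gt_eqF.
have pe0 : 0 <= (pi * e)^-1 by rewrite invr_ge0 mulr_ge0 ?pi_ge0 ?ltW.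
have mi : measurable_fun setT (fun x : R => ((1 + x ^+ 2)^-1)%:E).
  by apply/measurable_EFinP; apply: continuous_measurable_fun; exact: continuous_inv_sqr.
have i0 (x : R) : (0 <= ((1 + x ^+ 2)^-1)%:E)%E.
  by rewrite lee_fin invr_ge0 addr_ge0 ?sqr_ge0.
under eq_integral do rewrite h.
rewrite ge0_integralZl//; last first.
  by apply: (measurableT_comp mi); exact: measurable_affine.
rewrite (ge0_integral_affine _ _ mi)// ?invr_eq0 ?gt_eqF// integral_inv_sqr.
rewrite -!EFinM ger0_norm ?invr_ge0 ?ltW// invrK.
congr EFin; move: (pi : R) (@pi_gt0 R) => P P0.
by field; rewrite !gt_eqF.
Qed.

End poisson_kernel.

(** * Null sequences of nonnegative extended reals *)

Section ereal_limits.
Context {R : realType}.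
Implicit Types u : nat -> \bar R.

Lemma cvge0P u : (forall n, 0 <= u n)%E ->
  u @ \oo --> (0 : \bar R) <->
  (forall e : R, 0 < e -> \forall n \near \oo, (u n <= e%:E)%E).
Proof.
move=> u0; split.
  move=> /fine_cvgP[ufin /cvgrPdist_le h] e e0.
  move: (h e e0) ufin; apply: filterS2 => n; rewrite sub0r normrN => he fn.
  by rewrite -(fineK fn) lee_fin (le_trans (ler_norm _)).
move=> h; apply/fine_cvgP; split.
  move: (h 1 ltr01); apply: filterS => n h1.
  by rewrite ge0_fin_numE// (le_lt_trans h1)// ltry.
apply/cvgrPdist_le => e e0; move: (h e e0); apply: filterS => n hn.
rewrite sub0r normrN ger0_norm ?fine_ge0//= -lee_fin fineK//.
by rewrite ge0_fin_numE// (le_lt_trans hn)// ltry.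
Qed.

Lemma squeeze_cvge0 u v : (forall n, 0 <= u n)%E -> (forall n, u n <= v n)%E ->
  v @ \oo --> (0 : \bar R) -> u @ \oo --> (0 : \bar R).
Proof.
move=> u0 uv; have v0 n : (0 <= v n)%E by exact: le_trans (u0 n) (uv n).
move=> /(cvge0P v0) h; apply/(cvge0P u0) => e /h; apply: filterS => n.
exact: le_trans.
Qed.

Lemma cvge0D u v : (forall n, 0 <= u n)%E -> (forall n, 0 <= v n)%E ->
  u @ \oo --> (0 : \bar R) -> v @ \oo --> (0 : \bar R) ->
  (u n + v n)%E @[n --> \oo] --> (0 : \bar R).
Proof.
by move=> u0 v0 cu cv; rewrite -[X in _ --> X]adde0; apply: cvgeD.
Qed.

End ereal_limits.

(** * Approximation in L1 by compactly supported continuous functions *)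

Section approximate_identity.
Context {R : realType}.
Local Notation mu := (@lebesgue_measure R).
Local Notation nc := (@Normc.normc R).

(* Continuous cutoff: 1 on [[-N, N]], 0 outside [[-N-1, N+1]]. *)
Definition tent (N x : R) : R := (`|N + 1 - `|x| | - `|N - `|x| | + 1) / 2.

Lemma continuous_tent N : continuous (tent N).
Proof.
have h (c : R) : continuous (fun x : R => `|c - `|x| |).
  move=> x; apply: (@cvg_norm _ R); apply: cvgB; first exact: cvg_cst.
  exact: norm_continuous.
by move=> x; apply: cvgMl; apply: cvgD; [apply: cvgB; exact: h|exact: cvg_cst].
Qed.

Lemma tent_ge0 N x : 0 <= tent N x.
Proof.
rewrite /tent; move: `|x| => t.
by case: (ger0P (N + 1 - t)); case: (ger0P (N - t)); lra.
Qed.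

Lemma tent_le1 N x : tent N x <= 1.
Proof.
rewrite /tent; move: `|x| => t.
by case: (ger0P (N + 1 - t)); case: (ger0P (N - t)); lra.
Qed.

Lemma tent_eq1 N x : `|x| <= N -> tent N x = 1.
Proof.
rewrite /tent; move: `|x| => t.
by case: (ger0P (N + 1 - t)); case: (ger0P (N - t)); lra.
Qed.

Lemma tent_eq0 N x : N + 1 <= `|x| -> tent N x = 0.
Proof.
rewrite /tent; move: `|x| => t.
by case: (ger0P (N + 1 - t)); case: (ger0P (N - t)); lra.
Qed.


Lemma integral_tent_cvg (g : R -> R) : mu.-integrable setT (EFin \o g) ->
  (\int[mu]_x (`|g x - g x * tent n%:R x|)%:E)%E @[n --> \oo] --> (0 : \bar R).
Proof.
move=> ig; have mg : measurable_fun setT g by apply/measurable_EFinP; case/integrableP: ig.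
have ig' : mu.-integrable setT (EFin \o (fun x => `|g x|)).
  exact: integrable_abse ig.
have m1 n : measurable_fun setT (fun x => (`|g x - g x * tent n%:R x|)%:E).
  apply/measurable_EFinP; apply: measurableT_comp => //.
  apply: measurable_funB => //; apply: measurable_funM => //.
  by apply: continuous_measurable_fun; exact: continuous_tent.
have m2 : measurable_fun setT (cst (0 : \bar R) : R -> _) by exact: measurable_cst.
have c1 : {ae mu, forall x, setT x ->
    (`|g x - g x * tent n%:R x|)%:E @[n --> \oo] --> cst (0 : \bar R) x}.
  apply: nearW => x _; apply: (cvg_near_cst (0 : \bar R)).
  have [k xk] : exists k : nat, `|x| <= k%:R.
    by exists (Num.bound `|x|); apply/ltW/archi_boundP.
  near=> n; apply/eqP; rewrite tent_eq1 ?mulr1 ?subrr ?normr0//.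
  apply: (le_trans xk); rewrite ler_nat; near: n; exact: nbhs_infty_ge.
have b1 : {ae mu, forall x n, setT x ->
    (`|(`|g x - g x * tent n%:R x|)%:E| <= (EFin \o (fun x => `|g x|%R)) x)%E}.
  apply: nearW => x n _ /=; rewrite lee_fin normr_id.
  rewrite -[X in X - _]mulr1 -mulrBr normrM ler_piMr//.
  by rewrite ger0_norm ?subr_ge0 ?tent_le1// lerBlDr lerDl tent_ge0.
have [_ _] := @dominated_convergence _ _ R mu setT measurableT _ _ _ m1 m2 c1 ig' b1.
by rewrite integral0.
Unshelve. all: by end_near. Qed.

(** The witness is [h * tent], with [h] continuous and close to [g] on an interval outside which the
    tent vanishes. The error splits into the cost of cutting off [g] and that of replacing [g] by
    [h] under a factor in [[0, 1]], half of [e] each. The uniform bound is the maximum of [h] in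
    modulus on the interval. *)
Lemma approximation_compact_support (g : R -> R) (e : R) : 0 < e ->
  mu.-integrable setT (EFin \o g) ->
  exists k : R -> R, exists N : R, exists M : R,
    [/\ continuous k, forall x, N <= `|x| -> k x = 0, forall x, `|k x| <= M &
     (\int[mu]_x (`|g x - k x|)%:E <= e%:E)%E].
Proof.
move=> e0 ig; have mg : measurable_fun setT g by apply/measurable_EFinP; case/integrableP: ig.
have e20 : 0 < e / 2 by rewrite divr_gt0.
have mt N : measurable_fun setT (tent N).
  by apply: continuous_measurable_fun; exact: continuous_tent.
have [n hn] : exists n : nat, (\int[mu]_x (`|g x - g x * tent n%:R x|)%:E <= (e / 2)%:E)%E.
  have := integral_tent_cvg ig; move/cvge0P => /(_ _ _ e20)[|n _ h].
    by move=> n; apply: integral_ge0 => x _; rewrite lee_fin.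
  by exists n; exact: (h n (leqnn n)).
(* The tent of parameter [n] reaches 0 only at distance [n + 1]. *)
pose N : R := n%:R + 1; have N0 : 0 <= N by rewrite addr_ge0.
pose E := `[- N, N]%classic : set R.
have mE : measurable E by exact: measurable_itv.
have NN : - N <= N by rewrite (le_trans _ N0)// oppr_le0.
have fE : (mu E < +oo)%E.
  by rewrite lebesgue_measure_itv/=; case: ifP => _; rewrite -?EFinB ltry.
have igE : mu.-integrable E (EFin \o g) by exact: (integrableS measurableT).
have [h_ [ch ih hcvg]] := approximation_continuous_integrable mE fE igE.
have [m hm] : exists m : nat, (\int[mu]_(x in E) `|(g x - h_ m x)%:E| <= (e / 2)%:E)%E.
  move: hcvg; move/cvge0P => /(_ _ _ e20)[|m _ h].
    by move=> m; apply: integral_ge0 => x _.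
  by exists m; exact: (h m (leqnn m)).
pose h := h_ m; exists (fun x => h x * tent n%:R x), N.
have cw : {within `[- N, N], continuous (fun x => `|h x|)}.
  by apply: continuous_subspaceT => x; apply: (@cvg_norm _ R); exact: ch.
have [c _ hc] := EVT_max NN cw.
have {}hc x : `|x| <= N -> `|h x| <= `|h c|.
  by move=> xN; apply: hc; rewrite in_itv/= -ler_norml.
have Et x : ~ E x -> tent n%:R x = 0.
  move=> nE; apply: tent_eq0; rewrite leNgt; apply/negP => xN; apply: nE.
  by rewrite /E /= in_itv/= -ler_norml ltW.
exists `|h c|; split.
- by move=> x; apply: cvgM; [exact: ch|exact: continuous_tent].
- by move=> x xN; rewrite tent_eq0 ?mulr0.
- move=> x; rewrite normrM (ger0_norm (tent_ge0 _ _)).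
  have [xN|/ltW xN] := leP `|x| N.
    by rewrite (le_trans _ (hc _ xN))// ler_piMr// tent_le1.
  by rewrite tent_eq0// mulr0.
have mh : measurable_fun setT h by apply: continuous_measurable_fun; exact: ch.
have m1 : measurable_fun setT (fun x => (`|g x - h x * tent n%:R x|)%:E).
  apply/measurable_EFinP; apply: measurableT_comp => //.
  by apply: measurable_funB => //; exact: measurable_funM.
have m2 : measurable_fun setT (fun x => (`|g x - g x * tent n%:R x|)%:E).
  apply/measurable_EFinP; apply: measurableT_comp => //.
  by apply: measurable_funB => //; exact: measurable_funM.
have m4 : measurable_fun [set: R] (fun x => `|(g x - h x)%:E|%E).
  apply: measurableT_comp => //; apply/measurable_EFinP; exact: measurable_funB.
have m3 : measurable_fun setT ((fun x => `|(g x - h x)%:E|%E) \_ E).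
  have := (measurable_restrictT (fun x => `|(g x - h x)%:E|%E) mE).1; apply.
  exact: measurable_funTS.
apply: (@le_trans _ _ (\int[mu]_x (((`|g x - g x * tent n%:R x|)%:E) +
    ((fun x => `|(g x - h x)%:E|) \_ E) x))%E).
  apply: ge0_le_integral => //.
  - exact: emeasurable_funD.
  - move=> x _; rewrite patchE; case: ifPn => [xE|/negP xE].
      rewrite abse_EFin -EFinD lee_fin.
      apply: (@le_trans _ _ (`|g x - g x * tent n%:R x| + `|(g x - h x) * tent n%:R x|)).
        by rewrite mulrBl; apply: le_trans (ler_normD _ _); rewrite addrA subrK.
      rewrite lerD2l normrM ler_piMr// (ger0_norm (tent_ge0 _ _)); exact: tent_le1.
    by rewrite Et ?mulr0 ?adde0//; move=> /mem_set.
rewrite ge0_integralD//.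
- rewrite -integral_mkcond [X in (_ <= X)%E](_ : _ = (e / 2)%:E + (e / 2)%:E)%E.
    exact: leeD.
  by rewrite -EFinD -splitr.
- by move=> x _; rewrite patchE; case: ifP.
Qed.

End approximate_identity.

(** * Continuity of translations in L1 *)

Section translation.
Context {R : realType}.
Local Notation mu := (@lebesgue_measure R).
Local Notation nc := (@Normc.normc R).

Lemma ge0_integral_translate (f : R -> \bar R) (s : R) : measurable_fun setT f ->
  (forall x, 0 <= f x)%E -> (\int[mu]_x f (x + s)%R = \int[mu]_x f x)%E.
Proof.
move=> mf f0; have := ge0_integral_affine s (oner_neq0 R) mf f0.
by rewrite normr1 invr1 mul1e => <-; apply: eq_integral => x _; rewrite mul1r.
Qed.

Lemma measurable_translate (s : R) : measurable_fun [set: R] (fun x => x + s).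
Proof. by apply: measurable_funD. Qed.

(** Dominated convergence: since the shifts stay within [B], both [k] and its translates vanish
    outside the interval of radius [|N| + B], where [M + M] bounds their difference. *)
Lemma continuous_translate_L1 (k : R -> R) (N M B : R) (s : nat -> R) :
  continuous k -> (forall x, N <= `|x| -> k x = 0) -> (forall x, `|k x| <= M) ->
  s @ \oo --> (0 : R) -> (forall n, `|s n| <= B) ->
  (\int[mu]_a (`|k (a + s n) - k a|)%:E)%E @[n --> \oo] --> (0 : \bar R).
Proof.
move=> ck kN kM s0 sB.
have mk : measurable_fun setT k by exact: continuous_measurable_fun.
have mks t : measurable_fun [set: R] (fun x => k (x + t)).
  exact: (measurableT_comp mk (measurable_translate t)).
have M0 : 0 <= M by rewrite (le_trans _ (kM 0)).
pose E := `[- (`|N| + B), `|N| + B]%classic : set R.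
have mE : measurable E by exact: measurable_itv.
pose G x := (M + M) * \1_E x.
have iG : mu.-integrable setT (EFin \o G).
  have i1 : mu.-integrable setT (EFin \o \1_E).
    apply/integrableP; split.
      by apply/measurable_EFinP; exact: measurable_indic.
    under eq_integral do rewrite /= ger0_norm//.
    rewrite integral_indic// setIT.
    by have := lebesgue_measure_itv `[- (`|N| + B), `|N| + B] => /= ->;
      case: ifP => _; rewrite -?EFinB ltry.
  by have := @integrableZl _ _ _ mu setT measurableT (M + M) _ i1.
have m1 n : measurable_fun [set: R] (fun x => (`|k (x + s n) - k x|)%:E).
  by apply/measurable_EFinP; apply: measurableT_comp => //; exact: measurable_funB.
have m2 : measurable_fun setT (cst (0 : \bar R) : R -> _) by exact: measurable_cst.
have c1 : {ae mu, forall x, setT x ->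
    (`|k (x + s n) - k x|)%:E @[n --> \oo] --> cst (0 : \bar R) x}.
  apply: nearW => x _; apply/fine_cvgP; split; first exact: nearW.
  suff : `|k (x + s n) - k x| @[n --> \oo] --> (0 : R) by [].
  apply/(@norm_cvg0P _ R); rewrite -[X in _ --> X](subrr (k x)).
  apply: cvgB; last exact: cvg_cst.
  apply: (continuous_cvg _ (ck x)).
  by rewrite -[X in _ --> X](addr0 x); apply: cvgD => //; exact: cvg_cst.
have b1 : {ae mu, forall x n, setT x ->
    (`|(`|k (x + s n) - k x|)%:E| <= (EFin \o G) x)%E}.
  apply: nearW => x n _ /=; rewrite lee_fin normr_id /G indicE.
  have [xE|/negP xE] := boolP (x \in E).
    by rewrite mulr1 (le_trans (ler_normB _ _))// lerD.
  have xN : `|N| + B < `|x|.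
    rewrite ltNge; apply/negP => h; apply: xE; apply/mem_set.
    by rewrite /E /= in_itv/= -ler_norml.
  have B0 : 0 <= B by rewrite (le_trans _ (sB 0%N)).
  rewrite !kN ?subrr ?normr0 ?mulr0//.
    by rewrite (le_trans (ler_norm N))// (le_trans _ (ltW xN))// lerDl.
  rewrite (le_trans (ler_norm N))//.
  have := lerB_dist x (- s n); rewrite opprK normrN.
  by have := sB n; lra.
have [_ _] := @dominated_convergence _ _ R mu setT measurableT _ _ _ m1 m2 c1 iG b1.
by rewrite integral0.
Qed.

(** Approximation by a compactly supported continuous [k], each of three terms costing [e / 3]:
    translation invariance makes the distance between the translates of [g] and [k] equal to that
    between [g] and [k]. *)
Lemma translation_L1 (g : R -> R) (s : nat -> R) (B : R) :
  mu.-integrable setT (EFin \o g) ->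
  s @ \oo --> (0 : R) -> (forall n, `|s n| <= B) ->
  (\int[mu]_a (`|g (a + s n) - g a|)%:E)%E @[n --> \oo] --> (0 : \bar R).
Proof.
move=> ig s0 sB.
have mg : measurable_fun setT g by apply/measurable_EFinP; case/integrableP: ig.
have mgs t : measurable_fun [set: R] (fun x => g (x + t)).
  exact: (measurableT_comp mg (measurable_translate t)).
apply/cvge0P => [n|e e0]; first by apply: integral_ge0 => x _; rewrite lee_fin.
have e30 : 0 < e / 3 by rewrite divr_gt0.
have [k [N [M [ck kN kM gk]]]] := approximation_compact_support e30 ig.
have mk : measurable_fun setT k by exact: continuous_measurable_fun.
have mks t : measurable_fun [set: R] (fun x => k (x + t)).
  exact: (measurableT_comp mk (measurable_translate t)).
have := continuous_translate_L1 ck kN kM s0 sB.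
move/cvge0P => /(_ _ _ e30) h0.
have h : \forall n \near \oo, (\int[mu]_a (`|k (a + s n) - k a|)%:E <= (e / 3)%:E)%E.
  by apply: h0 => n; apply: integral_ge0 => x _; rewrite lee_fin.
near=> n.
have m1 : measurable_fun [set: R] (fun x => (`|g x - k x|)%:E).
  by apply/measurable_EFinP; apply: measurableT_comp => //; exact: measurable_funB.
have m2 : measurable_fun [set: R] (fun x => (`|g (x + s n) - k (x + s n)|)%:E).
  by apply/measurable_EFinP; apply: measurableT_comp => //; exact: measurable_funB.
have m3 : measurable_fun [set: R] (fun x => (`|k (x + s n) - k x|)%:E).
  by apply/measurable_EFinP; apply: measurableT_comp => //; exact: measurable_funB.
have m4 : measurable_fun [set: R] (fun x => (`|g (x + s n) - g x|)%:E).
  by apply/measurable_EFinP; apply: measurableT_comp => //; exact: measurable_funB.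
have m5 : measurable_fun [set: R] (fun x => (`|g (x + s n) - k (x + s n)|)%:E +
   (`|k (x + s n) - k x|)%:E)%E by exact: emeasurable_funD.
apply: (@le_trans _ _ (\int[mu]_x ((`|g (x + s n) - k (x + s n)|)%:E +
   (`|k (x + s n) - k x|)%:E + (`|g x - k x|)%:E))%E).
  apply: ge0_le_integral => //; first exact: emeasurable_funD.
  move=> x _; rewrite -!EFinD lee_fin.
  rewrite [X in _ <= _ + X]distrC.
  apply: le_trans (lerD (ler_normD _ _) (lexx _)).
  apply: le_trans (ler_normD _ _).
  by rewrite !addrA !subrK.
rewrite ge0_integralD//.
rewrite ge0_integralD//.
rewrite (ge0_integral_translate (f := fun x => (`|g x - k x|)%:E))//.
rewrite (_ : e%:E = (e / 3)%:E + (e / 3)%:E + (e / 3)%:E)%E; last first.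
  by rewrite -!EFinD; congr EFin; field.
apply: leeD => //; apply: leeD => //.
  by near: n; exact: h.
by move=> x _; rewrite adde_ge0// lee_fin.
Unshelve. all: by end_near. Qed.

Lemma ctranslation_L1 (g : R -> R[i]) (s : nat -> R) (B : R) :
  cintegrable g -> s @ \oo --> (0 : R) -> (forall n, `|s n| <= B) ->
  (\int[mu]_a (nc (g (a + s n) - g a))%:E)%E @[n --> \oo] --> (0 : \bar R).
Proof.
move=> ig s0 sB.
have h1 := translation_L1 (integrable_Re ig) s0 sB.
have h2 := translation_L1 (integrable_Im ig) s0 sB.
have [m1 m2] := ig.1.
have ms1 t : measurable_fun [set: R] (fun x => complex.Re (g (x + t))).
  exact: (measurableT_comp m1 (measurable_translate t)).
have ms2 t : measurable_fun [set: R] (fun x => complex.Im (g (x + t))).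
  exact: (measurableT_comp m2 (measurable_translate t)).
have ma n : measurable_fun [set: R] (fun a => (`|complex.Re (g (a + s n)) - complex.Re (g a)|)%:E).
  by apply/measurable_EFinP; apply: measurableT_comp => //; exact: measurable_funB.
have mb n : measurable_fun [set: R] (fun a => (`|complex.Im (g (a + s n)) - complex.Im (g a)|)%:E).
  by apply/measurable_EFinP; apply: measurableT_comp => //; exact: measurable_funB.
apply: (squeeze_cvge0 _ _ (cvge0D _ _ h1 h2)) => n; try (by apply: integral_ge0 => x _; rewrite lee_fin ?normc_ge0).
rewrite -ge0_integralD//.
apply: ge0_le_integral => //.
- by move=> x _; rewrite lee_fin normc_ge0.
- apply/measurable_EFinP; apply: measurable_normc; apply: cmeasurableB.
    exact: (cmeasurableT_comp ig.1 (measurable_translate _)).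
  exact: ig.1.
- exact: (emeasurable_funD (ma n) (mb n)).
- move=> x _; rewrite -EFinD lee_fin; apply: le_trans (normc_le_ReIm _) _.
  by rewrite /comp; case: (g (x + s n)) (g x) => a b [c d].
- exact: ma.
- exact: mb.
Qed.

End translation.

(** * Convergence of Poisson averages in L1 *)

Section poisson_average.
Context {R : realType}.
Local Notation mu := (@lebesgue_measure R).
Local Notation nc := (@Normc.normc R).

(** A fixed sequence of scales, because dominated convergence and Fatou's lemma are applied along
    sequences. Staying below 1 keeps the shifts [vanishing k * v] bounded for each [v]. *)
Definition vanishing (k : nat) : R := k.+1%:R^-1.

Lemma vanishing_gt0 k : 0 < vanishing k.
Proof. by rewrite /vanishing invr_gt0. Qed.

Lemma vanishing_le1 k : vanishing k <= 1.
Proof. by rewrite /vanishing invf_le1// ler1n. Qed.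

Lemma cvg_vanishing : vanishing @ \oo --> (0 : R).
Proof. exact: cvg_harmonic. Qed.

Lemma cintegrable_poisson e : 0 < e ->
  cintegrable (fun x : R => (poisson e x)%:C).
Proof.
move=> e0; split; first by apply: cmeasurable_real; exact: measurable_poisson.
under eq_integral do rewrite normc_real ger0_norm ?poisson_ge0 ?(ltW e0)//.
rewrite [X in (X < _)%E](_ : _ = 1%E) ?ltry//.
by rewrite -(integral_poisson 0 e0); apply: eq_integral => x _; rewrite subr0.
Qed.

Lemma cintegral_poisson e : 0 < e ->
  cintegral setT (fun x : R => (poisson e x)%:C) = 1.
Proof.
move=> e0; rewrite /cintegral; congr Complex; last first.
  rewrite (_ : _ \o _ = fun=> 0)//.
  by rewrite /Rintegral integral0.
have h := integral_poisson 0 e0.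
rewrite /Rintegral -[RHS]/(fine 1%E) -h; congr fine.
by apply: eq_integral => x _; rewrite subr0.
Qed.

(** The substitution [w = a + e * v] and the total mass 1 of the kernel move the scale [e] from the
    kernel to a translation of [g]. *)
Lemma poisson_average_subE (g : R -> R[i]) (e a : R) : cintegrable g -> 0 < e ->
  cintegral setT (fun w => g w * (poisson e (w - a))%:C) - g a =
  cintegral setT (fun v => (g (a + e * v) - g a) * (poisson 1 v)%:C).
Proof.
move=> ig e0.
have mP t b : 0 < t -> cmeasurable (fun w : R => (poisson t (w - b))%:C).
  move=> t0; apply: cmeasurable_real.
  exact: (measurableT_comp (measurable_poisson t0) (measurable_translate (- b))).
have bP t b w : 0 < t -> nc (poisson t (w - b))%:C <= (pi * t)^-1.
  move=> t0; rewrite normc_real ger0_norm ?poisson_ge0 ?(ltW t0)//.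
  exact: poisson_le.
have iP : cintegrable (fun w => g w * (poisson e (w - a))%:C).
  by apply: (cintegrableM_bounded (mP _ a e0) _ ig) => w; exact: bP.
have h := cintegral_affine a (lt0r_neq0 e0) iP.
have i1 : cintegrable (fun v => g (a + e * v) * (poisson 1 v)%:C).
  have ig' : cintegrable (fun v => g (a + e * v)).
    rewrite (_ : (fun _ => _) = (fun v => g (e * v + a))).
      exact: cintegrable_affine (lt0r_neq0 e0) _ ig.
    by apply/funext => v; rewrite addrC.
  apply: (@cintegrableM_bounded _ _ _ (pi * 1)^-1) ig'.
    by apply: cmeasurable_real; exact: measurable_poisson.
  by move=> v; have := @bP 1 0 v ltr01; rewrite subr0.
have i2 : cintegrable (fun v => g a * (poisson 1 v)%:C).
  exact: cintegrableZ (cintegrable_poisson ltr01).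
rewrite (_ : (fun v => (_ - _) * _) =
  (fun v => g (a + e * v) * (poisson 1 v)%:C - g a * (poisson 1 v)%:C)); last first.
  by apply/funext => v; rewrite mulrBl.
rewrite cintegralB// cintegralZl; last exact: cintegrable_poisson.
rewrite cintegral_poisson// mulr1; congr (_ - _).
have -> : cintegral setT (fun v => g (a + e * v) * (poisson 1 v)%:C) =
    e%:C * cintegral setT (fun v => g (e * v + a) * (poisson e (e * v + a - a))%:C).
  rewrite -cintegralZl; last exact: cintegrable_affine (lt0r_neq0 e0) _ iP.
  congr (cintegral setT); apply/funext => v.
  rewrite mulrCA [e * v + a]addrC addrAC subrr add0r -rmorphM.
  congr (_ * _%:C); rewrite /poisson.
  have -> : e ^+ 2 + (e * v) ^+ 2 = e * e * (1 ^+ 2 + v ^+ 2) by ring.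
  have v0 : 1 ^+ 2 + v ^+ 2 != 0 by rewrite gt_eqF// ltr_pwDl ?sqr_ge0// exprn_gt0.
  move: (1 ^+ 2 + v ^+ 2) v0 => V V0; move: (pi : R) (@pi_gt0 R) => P P0.
  by field; rewrite V0 !gt_eqF.
rewrite h mulrA -rmorphM gtr0_norm// divff ?gt_eqF//.
by rewrite mul1r.
Qed.

(** Minkowski's integral inequality in L1, which is Tonelli's theorem: the error is an average,
    against a fixed kernel, of L1 distances between [g] and its translates. *)
Lemma poisson_average_le (g : R -> R[i]) (e : R) : cintegrable g -> 0 < e ->
  (\int[mu]_a (nc (cintegral setT (fun w => g w * (poisson e (w - a))%:C) - g a))%:E
  <= \int[mu]_v ((poisson 1 v)%:E * \int[mu]_a (nc (g (a + e * v) - g a))%:E))%E.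
Proof.
move=> ig e0.
have mg2 : cmeasurable (fun z : R * R => (g (z.1 + e * z.2) - g z.1) * (poisson 1 z.2)%:C).
  apply: cmeasurableM; first apply: cmeasurableB.
  - apply: (cmeasurableT_comp ig.1).
    by apply: measurable_funD => //; apply: measurable_funM.
  - exact: (cmeasurableT_comp ig.1).
  - apply: cmeasurable_real.
    exact: (measurableT_comp (measurable_poisson ltr01)).
have iF a : cintegrable (fun v => (g (a + e * v) - g a) * (poisson 1 v)%:C).
  have ig' : cintegrable (fun v => g (a + e * v)).
    rewrite (_ : (fun _ => _) = (fun v => g (e * v + a))).
      exact: cintegrable_affine (lt0r_neq0 e0) _ ig.
    by apply/funext => v; rewrite addrC.
  rewrite (_ : (fun _ => _) =
    (fun v => g (a + e * v) * (poisson 1 v)%:C - g a * (poisson 1 v)%:C)); last first.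
    by apply/funext => v; rewrite mulrBl.
  apply: cintegrableB; last exact: cintegrableZ (cintegrable_poisson ltr01).
  apply: (@cintegrableM_bounded _ _ _ (pi * 1)^-1) ig'.
    by apply: cmeasurable_real; exact: measurable_poisson.
  by move=> v; rewrite normc_real ger0_norm ?poisson_ge0//; exact: poisson_le.
under eq_integral do rewrite poisson_average_subE//.
have mN : measurable_fun [set: R * R] (fun z : R * R => (nc ((g (z.1 + e * z.2) - g z.1) * (poisson 1 z.2)%:C))%:E).
  by apply/measurable_EFinP; exact: measurable_normc mg2.
apply: (@le_trans _ _ (\int[mu]_a \int[mu]_v (nc ((g (a + e * v) - g a) * (poisson 1 v)%:C))%:E)%E).
  apply: ge0_le_integral => //.
  - by move=> a _; rewrite lee_fin normc_ge0.
  - apply/measurable_EFinP; apply: measurable_normc.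
    exact: (cmeasurable_cintegral_prod mg2).
  - by apply: (measurable_ge0_integral_prod mN) => z; rewrite lee_fin normc_ge0.
  - by move=> a _; exact: normc_cintegral_le.
rewrite (normc_tonelli mg2) le_eqVlt; apply/orP; left; apply/eqP.
apply: eq_integral => v _ /=.
rewrite -integral_cst_normc ?poisson_ge0//.
  apply: eq_integral => a _; congr EFin.
  by rewrite Normc.normcM normc_real ger0_norm ?poisson_ge0// mulrC.
apply: cmeasurableB; last exact: ig.1.
exact: (cmeasurableT_comp ig.1 (measurable_translate _)).
Qed.

(** Dominated convergence in [v]: for each [v] the L1 distance to the translate tends to 0, and it
    never exceeds [I + I], twice the L1 norm of [g]. *)
Lemma poisson_average_cvg (g : R -> R[i]) : cintegrable g ->
  (\int[mu]_a (nc (cintegral setT (fun w => g w * (poisson (vanishing k) (w - a))%:C)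
     - g a))%:E)%E @[k --> \oo] --> (0 : \bar R).
Proof.
move=> ig.
apply: squeeze_cvge0 (fun k => poisson_average_le ig (vanishing_gt0 k)) _.
  by move=> k; apply: integral_ge0 => a _; rewrite lee_fin normc_ge0.
have mD (s : R) : cmeasurable (fun a : R => g (a + s) - g a).
  apply: cmeasurableB; last exact: ig.1.
  exact: (cmeasurableT_comp ig.1 (measurable_translate _)).
pose I := (\int[mu]_a (nc (g a))%:E)%E.
have Ifin : I \is a fin_num.
  by rewrite ge0_fin_numE; [exact: ig.2|apply: integral_ge0 => a _; rewrite lee_fin normc_ge0].
have bI (s : R) : (\int[mu]_a (nc (g (a + s) - g a))%:E <= I + I)%E.
  have mg : measurable_fun [set: R] (fun a => (nc (g a))%:E).
    by apply/measurable_EFinP; exact: measurable_normc ig.1.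
  have mgs : measurable_fun [set: R] (fun a : R => (nc (g (a + s)))%:E).
    exact: (measurableT_comp mg (measurable_translate s)).
  rewrite -[X in (X + _)%E](ge0_integral_translate s mg); last first.
    by move=> a; rewrite lee_fin normc_ge0.
  rewrite -ge0_integralD//; last 2 first.
  - by move=> a _; rewrite lee_fin normc_ge0.
  - by move=> a _; rewrite lee_fin normc_ge0.
  apply: ge0_le_integral => //.
  - by move=> a _; rewrite lee_fin normc_ge0.
  - by apply/measurable_EFinP; exact: (measurable_normc (mD s)).
  - exact: (emeasurable_funD mgs mg).
  - by move=> a _; rewrite -EFinD lee_fin; exact: normcB_le.
have mP1 : measurable_fun [set: R] (fun v : R => (poisson 1 v)%:E).
  by apply/measurable_EFinP; exact: measurable_poisson.
have mtau (t : R) : measurable_fun [set: R] (fun v : R => (\int[mu]_a (nc (g (a + t * v) - g a))%:E)%E).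
  have mz : cmeasurable (fun z : R * R => g (z.2 + t * z.1) - g z.2).
    apply: cmeasurableB.
      apply: (cmeasurableT_comp ig.1).
      by apply: measurable_funD => //; apply: measurable_funM.
    exact: (cmeasurableT_comp ig.1).
  have mz' : measurable_fun [set: R * R] (fun z : R * R => (nc (g (z.2 + t * z.1) - g z.2))%:E).
    by apply/measurable_EFinP; exact: measurable_normc mz.
  by apply: (measurable_ge0_integral_prod mz') => z; rewrite lee_fin normc_ge0.
have m1 k : measurable_fun [set: R] (fun v => ((poisson 1 v)%:E *
    \int[mu]_a (nc (g (a + vanishing k * v) - g a))%:E)%E).
  exact: emeasurable_funM.
have m2 : measurable_fun setT (cst (0 : \bar R) : R -> _) by exact: measurable_cst.
have tau0 (k : nat) (v : R) : (0 <= \int[mu]_a (nc (g (a + vanishing k * v) - g a))%:E)%E.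
  by apply: integral_ge0 => a _; rewrite lee_fin normc_ge0.
have c1 : {ae mu, forall v, setT v -> ((poisson 1 v)%:E *
    \int[mu]_a (nc (g (a + vanishing k * v) - g a))%:E)%E @[k --> \oo] --> cst (0 : \bar R) v}.
  apply: nearW => v _ /=; rewrite -[X in _ --> X](mule0 (poisson 1 v)%:E).
  apply: cvgeMl => //.
  apply: (@ctranslation_L1 _ _ (fun k => vanishing k * v) `|v|) => //.
    rewrite -[X in _ --> X](mul0r v); apply: cvgMl; exact: cvg_vanishing.
  move=> k; rewrite normrM ler_piMl// gtr0_norm ?vanishing_gt0//.
  exact: vanishing_le1.
have b1 : {ae mu, forall v k, setT v -> (`|((poisson 1 v)%:E *
    \int[mu]_a (nc (g (a + vanishing k * v) - g a))%:E)| <=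
    (EFin \o (fun v => fine (I + I)%E * poisson 1 v)%R) v)%E}.
  apply: nearW => v k _ /=.
  rewrite gee0_abs; last by rewrite mule_ge0// lee_fin poisson_ge0.
  have II : (fine (I + I)%E)%:E = (I + I)%E by rewrite fineK// fin_numD Ifin.
  rewrite [leRHS]EFinM II muleC lee_pmul//.
  by rewrite lee_fin poisson_ge0.
have i1 : mu.-integrable setT (EFin \o (fun v => fine (I + I)%E * poisson 1 v)%R).
  have := @integrableZl _ _ _ mu setT measurableT (fine (I + I)%E) _ (integrable_Re (cintegrable_poisson (@ltr01 R))).
  by [].
have [_ _] := @dominated_convergence _ _ R mu setT measurableT _ _ _ m1 m2 c1 i1 b1.
by rewrite integral0.
Qed.

End poisson_average.

(** * The SAFT kernel and Plancherel's inequality *)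

(* The notation [^*] elaborates to [Num.conj] under a ring operation and to
   [conjc] elsewhere. *)
Lemma num_conjE (R : realType) (z : R[i]) : Num.conj z = conjc z.
Proof. by []. Qed.

Lemma conjcM (R : realType) (x y : R[i]) : conjc (x * y) = conjc x * conjc y.
Proof. by case: x y => a b [c d]; simpc; congr Complex; ring. Qed.

Section saft_kernel.
Context {R : realType}.
Local Notation mu := (@lebesgue_measure R).
Local Notation nc := (@Normc.normc R).
Variables (A B C D p q : R).
Hypothesis hB : B != 0.
Local Notation L := (SaftParams A B C D p q).
Local Notation K := (saft_kernel L).
Local Notation saft := (saft_integral L [set: R]).
Local Notation kb := (nc (saft_KB L)).

(** With [chirpw], this isolates the phases depending on a single variable. Only [- (x * w / B)]
    couples the two, so the SAFT is a scaled Fourier transform between two unimodular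
    multiplications. *)
Definition chirpx (x : R) : R := (2 * B)^-1 * (A * x ^+ 2 + 2 * x * p).
Definition chirpw (w : R) : R :=
  (2 * B)^-1 * (- 2 * w * (D * p - B * q) + D * w ^+ 2).

Lemma saft_kernelE x w : K x w = (saft_KB L)^* *
  (expi (chirpx x) * expi (chirpw w) * expi (- (x * w / B))).
Proof.
rewrite /saft_kernel -!expiD; congr (_ * expi _).
by rewrite /= /chirpx /chirpw; field.
Qed.

Lemma mulc_conj (z : R[i]) : z * conjc z = (nc z ^+ 2)%:C.
Proof.
case: z => a b; rewrite sqr_normc /=; simpc; congr Complex; ring.
Qed.

Lemma sqr_normc_KB : kb ^+ 2 = (2 * pi * `|B|)^-1.
Proof.
rewrite /saft_KB Normc.normcV exprVn; congr (_^-1).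
rewrite expr2 -Normc.normcM -expr2 sqr_sqrtc normc_real /=.
by rewrite normrM ger0_norm ?mulr_ge0 ?pi_ge0.
Qed.

Lemma normc_kernel x w : nc (K x w) = kb.
Proof. by rewrite saft_kernelE !Normc.normcM !normc_expi normc_conj !mulr1. Qed.

Lemma measurable_chirpx : measurable_fun setT chirpx.
Proof.
apply: measurable_funM => //; apply: measurable_funD.
  by apply: measurable_funM => //; exact: measurable_funX.
by apply: measurable_funM => //; exact: measurable_funM.
Qed.

Lemma measurable_chirpw : measurable_fun setT chirpw.
Proof.
apply: measurable_funM => //; apply: measurable_funD.
  by apply: measurable_funM => //; exact: measurable_funM.
by apply: measurable_funM => //; exact: measurable_funX.
Qed.

Lemma cmeasurable_kernel : cmeasurable (fun z : R * R => K z.1 z.2).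
Proof.
rewrite (_ : (fun _ => _) = fun z => (saft_KB L)^* *
  (expi (chirpx z.1) * expi (chirpw z.2) * expi (- (z.1 * z.2 / B)))); last first.
  by apply/funext => z; rewrite saft_kernelE.
apply: cmeasurableM; first exact: cmeasurable_cst.
apply: cmeasurableM; last first.
  apply: cmeasurable_expi; apply: measurableT_comp => //.
  by apply: measurable_funM => //; exact: measurable_funM.
apply: cmeasurableM; apply: cmeasurable_expi.
  exact: (measurableT_comp measurable_chirpx).
exact: (measurableT_comp measurable_chirpw).
Qed.

Lemma cmeasurable_kernel1 w : cmeasurable (fun x => K x w).
Proof.
exact: (cmeasurableT_comp cmeasurable_kernel (measurable_pair2 w)).
Qed.

Lemma cmeasurable_kernel2 x : cmeasurable (fun w => K x w).
Proof.
exact: (cmeasurableT_comp cmeasurable_kernel (measurable_pair1 x)).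
Qed.

Lemma cintegrableM_kernel g w : cintegrable g -> cintegrable (fun x => g x * K x w).
Proof.
apply: (@cintegrableM_bounded _ _ _ kb); first exact: cmeasurable_kernel1.
by move=> x; rewrite normc_kernel.
Qed.

Lemma cmeasurable_saft g : cmeasurable g -> cmeasurable (saft g).
Proof.
move=> mg; apply: (@cmeasurable_cintegral_prod _ (fun z => g z.2 * K z.2 z.1)).
apply: cmeasurableM; first exact: (cmeasurableT_comp mg).
exact: (cmeasurableT_comp cmeasurable_kernel (@measurable_swap _ _ _ _)).
Qed.

Lemma normc_saft_le g w : cintegrable g ->
  ((nc (saft g w))%:E <= kb%:E * \int[mu]_x (nc (g x))%:E)%E.
Proof.
move=> ig; apply: le_trans (normc_cintegral_le (cintegrableM_kernel w ig)) _.
rewrite -integral_cst_normc ?normc_ge0//; last exact: ig.1.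
rewrite le_eqVlt; apply/orP; left; apply/eqP; apply: eq_integral => x _.
by rewrite Normc.normcM normc_kernel mulrC.
Qed.

Lemma saftB g h w : cintegrable g -> cintegrable h ->
  saft (fun x => g x - h x) w = saft g w - saft h w.
Proof.
move=> ig ih; rewrite /saft_integral -cintegralB; [|exact: cintegrableM_kernel..].
by congr cintegral; apply/funext => x; rewrite mulrBl.
Qed.

(** The chirps in the shared variable [x] cancel, leaving a pure exponential in [x] whose frequency
    is scaled by [B^-1]. *)
Lemma kernel_mulJ x a w : (K x a)^* * K x w =
  (kb ^+ 2)%:C * expi (chirpw w - chirpw a) * expi ((a - w) / B * x).
Proof.
rewrite !saft_kernelE !num_conjE !conjcM conjcK !conjc_expi.
rewrite -mulc_conj -!expiD mulrACA -expiD -[RHS]mulrA -expiD; congr (_ * expi _).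
by field.
Qed.

Lemma kernel_mulJw x y w : K x w * (K y w)^* =
  (kb ^+ 2)%:C * expi (chirpx x - chirpx y) * expi ((y - x) / B * w).
Proof.
rewrite !saft_kernelE !num_conjE !conjcM conjcK !conjc_expi.
rewrite -mulc_conj -!expiD mulrACA -expiD -[RHS]mulrA -expiD.
by congr (_ * expi _); field.
Qed.

(** The rate [e / |B|] matches the frequency scale [1 / B] of the kernel, and
    [kb ^+ 2 = 1 / (2 pi |B|)] supplies the normalisation; hence the result is free of [B]. *)
Lemma abel_kernelE e s : 0 < e ->
  (kb ^+ 2)%:C * cintegral setT (fun x => (expabs (e / `|B|) x)%:C * expi (s / B * x)) =
  (poisson e s)%:C.
Proof.
move=> e0; have B0 : 0 < `|B| by rewrite normr_gt0.
rewrite cintegral_expabs_expi ?divr_gt0// -rmorphM sqr_normc_KB; congr _%:C.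
rewrite /poisson !expr_div_n real_normK ?num_real//.
have es : e ^+ 2 + s ^+ 2 != 0 by rewrite gt_eqF// ltr_pwDl ?exprn_gt0 ?sqr_ge0.
have -> : B ^+ 2 = `|B| ^+ 2 by rewrite real_normK ?num_real.
move: (`|B|) B0 => b b0; move: (pi : R) (@pi_gt0 R) => P P0.
by field; rewrite es !gt_eqF.
Qed.

(* The SAFT of this function is a unimodular multiple of the Poisson kernel
   centred at [a]; testing against it yields the Abel means at [a]. *)
Definition abel_test (e a x : R) : R[i] := (expabs (e / `|B|) x)%:C * (K x a)^*.

Lemma abel_rate_gt0 e : 0 < e -> 0 < e / `|B|.
Proof. by move=> e0; rewrite divr_gt0// normr_gt0. Qed.

Lemma cintegrable_abel_test e a : 0 < e -> cintegrable (abel_test e a).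
Proof.
move=> e0; apply: (@cintegrableM_bounded _ _ _ kb).
- by apply: cmeasurable_conj; exact: cmeasurable_kernel1.
- by move=> x; rewrite normc_conj normc_kernel.
- exact/cintegrable_expabs/abel_rate_gt0.
Qed.

Lemma saft_abel_test e a w : 0 < e -> saft (abel_test e a) w =
  expi (chirpw w - chirpw a) * (poisson e (w - a))%:C.
Proof.
move=> e0; rewrite /saft_integral.
rewrite -(opprB a w) poissonN -abel_kernelE//.
rewrite mulrCA mulrA -cintegralZl; last first.
  apply: (@cintegrableM_bounded _ _ _ 1).
  - by apply: cmeasurable_expi; exact: mulrl_measurable.
  - by move=> x; rewrite normc_expi.
  - exact/cintegrable_expabs/abel_rate_gt0.
congr cintegral; apply/funext => x.
by rewrite /abel_test -mulrA kernel_mulJ mulrCA.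
Qed.

End saft_kernel.
Arguments saft_kernelE {R A B C D p q} hB.
Arguments normc_kernel {R A B C D p q} hB.
Arguments cmeasurable_kernel {R A B C D p q} hB.
Arguments cmeasurable_kernel1 {R A B C D p q} hB.
Arguments cmeasurable_kernel2 {R A B C D p q} hB.
Arguments cintegrableM_kernel {R A B C D p q} hB {g}.
Arguments cmeasurable_saft {R A B C D p q} hB {g}.
Arguments normc_saft_le {R A B C D p q} hB {g}.
Arguments saftB {R A B C D p q} hB {g h}.
Arguments kernel_mulJ {R A B C D p q} hB.
Arguments kernel_mulJw {R A B C D p q} hB.
Arguments abel_kernelE {R} A {B} C D p q hB {e}.
Arguments cintegrable_abel_test {R A B C D p q} hB {e}.
Arguments saft_abel_test {R A B C D p q} hB {e}.

(** * Domination on products, Fatou's lemma and Schur's test *)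

Section integration_lemmas.
Context {R : realType}.
Local Notation mu := (@lebesgue_measure R).
Local Notation nc := (@Normc.normc R).

Lemma cvg_expabs_vanishing (b x : R) :
  expabs (@vanishing R k / b) x @[k --> \oo] --> (1 : R).
Proof.
rewrite -expR0; apply: (continuous_cvg _ (@continuous_expR R 0)).
rewrite -[X in _ --> X]oppr0; apply: cvgN.
rewrite -[X in _ --> X](mul0r `|x|); apply: cvgMl.
rewrite -[X in _ --> X](mul0r b^-1); apply: cvgMl; exact: cvg_vanishing.
Qed.

Lemma prod_dominated_lty (F : R * R -> R[i]) (g h : R -> R) : cmeasurable F ->
  measurable_fun setT g -> measurable_fun setT h ->
  (forall x, 0 <= g x) -> (forall x, 0 <= h x) ->
  (forall x y, nc (F (x, y)) <= g x * h y) ->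
  (\int[mu]_x (g x)%:E < +oo)%E -> (\int[mu]_x (h x)%:E < +oo)%E ->
  (\int[mu]_x \int[mu]_y (nc (F (x, y)))%:E < +oo)%E.
Proof.
move=> mF mg mh g0 h0 Fgh ig ih.
have mN : measurable_fun [set: R * R] (fun z => (nc (F z))%:E).
  by apply/measurable_EFinP; exact: measurable_normc.
have mh' : measurable_fun [set: R] (fun y => (h y)%:E) by exact/measurable_EFinP.
have mg' : measurable_fun [set: R] (fun y => (g y)%:E) by exact/measurable_EFinP.
pose I := (\int[mu]_x (h x)%:E)%E.
have I0 : (0 <= I)%E by apply: integral_ge0 => x _; rewrite lee_fin.
apply: (@le_lt_trans _ _ (\int[mu]_x ((g x)%:E * I))%E).
  apply: ge0_le_integral => //.
  - by move=> x _; apply: integral_ge0 => y _; rewrite lee_fin normc_ge0.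
  - by apply: (measurable_ge0_integral_prod mN) => z; rewrite lee_fin normc_ge0.
  - exact: emeasurable_funM.
  - move=> x _; rewrite -ge0_integralZl//; last by rewrite lee_fin.
    apply: ge0_le_integral => //.
    + by move=> y _; rewrite lee_fin normc_ge0.
    + exact: (measurableT_comp mN (measurable_pair1 x)).
    + exact: emeasurable_funM.
    + by move=> y _; rewrite -EFinM lee_fin.
    + by move=> y _; rewrite lee_fin.
have -> : (\int[mu]_x ((g x)%:E * I) = I * \int[mu]_x (g x)%:E)%E.
  rewrite -ge0_integralZl//; last by move=> x _; rewrite lee_fin.
  by apply: eq_integral => x _; rewrite muleC.
by rewrite lte_mul_pinfty// ge0_fin_numE.
Qed.

(** Lets a nonnegative real integral be expanded by the complex Fubini theorem and then estimated by
    [normc_cintegral_le]. *)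
Lemma integral_cintegral_real (r : R -> R) : (forall x, 0 <= r x) ->
  cintegrable (fun x => (r x)%:C) ->
  (\int[mu]_x (r x)%:E)%E = (nc (cintegral setT (fun x => (r x)%:C)))%:E.
Proof.
move=> r0 ir; rewrite /cintegral.
rewrite (_ : Rintegral mu setT (@complex.Im R \o _) = 0); last first.
  by rewrite (_ : _ \o _ = fun=> 0)// /Rintegral integral0.
rewrite normc_real ger0_norm; last by apply: Rintegral_ge0 => x _; exact: r0.
by rewrite /Rintegral fineK//; exact: integrable_fin_num (integrable_Re ir).
Qed.

Lemma fatou_le (f_ : nat -> R -> R) (f : R -> R) (l : \bar R) :
  (forall n, measurable_fun setT (f_ n)) -> (forall n x, 0 <= f_ n x) ->
  (forall x, f_ n x @[n --> \oo] --> f x) ->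
  (forall n, (\int[mu]_x (f_ n x)%:E <= l)%E) ->
  (\int[mu]_x (f x)%:E <= l)%E.
Proof.
move=> mf f0 ff fl.
have mf' n : measurable_fun [set: R] (fun x => (f_ n x)%:E).
  exact/measurable_EFinP.
have h := @fatou _ _ R mu setT measurableT (fun n x => (f_ n x)%:E) mf'.
have -> : (\int[mu]_x (f x)%:E = \int[mu]_x limn_einf (fun n => (f_ n x)%:E))%E.
  apply: eq_integral => x _.
  have c : (f_ n x)%:E @[n --> \oo] --> (f x)%:E.
    by apply/fine_cvgP; split; [exact: nearW|exact: ff].
  by rewrite (cvg_limn_einf_sup c).1.
apply: le_trans (h _) _; first by move=> n x _; rewrite lee_fin.
rewrite limn_einf_lim; apply: lime_le; first exact: is_cvg_einfs.
apply: nearW => n; apply: le_trans (fl n).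
by apply: ereal_inf_lbound; exists n => /=.
Qed.

(* Schur's test: [a x * a y <= (a x ^+ 2 + a y ^+ 2) / 2], and the kernel has
   total mass 1 in each variable. *)
Lemma poisson_schur (a : R -> R) (e : R) : 0 < e -> measurable_fun setT a ->
  (forall x, 0 <= a x) ->
  (\int[mu]_x \int[mu]_y (a x * (poisson e (y - x) * a y))%:E <=
   \int[mu]_x (a x ^+ 2)%:E)%E.
Proof.
move=> e0 ma a0; pose v x := 2^-1 * a x ^+ 2.
have v0 x : (0 <= (v x)%:E)%E by rewrite lee_fin mulr_ge0 ?sqr_ge0.
have mv : measurable_fun [set: R] (fun x => (v x)%:E).
  by apply/measurable_EFinP; apply: measurable_funM => //; exact: measurable_funX.
have P0 u : (0 <= (poisson e u)%:E)%E by rewrite lee_fin poisson_ge0// ltW.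
have mP : measurable_fun [set: R * R] (fun z : R * R => (poisson e (z.2 - z.1))%:E).
  apply/measurable_EFinP; apply: (measurableT_comp (measurable_poisson e0)).
  exact: measurable_funB.
have m1 : measurable_fun [set: R * R] (fun z : R * R => ((v z.1)%:E * (poisson e (z.2 - z.1))%:E)%E).
  by apply: emeasurable_funM => //; exact: (measurableT_comp mv).
have m2 : measurable_fun [set: R * R] (fun z : R * R => ((v z.2)%:E * (poisson e (z.2 - z.1))%:E)%E).
  by apply: emeasurable_funM => //; exact: (measurableT_comp mv).
have m3 : measurable_fun [set: R * R] (fun z : R * R =>
    ((v z.1)%:E * (poisson e (z.2 - z.1))%:E + (v z.2)%:E * (poisson e (z.2 - z.1))%:E)%E).
  exact: emeasurable_funD.
have m4 : measurable_fun [set: R * R] (fun z : R * R => (a z.1 * (poisson e (z.2 - z.1) * a z.2))%:E).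
  apply/measurable_EFinP; apply: measurable_funM.
    exact: (measurableT_comp ma).
  apply: measurable_funM; last exact: (measurableT_comp ma).
  exact/measurable_EFinP.
pose I := (\int[mu]_x (v x)%:E)%E.
have I1 : (\int[mu]_x \int[mu]_y ((v x)%:E * (poisson e (y - x))%:E) = I)%E.
  apply: eq_integral => x _; rewrite ge0_integralZl//.
    by rewrite integral_poisson// mule1.
  exact: (measurableT_comp mP (measurable_pair1 x)).
have I2 : (\int[mu]_x \int[mu]_y ((v y)%:E * (poisson e (y - x))%:E) = I)%E.
  have := @fubini_tonelli _ _ _ _ R mu mu _ m2.
  rewrite /= => ->; last by move=> z; rewrite mule_ge0.
  apply: eq_integral => y _; rewrite ge0_integralZl//.
    have -> : (\int[mu]_x (poisson e (y - x))%:E = 1)%E; last by rewrite mule1.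
    rewrite -(integral_poisson y e0); apply: eq_integral => x _.
    by rewrite -poissonN opprB.
  exact: (measurableT_comp mP (measurable_pair2 y)).
have -> : (\int[mu]_x (a x ^+ 2)%:E = I + I)%E.
  rewrite -ge0_integralD//; apply: eq_integral => x _.
  by rewrite -EFinD; congr EFin; rewrite /v; field.
rewrite -[X in (_ <= X + _)%E]I1 -[X in (_ <= _ + X)%E]I2 -ge0_integralD//.
- apply: ge0_le_integral => //.
  + move=> x _; apply: integral_ge0 => y _.
    by rewrite lee_fin mulr_ge0// mulr_ge0// poisson_ge0// ltW.
  + apply: (measurable_ge0_integral_prod m4) => z.
    by rewrite lee_fin mulr_ge0// mulr_ge0// poisson_ge0// ltW.
  + apply: emeasurable_funD.
      by apply: (measurable_ge0_integral_prod m1) => z; rewrite mule_ge0.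
    by apply: (measurable_ge0_integral_prod m2) => z; rewrite mule_ge0.
  + move=> x _; rewrite -ge0_integralD//.
    * apply: ge0_le_integral => //.
      - by move=> y _; rewrite lee_fin mulr_ge0// mulr_ge0// poisson_ge0// ltW.
      - exact: (measurableT_comp m4 (measurable_pair1 x)).
      - exact: (measurableT_comp m3 (measurable_pair1 x)).
      - move=> y _; rewrite -!EFinM -EFinD lee_fin /v.
        have := poisson_ge0 (y - x) (ltW e0); have := a0 x; have := a0 y.
        move: (poisson e _) (a x) (a y) => P ax ay ay0 ax0 P0'.
        have -> : 2^-1 * ax ^+ 2 * P + 2^-1 * ay ^+ 2 * P =
          ax * (P * ay) + 2^-1 * (ax - ay) ^+ 2 * P by field.
        by rewrite lerDl mulr_ge0// mulr_ge0// sqr_ge0.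
    * by move=> y _; rewrite mule_ge0.
    * exact: (measurableT_comp m1 (measurable_pair1 x)).
    * by move=> y _; rewrite mule_ge0.
    * exact: (measurableT_comp m2 (measurable_pair1 x)).
- by move=> x _; apply: integral_ge0 => y _; rewrite mule_ge0.
- by apply: (measurable_ge0_integral_prod m1) => z; rewrite mule_ge0.
- by move=> x _; apply: integral_ge0 => y _; rewrite mule_ge0.
- by apply: (measurable_ge0_integral_prod m2) => z; rewrite mule_ge0.
Qed.

End integration_lemmas.

Local Opaque saft_kernel saft_KB.

(** * Plancherel's inequality for integrable functions *)

Section plancherel_inequality.
Context {R : realType}.
Local Notation mu := (@lebesgue_measure R).
Local Notation nc := (@Normc.normc R).
Variables (A B C D p q : R).
Hypothesis hB : B != 0.
Local Notation L := (SaftParams A B C D p q).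
Local Notation K := (saft_kernel L).
Local Notation saft := (saft_integral L [set: R]).
Local Notation kb := (nc (saft_KB L)).

Section weighted.
Variables (u : R -> R[i]) (e : R).
Hypotheses (iu : cintegrable u) (e0 : 0 < e).
Let E w := expabs (e / `|B|) w.
Let U : R := fine (\int[mu]_x (nc (u x))%:E)%E.

Let mE : measurable_fun setT E. Proof. exact: measurable_expabs. Qed.

Let iE : (\int[mu]_w (E w)%:E < +oo)%E.
Proof.
have [_] := cintegrable_expabs (abel_rate_gt0 hB e0).
by under eq_integral do rewrite normc_real ger0_norm ?expabs_ge0//.
Qed.

Let saft_bound w : nc (saft u w) <= kb * U.
Proof.
rewrite -lee_fin EFinM fineK; first exact: (normc_saft_le hB).
exact: integrable_fin_num (integrable_normc iu).
Qed.

Let mnu : measurable_fun setT (fun x => nc (u x)).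
Proof. exact: measurable_normc iu.1. Qed.

Let inner_eq x : cintegral setT (fun w => (E w)%:C * conjc (saft u w) * (u x * K x w)) =
  u x * cintegral setT (fun y =>
    (expi (chirpx A B p x - chirpx A B p y) * (poisson e (y - x))%:C) * conjc (u y)).
Proof.
pose F (z : R * R) := (E z.1)%:C * (K x z.1 * conjc (K z.2 z.1)) * conjc (u z.2).
have mF : cmeasurable F.
  apply: cmeasurableM; first apply: cmeasurableM.
  - by apply: cmeasurable_real; exact: measurableT_comp.
  - apply: cmeasurableM.
      exact: (cmeasurableT_comp (cmeasurable_kernel2 hB x) measurable_fst).
    apply: cmeasurable_conj.
    exact: (cmeasurableT_comp (cmeasurable_kernel hB) (@measurable_swap _ _ _ _)).
  - by apply: cmeasurable_conj; exact: (cmeasurableT_comp iu.1).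
(* The kernels have constant modulus [kb], so integrability in [w] comes entirely from the weight
   [E]. *)
have iF : (\int[mu]_w \int[mu]_y (nc (F (w, y)))%:E < +oo)%E.
  apply: (@prod_dominated_lty _ _ (fun w => kb ^+ 2 * E w) (fun y => nc (u y))) => //.
  - exact: measurable_funM.
  - by move=> w; rewrite mulr_ge0 ?sqr_ge0// expabs_ge0.
  - by move=> y; exact: normc_ge0.
  - move=> w y; rewrite /F /= Normc.normcM normc_conj Normc.normcM (Normc.normcM (K x w)) normc_conj !(normc_kernel hB) -expr2.
    by rewrite normc_real ger0_norm ?expabs_ge0// [E w * _]mulrC.
  - under eq_integral do rewrite EFinM.
    rewrite ge0_integralZl//.
    + by rewrite lte_mul_pinfty// ?lee_fin ?sqr_ge0.
    + exact/measurable_EFinP.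
    + by move=> w _; rewrite lee_fin expabs_ge0.
    + by rewrite lee_fin sqr_ge0.
  - exact: iu.2.
have iGw w : cintegrable (fun y => conjc (u y) * conjc (K y w)).
  under eq_fun do rewrite -conjcM; apply: cintegrable_conj.
  exact: (cintegrableM_kernel hB).
transitivity (u x * cintegral setT (fun w => cintegral setT (fun y => F (w, y)))).
  rewrite -cintegralZl.
    congr cintegral; apply/funext => w.
    rewrite /F [RHS]/=.
    have -> : cintegral setT (fun y => (E w)%:C * (K x w * conjc (K y w)) * conjc (u y)) =
        (E w)%:C * K x w * cintegral setT (fun y => conjc (u y) * conjc (K y w)).
      rewrite -cintegralZl//; congr cintegral; apply/funext => y; ring.
    have -> : cintegral setT (fun y => conjc (u y) * conjc (K y w)) = conjc (saft u w).
      rewrite /saft_integral -cintegral_conj; last exact: (cintegrableM_kernel hB).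
      by congr cintegral; apply/funext => y; rewrite (conjcM (u y)).

    ring.
  exact: (cintegrable_cintegral_prod mF iF).
congr (_ * _); rewrite cintegral_fubini//; congr cintegral; apply/funext => y.
rewrite /F /=.
rewrite -(abel_kernelE A C D p q hB _ e0).
have ic : cintegrable (fun w => (E w)%:C * expi ((y - x) / B * w)).
  apply: (@cintegrableM_bounded _ _ _ 1).
  - by apply: cmeasurable_expi; exact: mulrl_measurable.
  - by move=> w; rewrite normc_expi.
  - exact/cintegrable_expabs/abel_rate_gt0.
transitivity (expi (chirpx A B p x - chirpx A B p y) * (kb ^+ 2)%:C * conjc (u y) *
    cintegral setT (fun w => (E w)%:C * expi ((y - x) / B * w))); last first.
  rewrite /E; move: (cintegral _ _) (conjc _) => I v; ring.
rewrite -cintegralZl//; congr cintegral; apply/funext => w.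
have -> : K x w * conjc (K y w) = _ := kernel_mulJw hB x y w.
by move: (expi _) (expi _) (conjc _) => z1 z2 z3; ring.
Qed.

Let Fbound x : ((nc (cintegral setT (fun w => (E w)%:C * conjc (saft u w) * (u x * K x w))))%:E
  <= \int[mu]_y (nc (u x) * (poisson e (y - x) * nc (u y)))%:E)%E.
Proof.
rewrite inner_eq Normc.normcM EFinM.
have mP : measurable_fun [set: R] (fun y => poisson e (y - x)).
  exact: (measurableT_comp (measurable_poisson e0) (measurable_translate (- x))).
have mM : measurable_fun [set: R] (fun y => (poisson e (y - x) * nc (u y))%:E).
  by apply/measurable_EFinP; exact: measurable_funM.
have iG : cintegrable (fun y =>
    (expi (chirpx A B p x - chirpx A B p y) * (poisson e (y - x))%:C) * conjc (u y)).
  rewrite (_ : (fun _ => _) = (fun y => conjc (u y) *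
    (expi (chirpx A B p x - chirpx A B p y) * (poisson e (y - x))%:C))); last first.
    by apply/funext => y; rewrite mulrC.
  apply: (@cintegrableM_bounded _ _ _ (pi * e)^-1); last exact: cintegrable_conj.
    apply: cmeasurableM; last exact: cmeasurable_real.
    apply: cmeasurable_expi; apply: measurable_funB => //.
    exact: measurable_chirpx.
  move=> y; rewrite Normc.normcM normc_expi mul1r normc_real.
  by rewrite ger0_norm ?poisson_ge0 ?(ltW e0)// poisson_le.
under eq_integral do rewrite EFinM.
rewrite ge0_integralZl//.
- apply: lee_pmul; rewrite ?lee_fin ?normc_ge0//.
  apply: le_trans (normc_cintegral_le iG) _.
  rewrite le_eqVlt; apply/orP; left; apply/eqP; apply: eq_integral => y _.
  rewrite Normc.normcM normc_conj Normc.normcM normc_expi mul1r normc_real.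
  by rewrite ger0_norm ?poisson_ge0 ?(ltW e0).
- by move=> y _; rewrite lee_fin mulr_ge0 ?poisson_ge0 ?normc_ge0 ?(ltW e0).
- by rewrite lee_fin normc_ge0.
Qed.

(* Expanding the square and exchanging the integrals produces the SAFT of
   [E], that is, the Poisson kernel at [y - x]. *)
Lemma weighted_plancherel_le :
  (\int[mu]_w (expabs (e / `|B|) w * nc (saft u w) ^+ 2)%:E <=
   \int[mu]_x (nc (u x) ^+ 2)%:E)%E.
Proof.
have ms : cmeasurable (saft u) := cmeasurable_saft hB iu.1.
have U0 : 0 <= U by apply: fine_ge0; apply: integral_ge0 => x _; rewrite lee_fin normc_ge0.
have kbU0 : 0 <= kb * U by rewrite mulr_ge0// normc_ge0.
pose F (z : R * R) := (E z.1)%:C * conjc (saft u z.1) * (u z.2 * K z.2 z.1).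
have mF : cmeasurable F.
  apply: cmeasurableM; first apply: cmeasurableM.
  - by apply: cmeasurable_real; exact: measurableT_comp.
  - by apply: cmeasurable_conj; exact: (cmeasurableT_comp ms).
  - apply: cmeasurableM; first exact: (cmeasurableT_comp iu.1).
    exact: (cmeasurableT_comp (cmeasurable_kernel hB) (@measurable_swap _ _ _ _)).
have nF w x : nc (F (w, x)) = E w * nc (saft u w) * (nc (u x) * kb).
  rewrite /F Normc.normcM (Normc.normcM (E w)%:C) (Normc.normcM (u x)) normc_conj.
  by rewrite (normc_kernel hB) normc_real ger0_norm ?expabs_ge0.
have iEk k : 0 <= k -> (\int[mu]_w (k * E w)%:E < +oo)%E.
  move=> k0; under eq_integral do rewrite EFinM.
  rewrite ge0_integralZl//.
  - by rewrite lte_mul_pinfty.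
  - exact/measurable_EFinP.
  - by move=> w _; rewrite lee_fin expabs_ge0.
have iF : (\int[mu]_w \int[mu]_x (nc (F (w, x)))%:E < +oo)%E.
  apply: (@prod_dominated_lty _ _ (fun w => (kb * (kb * U)) * E w) (fun x => nc (u x))) => //.
  - exact: measurable_funM.
  - by move=> w; rewrite mulr_ge0 ?expabs_ge0// mulr_ge0// normc_ge0.
  - by move=> x; exact: normc_ge0.
  - move=> w x; rewrite nF.
    rewrite [leRHS](_ : _ = E w * (kb * U) * (nc (u x) * kb)); last by ring.
    by rewrite ler_wpM2r ?mulr_ge0 ?normc_ge0// ler_wpM2l ?expabs_ge0.
  - by apply: iEk; rewrite mulr_ge0// normc_ge0.
  - exact: iu.2.
have iR : cintegrable (fun w => (E w * nc (saft u w) ^+ 2)%:C).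
  apply: (@le_cintegrable _ _ (fun w => (kb * U) ^+ 2 * E w)).
  - apply: cmeasurable_real; apply: measurable_funM => //.
    by apply: measurable_funX; exact: measurable_normc.
  - exact: measurable_funM.
  - move=> w; rewrite normc_real ger0_norm; last by rewrite mulr_ge0 ?expabs_ge0 ?sqr_ge0.
    rewrite mulrC ler_wpM2r ?expabs_ge0//.
    by rewrite ler_pXn2r// ?nnegrE ?normc_ge0.
  - by apply: iEk; exact: sqr_ge0.
rewrite integral_cintegral_real//; last first.
  by move=> w; rewrite mulr_ge0 ?expabs_ge0 ?sqr_ge0.
(* Only one factor of the squared modulus is expanded here, as an integral over [x]; the conjugated
   one is expanded over [y] in [inner_eq]. *)
have -> : cintegral setT (fun w => (E w * nc (saft u w) ^+ 2)%:C) =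
    cintegral setT (fun w => cintegral setT (fun x => F (w, x))).
  congr cintegral; apply/funext => w.
  rewrite /F [RHS]/= cintegralZl; last exact: (cintegrableM_kernel hB).
  have -> : (E w * nc (saft u w) ^+ 2)%:C = (E w)%:C * (nc (saft u w) ^+ 2)%:C.
    exact: rmorphM.
  by rewrite -mulc_conj mulrA mulrAC.
rewrite cintegral_fubini//.
have mFs : cmeasurable (fun z => F (z.2, z.1)).
  exact: (cmeasurableT_comp mF (@measurable_swap _ _ _ _)).
have iFs : (\int[mu]_x \int[mu]_w (nc (F (w, x)))%:E < +oo)%E.
  by rewrite -(normc_tonelli mF).
have iG := cintegrable_cintegral_prod mFs iFs.
apply: le_trans (normc_cintegral_le iG) _.
have e1 := poisson_schur e0 mnu (fun x => normc_ge0 _).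
apply: le_trans _ e1.
have m4 : measurable_fun [set: R * R] (fun z : R * R => (nc (u z.1) * (poisson e (z.2 - z.1) * nc (u z.2)))%:E).
  apply/measurable_EFinP; apply: measurable_funM.
    exact: (measurableT_comp mnu).
  apply: measurable_funM; last exact: (measurableT_comp mnu).
  apply: (measurableT_comp (measurable_poisson e0)).
  exact: measurable_funB.
apply: ge0_le_integral => //.
- by move=> x _; rewrite lee_fin normc_ge0.
- by apply/measurable_EFinP; exact: measurable_normc iG.1.
- apply: (measurable_ge0_integral_prod m4) => z.
  by rewrite lee_fin mulr_ge0 ?normc_ge0// mulr_ge0 ?normc_ge0// poisson_ge0// ltW.
- by move=> x _; exact: Fbound.
Qed.

End weighted.

(** The weight tends to 1 pointwise and the weighted bound does not depend on it, so Fatou's lemma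
    removes it. *)
Lemma plancherel_le (u : R -> R[i]) : cintegrable u ->
  (\int[mu]_w (nc (saft u w) ^+ 2)%:E <= \int[mu]_x (nc (u x) ^+ 2)%:E)%E.
Proof.
move=> iu.
have ms : measurable_fun setT (fun w => nc (saft u w)).
  exact: measurable_normc (cmeasurable_saft hB iu.1).
apply: (@fatou_le _ (fun k w => expabs (vanishing k / `|B|) w * nc (saft u w) ^+ 2)).
- move=> k; apply: measurable_funM; first exact: measurable_expabs.
  exact: measurable_funX.
- by move=> k w; rewrite mulr_ge0 ?expabs_ge0 ?sqr_ge0.
- move=> w; rewrite -[X in _ --> X]mul1r; apply: cvgMl.
  exact: cvg_expabs_vanishing.
- by move=> k; apply: weighted_plancherel_le => //; exact: vanishing_gt0.
Qed.

End plancherel_inequality.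
Arguments plancherel_le {R A B C D p q} hB {u}.

(** * Recovering the SAFT from the Parseval formula *)

Section abel_means.
Context {R : realType}.
Local Notation mu := (@lebesgue_measure R).
Local Notation nc := (@Normc.normc R).
Variables (A B C D p q : R).
Hypothesis hB : B != 0.
Local Notation L := (SaftParams A B C D p q).
Local Notation K := (saft_kernel L).
Local Notation saft := (saft_integral L [set: R]).
Local Notation kb := (nc (saft_KB L)).
Local Notation abel := (abel_test A B C D p q).
Variables (W G : R -> R[i]) (MW : R).
Hypotheses (mW : cmeasurable W) (bW : forall t, nc (W t) <= MW) (iG : cintegrable G).
Hypothesis WG : forall e a, 0 < e -> cinner W (abel e a) = cinner G (saft (abel e a)).

Let E k x := expabs (vanishing k / `|B|) x.

Let E0 k x : 0 <= E k x. Proof. exact: expabs_ge0. Qed.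

Let E1 k x : E k x <= 1.
Proof. by apply: expabs_le1; rewrite divr_ge0// ltW// vanishing_gt0. Qed.

Let mE k : measurable_fun setT (E k). Proof. exact: measurable_expabs. Qed.

Let cE x : E k x @[k --> \oo] --> (1 : R). Proof. exact: cvg_expabs_vanishing. Qed.

Let iWE k : cintegrable (fun x => W x * (E k x)%:C).
Proof.
rewrite (_ : (fun _ => _) = (fun x => (E k x)%:C * W x)); last first.
  by apply/funext => x; rewrite mulrC.
apply: (cintegrableM_bounded mW bW).
exact/cintegrable_expabs/abel_rate_gt0/vanishing_gt0.
Qed.

(** The Abel means of the SAFT integral of [W], which need not converge for a merely bounded [W]. *)
Let H k a := saft (fun x => W x * (E k x)%:C) a.

(** Stripping the chirp from [G] turns the twisted average into a genuine Poisson average. The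
    factor has modulus 1, so L1 distances are unchanged. *)
Let g w := G w * expi (- chirpw B D p q w).

Let ig : cintegrable g.
Proof.
apply: (@cintegrableM_bounded _ _ _ 1) iG.
  by apply: cmeasurable_expi; apply: measurableT_comp => //; exact: measurable_chirpw.
by move=> w; rewrite normc_expi.
Qed.

Let HE k a : H k a = expi (chirpw B D p q a) *
  cintegral setT (fun w => g w * (poisson (vanishing k) (w - a))%:C).
Proof.
have ek := @vanishing_gt0 R k.
have bP w : nc (poisson (vanishing k) (w - a))%:C <= (pi * vanishing k)^-1.
  by rewrite normc_real ger0_norm ?poisson_ge0 ?(ltW ek)//; exact: poisson_le.
have mP : cmeasurable (fun w : R => (poisson (vanishing k) (w - a))%:C).
  apply: cmeasurable_real.
  exact: (measurableT_comp (measurable_poisson ek) (measurable_translate (- a))).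
rewrite -cintegralZl; last exact: cintegrableM_bounded mP bP ig.
(* The kernel is conjugated in [abel_test], and the inner product conjugates it back: the pairing is
   the Abel mean itself. *)
transitivity (cinner W (abel (vanishing k) a)).
  congr cintegral; apply/funext => x; rewrite /abel_test !num_conjE conjcM conjcK.
  by rewrite conjc_real mulrA.
rewrite WG//; congr cintegral; apply/funext => w.
rewrite (saft_abel_test hB)// num_conjE conjcM conjc_expi conjc_real.
by rewrite opprB expiD /g; ring.
Qed.

Lemma abel_mean_cvg :
  (\int[mu]_a (nc (H k a - G a))%:E)%E @[k --> \oo] --> (0 : \bar R).
Proof.
have := poisson_average_cvg ig.
set v := (fun k => _) => h; suff -> : (fun k => \int[mu]_a (nc (H k a - G a))%:E)%E = v by [].
apply/funext => k.
apply: eq_integral => a _; congr EFin.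
have -> : G a = expi (chirpw B D p q a) * g a.
  by rewrite /g mulrCA -expiD subrr expi0 mulr1.
by rewrite HE -mulrBr Normc.normcM normc_expi mul1r.
Qed.

Let mH k : cmeasurable (H k). Proof. exact: (cmeasurable_saft hB (iWE k).1). Qed.

(** The Abel means have two limits: [G] in L1 and, by dominated convergence in [x], [saft W]
    uniformly. The limits must agree almost everywhere. *)
Lemma ae_eq_saft : cintegrable W -> \forall w \ae mu, G w = saft W w.
Proof.
move=> iW.
pose d k := (\int[mu]_x (nc (W x - W x * (E k x)%:C))%:E)%E.
have d0 k : (0 <= d k)%E by apply: integral_ge0 => x _; rewrite lee_fin normc_ge0.
have dcvg : d k @[k --> \oo] --> (0 : \bar R).
  have := @cdominated_convergence R (fun k x => W x * (E k x)%:C) W (fun x => nc (W x)).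
  rewrite (_ : (fun k => _) = d); last first.
    by apply/funext => k; apply: eq_integral => x _; rewrite normcBC.
  have nE k x : nc (W x * (E k x)%:C - W x) = nc (W x) * (1 - E k x).
    rewrite -{2}[W x]mulr1 -mulrBr Normc.normcM.
    have -> : (E k x)%:C - 1 = (E k x - 1)%:C by rewrite rmorphB.
    by rewrite normc_real ler0_norm ?subr_le0// opprB.
  apply.
  - by move=> k; exact: (iWE k).1.
  - exact: mW.
  - exact: integrable_normc.
  - by move=> k x; rewrite nE ler_piMr ?normc_ge0// gerDl oppr_le0.
  - move=> x; rewrite (_ : (fun k => _) = (fun k => nc (W x) * (1 - E k x))); last first.
      by apply/funext => k; exact: nE.
    rewrite -[X in _ --> X](mulr0 (nc (W x))); apply: cvgMr.
    by rewrite -[X in _ --> X](subrr 1); apply: cvgB => //; exact: cvg_cst.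
(* Uniform convergence calls for an integrable weight and L1 convergence for a bounded one;
   [poisson 1] is both. Being positive everywhere, it lets the vanishing of the integral give
   equality almost everywhere. *)
pose f w := nc (saft W w - G w) * poisson 1 w.
have msW : cmeasurable (fun w => saft W w - G w).
  by apply: cmeasurableB; [exact: (cmeasurable_saft hB mW)|exact: iG.1].
have mf : measurable_fun setT (fun w => (f w)%:E).
  apply/measurable_EFinP; apply: measurable_funM; first exact: measurable_normc msW.
  exact: measurable_poisson.
have f0 w : (0 <= (f w)%:E)%E by rewrite lee_fin mulr_ge0 ?normc_ge0 ?poisson_ge0.
have mP : measurable_fun setT (fun w : R => (poisson 1 w)%:E).
  by apply/measurable_EFinP; exact: measurable_poisson.
have mHG k : measurable_fun setT (fun w => (nc (H k w - G w))%:E).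
  apply/measurable_EFinP; apply: measurable_normc.
  by apply: cmeasurableB; [exact: mH|exact: iG.1].
have dfin k : d k \is a fin_num.
  by apply: integrable_fin_num => //; exact: integrable_normc (cintegrableB iW (iWE k)).
(* [kb] is the modulus of the kernel and [pi^-1] the maximum of [poisson 1]. *)
have le1 k : (\int[mu]_w (f w)%:E <= kb%:E * d k + pi^-1%:E * \int[mu]_w (nc (H k w - G w))%:E)%E.
  have kd0 : (0 <= kb%:E * d k)%E by rewrite mule_ge0// lee_fin normc_ge0.
  have p0 : (0 <= (pi^-1 : R)%:E)%E by rewrite lee_fin invr_ge0 pi_ge0.
  have m1 : measurable_fun [set: R] (fun w => (kb%:E * d k) * (poisson 1 w)%:E)%E.
    exact: emeasurable_funM.
  have m2 : measurable_fun [set: R] (fun w => pi^-1%:E * (nc (H k w - G w))%:E)%E.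
    exact: emeasurable_funM.
  have I1 : (\int[mu]_w ((kb%:E * d k) * (poisson 1 w)%:E) = kb%:E * d k)%E.
    rewrite ge0_integralZl//; last by move=> w _; rewrite lee_fin poisson_ge0.
    have -> : (\int[mu]_x (poisson 1 x)%:E = 1)%E; last by rewrite mule1.
    by rewrite -(integral_poisson 0 (@ltr01 R)); apply: eq_integral => x _; rewrite subr0.
  have I2 : (\int[mu]_w (pi^-1%:E * (nc (H k w - G w))%:E) =
      pi^-1%:E * \int[mu]_w (nc (H k w - G w))%:E)%E.
    rewrite ge0_integralZl//; first exact: mHG.
    by move=> w _; rewrite lee_fin normc_ge0.
  apply: (@le_trans _ _ (\int[mu]_w ((kb%:E * d k) * (poisson 1 w)%:E + pi^-1%:E * (nc (H k w - G w))%:E))%E).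
    apply: ge0_le_integral => //.
    - exact: (emeasurable_funD m1 m2).
    - move=> w _.
      have h1 : ((nc (saft W w - H k w))%:E <= kb%:E * d k)%E.
        rewrite -[X in nc X](saftB hB w iW (iWE k)).
        exact: (normc_saft_le hB w (cintegrableB iW (iWE k))).
      rewrite -(fineK (dfin k)) -EFinM -EFinD lee_fin.
      move: h1; rewrite -(fineK (dfin k)) -EFinM lee_fin => h1.
      rewrite /f; apply: (@le_trans _ _ ((nc (saft W w - H k w) + nc (H k w - G w)) * poisson 1 w)).
        by rewrite ler_wpM2r ?poisson_ge0//; exact: normc_sum3.
      rewrite mulrDl; apply: lerD; first by rewrite ler_wpM2r ?poisson_ge0.
      rewrite mulrC; apply: ler_wpM2r; first exact: normc_ge0.
      by have := @poisson_le R 1 w ltr01; rewrite mulr1.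
  rewrite ge0_integralD//.
  - by rewrite I1 I2.
  - by move=> w _; rewrite mule_ge0// lee_fin poisson_ge0.
  - by move=> w _; rewrite mule_ge0// lee_fin normc_ge0.
have If0 : (\int[mu]_w (f w)%:E = 0)%E.
  apply/eqP; rewrite eq_le; apply/andP; split; last exact: integral_ge0.
  have c0 : (kb%:E * d k + pi^-1%:E * \int[mu]_w (nc (H k w - G w))%:E)%E @[k --> \oo] --> (0 : \bar R).
    apply: cvge0D.
    - by move=> k; rewrite mule_ge0// lee_fin normc_ge0.
    - move=> k; rewrite mule_ge0// ?lee_fin ?invr_ge0 ?pi_ge0//.
      by apply: integral_ge0 => w _; rewrite lee_fin normc_ge0.
    - by rewrite -[X in _ --> X](mule0 kb%:E); apply: cvgeMl.
    - by rewrite -[X in _ --> X](mule0 (pi^-1)%:E); apply: cvgeMl => //; exact: abel_mean_cvg.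
  rewrite -(cvg_lim _ c0)//; apply: lime_ge; first by apply/cvg_ex; exists 0%E.
  exact: nearW.
have [h _] := @ae_eq_integral_abs _ _ R mu setT measurableT _ mf.
have {}h := h _; have : ae_eq mu setT (fun w => (f w)%:E) (cst 0%E).
  apply: h; rewrite -[RHS]If0; apply: eq_integral => w _.
  by rewrite gee0_abs.
apply: filterS => w /(_ I) [] /eqP; rewrite mulf_eq0 => /orP[/eqP/normc_eq0 /eqP|].
  by rewrite subr_eq0 eq_sym => /eqP.
rewrite /poisson mulf_eq0 oner_eq0/= invr_eq0 => /eqP h0; exfalso.
have : 0 < pi * (1 ^+ 2 + w ^+ 2) by rewrite mulr_gt0 ?pi_gt0// ltr_pwDl ?sqr_ge0// exprn_gt0.
by rewrite h0 ltxx.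
Qed.


Hypothesis W2 : (\int[mu]_x (nc (W x) ^+ 2)%:E < +oo)%E.

(* With [a] and [b] the differences of the SAFT of [W chi] with [G] and with
   the k-th Abel mean, [a^2 <= b^2 + 2 m |a - b|] wherever [|a| <= m]. The
   first term is controlled by Plancherel's inequality and the second by
   [abel_mean_cvg]. *)
Lemma saft_cutoff_le (chi : R -> R) : measurable_fun setT chi ->
  (forall x, 0 <= chi x <= 1) -> cintegrable (fun x => W x * (chi x)%:C) ->
  (\int[mu]_w (nc (saft (fun x => (W x * (chi x)%:C)%R) w - G w) ^+ 2)%:E <=
   \int[mu]_x ((nc (W x) * (1 - chi x)) ^+ 2)%:E)%E.
Proof.
move=> mchi chi01 iWchi.
pose beta k := (\int[mu]_x (nc (W x * (chi x)%:C - W x * (E k x)%:C) ^+ 2)%:E)%E.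
pose gamma k := (\int[mu]_w (nc (H k w - G w))%:E)%E.
pose a w := saft (fun x => W x * (chi x)%:C) w - G w.
pose b k w := saft (fun x => W x * (chi x)%:C) w - H k w.
have ma : measurable_fun setT (fun w => nc (a w)).
  apply: measurable_normc.
  by apply: cmeasurableB; [exact: (cmeasurable_saft hB iWchi.1)|exact: iG.1].
have mb k : measurable_fun setT (fun w => nc (b k w)).
  apply: measurable_normc.
  by apply: cmeasurableB; [exact: (cmeasurable_saft hB iWchi.1)|exact: mH].
have mHG k : measurable_fun setT (fun w => nc (H k w - G w)).
  by apply: measurable_normc; apply: cmeasurableB; [exact: mH|exact: iG.1].
have bbeta k : (\int[mu]_w (nc (b k w) ^+ 2)%:E <= beta k)%E.
  apply: le_trans (plancherel_le hB (cintegrableB iWchi (iWE k))).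
  rewrite le_eqVlt; apply/orP; left; apply/eqP.
  by apply: eq_integral => w _; rewrite (saftB hB w iWchi (iWE k)).
have nE k x : nc (W x * (chi x)%:C - W x * (E k x)%:C) = nc (W x) * `|chi x - E k x|.
  by rewrite -mulrBr Normc.normcM -rmorphB normc_real.
have betacvg : beta k @[k --> \oo] --> (\int[mu]_x ((nc (W x) * (1 - chi x)) ^+ 2)%:E)%E.
  have mnW : measurable_fun setT (fun x => nc (W x)) := measurable_normc mW.
  have m1 k : measurable_fun [set: R] (fun x => ((nc (W x) * `|chi x - E k x|) ^+ 2)%:E).
    apply/measurable_EFinP; apply: measurable_funX; apply: measurable_funM => //.
    by apply: measurableT_comp => //; exact: measurable_funB.
  have m2 : measurable_fun [set: R] (fun x => ((nc (W x) * (1 - chi x)) ^+ 2)%:E).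
    apply/measurable_EFinP; apply: measurable_funX; apply: measurable_funM => //.
    exact: measurable_funB.
  have c1 : {ae mu, forall x, setT x -> ((nc (W x) * `|chi x - E k x|) ^+ 2)%:E @[k --> \oo] -->
      ((nc (W x) * (1 - chi x)) ^+ 2)%:E}.
    apply: nearW => x _; apply/fine_cvgP; split; first exact: nearW.
    suff : (nc (W x) * `|chi x - E k x|) ^+ 2 @[k --> \oo] --> (nc (W x) * (1 - chi x)) ^+ 2 by [].
    have h : nc (W x) * `|chi x - E k x| @[k --> \oo] --> nc (W x) * (1 - chi x).
      apply: cvgMr; have -> : 1 - chi x = `|chi x - 1|.
        by have /andP[_ h1] := chi01 x; rewrite distrC ger0_norm// subr_ge0.
      by apply: (@cvg_norm _ R); apply: cvgB => //; exact: cvg_cst.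
    by rewrite expr2; apply: cvgM.
  have i1 : mu.-integrable setT (EFin \o (fun x => nc (W x) ^+ 2)).
    apply/integrableP; split; first by apply/measurable_EFinP; exact: measurable_funX.
    by under eq_integral do rewrite gee0_abs ?lee_fin ?sqr_ge0//.
  have b1 : {ae mu, forall x k, setT x -> (`|((nc (W x) * `|chi x - E k x|%R) ^+ 2)%:E| <=
      (EFin \o (fun x => nc (W x) ^+ 2)%R) x)%E}.
    apply: nearW => x k _ /=; rewrite lee_fin ger0_norm ?sqr_ge0//.
    rewrite exprMn ler_piMr ?sqr_ge0// expr_le1//.
    have /andP[h0 h1] := chi01 x; have e0 := E0 k x; have e1 := E1 k x.
    by rewrite ler_norml; apply/andP; split; lra.
  have [_ _] := @dominated_convergence _ _ R mu setT measurableT _ _ _ m1 m2 c1 i1 b1.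
  rewrite (_ : [sequence _]_n = beta)//; apply/funext => k.
  by apply: eq_integral => x _; rewrite nE.
(* [G] is known only to be integrable, so [a] is not known to be square-integrable. The bound proved
   for each [m] is independent of [m], and [m] tends to infinity by Fatou's lemma. *)
pose f (m : nat) w := if nc (a w) <= m%:R then nc (a w) ^+ 2 else 0.
have mf m : measurable_fun setT (f m).
  apply: measurable_fun_ifT => //; last exact: measurable_funX.
  exact: measurable_fun_ler.
have f0 m w : 0 <= f m w by rewrite /f; case: ifP => // _; exact: sqr_ge0.
apply: (fatou_le mf f0).
  move=> w; apply: cvg_near_cst.
  have nw : nc (a w) <= (Num.bound (nc (a w)))%:R by apply/ltW/archi_boundP/normc_ge0.
  near=> m; rewrite /f ifT//; apply: (le_trans nw); rewrite ler_nat.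
  by near: m; exact: nbhs_infty_ge.
move=> m.
have lek k : (\int[mu]_w (f m w)%:E <= beta k + (2 * m%:R)%:E * gamma k)%E.
  have m1 : measurable_fun [set: R] (fun w => (nc (b k w) ^+ 2)%:E).
    by apply/measurable_EFinP; exact: measurable_funX.
  have m2' : measurable_fun [set: R] (fun w => (nc (H k w - G w))%:E).
    exact/measurable_EFinP.
  have m2 : measurable_fun [set: R] (fun w => (2 * m%:R)%:E * (nc (H k w - G w))%:E)%E.
    exact: emeasurable_funM.
  have m0 : (0 <= (2 * m%:R : R)%:E)%E by rewrite lee_fin mulr_ge0.
  apply: (@le_trans _ _ (\int[mu]_w ((nc (b k w) ^+ 2)%:E + (2 * m%:R)%:E * (nc (H k w - G w))%:E))%E).
    apply: ge0_le_integral => //.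
    - by move=> w _; rewrite lee_fin.
    - by apply/measurable_EFinP; exact: mf.
    - exact: (emeasurable_funD m1 m2).
    - move=> w _; rewrite -EFinM -EFinD lee_fin /f.
      have h : nc (a w) <= nc (b k w) + nc (H k w - G w) by exact: normc_sum3.
      have := normc_ge0 (a w); have := normc_ge0 (b k w); have := normc_ge0 (H k w - G w).
      move: h; move: (nc (a w)) (nc (b k w)) (nc (H k w - G w)) => t s r h r0 s0 t0.
      have m0' : 0 <= m%:R :> R by [].
      case: ifP => [tm|_]; last by rewrite addr_ge0 ?sqr_ge0// mulr_ge0// mulr_ge0.
      have [ts|st] := leP t s.
        apply: (@le_trans _ _ (s ^+ 2)); first by rewrite ler_pXn2r// nnegrE.
        by rewrite lerDl mulr_ge0// mulr_ge0.
      rewrite -lerBlDl subr_sqr.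
      apply: (@le_trans _ _ (r * (2 * t))).
        apply: ler_pM; [lra|lra|lra|lra].
      by rewrite mulrC ler_wpM2r// ler_wpM2l.
  rewrite ge0_integralD//.
  - apply: leeD; first exact: bbeta.
    by rewrite ge0_integralZl// => w _; rewrite lee_fin normc_ge0.
  - by move=> w _; rewrite lee_fin sqr_ge0.
  - by move=> w _; rewrite mule_ge0// lee_fin normc_ge0.
set l := (\int[mu]_x ((nc (W x) * (1 - chi x)) ^+ 2)%:E)%E in betacvg *.
have c0 : (beta k + (2 * m%:R)%:E * gamma k)%E @[k --> \oo] --> l.
  rewrite -[l]adde0; apply: cvgeD => //.
    by rewrite fin_num_adde_defl.
  by rewrite -[X in _ --> X](mule0 (2 * m%:R)%:E); apply: cvgeMl => //; exact: abel_mean_cvg.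
rewrite -(cvg_lim _ c0)//; apply: lime_ge; first by apply/cvg_ex; exists l.
exact: nearW.
Unshelve. all: by end_near. Qed.

End abel_means.

(** * Square-integrable functions *)

Section Lp_spaces.
Context {R : realType}.
Local Notation mu := (@lebesgue_measure R).
Local Notation nc := (@Normc.normc R).
Implicit Types h : R -> R[i].

Definition sqr_cintegrable h :=
  cmeasurable h /\ (\int[mu]_x (nc (h x) ^+ 2)%:E < +oo)%E.

Lemma cLp1P h : cLp 1%:E h <-> cintegrable h.
Proof.
have e : cLnorm 1%:E h = (\int[mu]_x (nc (h x))%:E)%E.
  rewrite /cLnorm Lnorm1; apply: eq_integral => x _.
  by rewrite gee0_abs// lee_fin normc_ge0.
by split => [[h1 h2]|[[h1 h2] h3]]; [rewrite e => h3; split|split => //; rewrite e].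
Qed.

Lemma cLnorm2E h :
  cLnorm 2%:E h = ((\int[mu]_x (nc (h x) ^+ 2)%:E) `^ 2^-1)%E.
Proof.
rewrite /cLnorm unlock; congr (_ `^ _)%E; apply: eq_integral => x _.
by rewrite gee0_abs ?lee_fin ?normc_ge0// poweR_EFin powR_mulrn ?normc_ge0.
Qed.

Lemma cLp2P h : cLp 2%:E h <-> sqr_cintegrable h.
Proof.
split => [[h1 h2]|[[h1 h2] h3]].
  rewrite cLnorm2E => h3; split => //.
  by apply: lty_poweRy h3; rewrite invr_eq0 pnatr_eq0.
by split => //; rewrite cLnorm2E; exact: poweR_lty.
Qed.

Lemma cLnorm2_le h e : 0 <= e ->
  (cLnorm 2%:E h <= e%:E)%E <-> (\int[mu]_x (nc (h x) ^+ 2)%:E <= (e ^+ 2)%:E)%E.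
Proof.
move=> e0; rewrite cLnorm2E; set I := (\int[mu]_x _)%E.
have I0 : (0 <= I)%E by apply: integral_ge0 => x _; rewrite lee_fin sqr_ge0.
have m (x : \bar R) : (0 <= x)%E -> x \in `[0%E, +oo%E].
  by move=> x0; rewrite in_itv/= x0 leey.
have s2 : 0 <= (2^-1 : R) by rewrite invr_ge0.
split => h1.
  have := @gt0_ler_poweR R 2 (ler0n _ _) _ _ (m _ (poweR_ge0 _ _)) (m e%:E _) h1.
  rewrite lee_fin => /(_ e0).
  by rewrite -poweRrM mulVf ?pnatr_eq0// poweRe1// poweR_EFin powR_mulrn.
have := @gt0_ler_poweR R 2^-1 s2 _ _ (m _ I0) (m _ _) h1.
rewrite lee_fin => /(_ (sqr_ge0 _)).
by rewrite poweR_EFin -powR_mulrn// -powRrM mulfV ?pnatr_eq0// powRr1.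
Qed.

Lemma cvg_cLnorm2 (h : nat -> R -> R[i]) :
  cLnorm 2%:E (h n) @[n --> \oo] --> (0 : \bar R) <->
  (\int[mu]_x (nc (h n x) ^+ 2)%:E)%E @[n --> \oo] --> (0 : \bar R).
Proof.
have N0 n : (0 <= cLnorm 2%:E (h n))%E by exact: Lnorm_ge0.
have I0 n : (0 <= \int[mu]_x (nc (h n x) ^+ 2)%:E)%E.
  by apply: integral_ge0 => x _; rewrite lee_fin sqr_ge0.
split => c; apply/cvge0P => // e e0.
  have s0 : 0 < Num.sqrt e by rewrite sqrtr_gt0.
  move/cvge0P : c => /(_ N0 _ s0); apply: filterS => n /cLnorm2_le.
  by rewrite sqrtr_ge0 sqr_sqrtr ?(ltW e0)//; apply.
have s0 : 0 < e ^+ 2 by rewrite exprn_gt0.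
move/cvge0P : c => /(_ I0 _ s0); apply: filterS => n hn.
by apply/cLnorm2_le => //; exact: ltW.
Qed.

(** The crude [a * b <= a ^+ 2 + b ^+ 2] takes the place of the Cauchy-Schwarz inequality: its uses
    call for integrability and a bound uniform over the translates of the wavelet. *)
Lemma cintegrableM_L2 h k : sqr_cintegrable h -> sqr_cintegrable k ->
  cintegrable (fun x => h x * k x) /\
  (\int[mu]_x (nc (h x * k x))%:E <=
   \int[mu]_x (nc (h x) ^+ 2)%:E + \int[mu]_x (nc (k x) ^+ 2)%:E)%E.
Proof.
move=> [mh ih] [mk ik].
have m1 : measurable_fun [set: R] (fun x => (nc (h x) ^+ 2)%:E).
  by apply/measurable_EFinP; apply: measurable_funX; exact: measurable_normc.
have m2 : measurable_fun [set: R] (fun x => (nc (k x) ^+ 2)%:E).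
  by apply/measurable_EFinP; apply: measurable_funX; exact: measurable_normc.
have mhk : cmeasurable (fun x => h x * k x) by exact: cmeasurableM.
suff le : (\int[mu]_x (nc (h x * k x))%:E <=
   \int[mu]_x (nc (h x) ^+ 2)%:E + \int[mu]_x (nc (k x) ^+ 2)%:E)%E.
  by split => //; split => //; apply: le_lt_trans le _; exact: lte_add_pinfty.
rewrite -ge0_integralD//; last 2 first.
- by move=> x _; rewrite lee_fin sqr_ge0.
- by move=> x _; rewrite lee_fin sqr_ge0.
apply: ge0_le_integral => //.
- by move=> x _; rewrite lee_fin normc_ge0.
- by apply/measurable_EFinP; exact: measurable_normc.
- exact: emeasurable_funD.
- move=> x _; rewrite -EFinD lee_fin Normc.normcM.
  by apply: mulr_le_sqrD; exact: normc_ge0.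
Qed.

Lemma sqr_cintegrable_normc_eq h k : cmeasurable k ->
  (forall x, nc (k x) = nc (h x)) -> sqr_cintegrable h -> sqr_cintegrable k.
Proof.
move=> mk hk [mh ih]; split => //; apply: le_lt_trans ih.
by rewrite le_eqVlt; apply/orP; left; apply/eqP; apply: eq_integral => x _; rewrite hk.
Qed.

Lemma sqr_cintegrable_affine h (a b : R) : a != 0 -> sqr_cintegrable h ->
  sqr_cintegrable (fun x => h (a * x + b)).
Proof.
move=> a0 [mh ih]; split; first exact: (cmeasurableT_comp mh (measurable_affine a b)).
rewrite (ge0_integral_affine b a0 (f := fun x => (nc (h x) ^+ 2)%:E)).
- by rewrite lte_mul_pinfty// lee_fin invr_ge0.
- by apply/measurable_EFinP; apply: measurable_funX; exact: measurable_normc.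
- by move=> x; rewrite lee_fin sqr_ge0.
Qed.

(* By [a b <= c a^2 + b^2 / c], with [c] small and then [n] large. *)
Lemma cvg_L2_pairing h (k : nat -> R -> R[i]) : sqr_cintegrable h ->
  (forall n, cmeasurable (k n)) ->
  (\int[mu]_x (nc (k n x) ^+ 2)%:E)%E @[n --> \oo] --> (0 : \bar R) ->
  (\int[mu]_x (nc (h x * k n x))%:E)%E @[n --> \oo] --> (0 : \bar R).
Proof.
move=> [mh ih] mk ck.
have I0 n : (0 <= \int[mu]_x (nc (k n x) ^+ 2)%:E)%E.
  by apply: integral_ge0 => x _; rewrite lee_fin sqr_ge0.
apply/cvge0P => [n|e e0].
  by apply: integral_ge0 => x _; rewrite lee_fin normc_ge0.
pose J : R := fine (\int[mu]_x (nc (h x) ^+ 2)%:E)%E.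
have J0 : 0 <= J by apply: fine_ge0; apply: integral_ge0 => x _; rewrite lee_fin sqr_ge0.
have JE : (\int[mu]_x (nc (h x) ^+ 2)%:E)%E = J%:E.
  rewrite fineK// ge0_fin_numE//.
  by apply: integral_ge0 => x _; rewrite lee_fin sqr_ge0.
(* [J + 1] keeps the divisor positive when [h] vanishes, and [c * J <= e / 2]. The threshold
   [c * (e / 2)] below absorbs the factor [c^-1]. *)
pose c := e / 2 / (J + 1).
have J1 : 0 < J + 1 by rewrite ltr_wpDl.
have c0 : 0 < c by rewrite !divr_gt0.
have cJ : c * J <= e / 2.
  rewrite /c mulrAC -mulrA ler_piMr ?divr_ge0 ?(ltW e0)// ler_pdivrMr//.
  by rewrite mul1r lerDl.
have ec0 : 0 < c * (e / 2) by rewrite mulr_gt0// divr_gt0.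
move/cvge0P : ck => /(_ I0 _ ec0); apply: filterS => n hn.
have m1 : measurable_fun [set: R] (fun x => c%:E * (nc (h x) ^+ 2)%:E)%E.
  apply: emeasurable_funM => //; apply/measurable_EFinP.
  by apply: measurable_funX; exact: measurable_normc.
have mkn : measurable_fun [set: R] (fun x => (nc (k n x) ^+ 2)%:E).
  by apply/measurable_EFinP; apply: measurable_funX; exact: measurable_normc.
have mhn : measurable_fun [set: R] (fun x => (nc (h x) ^+ 2)%:E).
  by apply/measurable_EFinP; apply: measurable_funX; exact: measurable_normc.
have m2 : measurable_fun [set: R] (fun x => c^-1%:E * (nc (k n x) ^+ 2)%:E)%E.
  exact: emeasurable_funM.
apply: (@le_trans _ _ (\int[mu]_x (c%:E * (nc (h x) ^+ 2)%:E + c^-1%:E * (nc (k n x) ^+ 2)%:E))%E).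
  apply: ge0_le_integral => //.
  - by move=> x _; rewrite lee_fin normc_ge0.
  - by apply/measurable_EFinP; exact: (measurable_normc (cmeasurableM mh (mk n))).
  - exact: (emeasurable_funD m1 m2).
  - move=> x _; rewrite -!EFinM -EFinD lee_fin Normc.normcM.
    have a0 := normc_ge0 (h x); have b0 := normc_ge0 (k n x).
    move: (nc (h x)) (nc (k n x)) a0 b0 => a b a0 b0.
    have -> : c * a ^+ 2 + c^-1 * b ^+ 2 = c^-1 * ((c * a) ^+ 2 + b ^+ 2).
      by field; rewrite gt_eqF.
    rewrite -(ler_pM2l c0) [leRHS]mulrA mulfV ?gt_eqF// mul1r mulrA.
    by apply: mulr_le_sqrD => //; rewrite mulr_ge0// ltW.
have ci0 : (0 <= (c^-1)%:E)%E by rewrite lee_fin invr_ge0 ltW.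
rewrite ge0_integralD//; last 2 first.
- by move=> x _; rewrite mule_ge0// lee_fin ?sqr_ge0// ltW.
- by move=> x _; rewrite mule_ge0// lee_fin sqr_ge0.
rewrite ge0_integralZl//; last 2 first.
- by move=> x _; rewrite lee_fin sqr_ge0.
- by rewrite lee_fin ltW.
rewrite ge0_integralZl//; last by move=> x _; rewrite lee_fin sqr_ge0.
rewrite JE -EFinM [e in (_ <= e%:E)%E]splitr EFinD; apply: leeD; first by rewrite lee_fin.
apply: le_trans (lee_wpmul2l ci0 hn) _.
by rewrite -EFinM lee_fin mulKf // gt_eqF.
Qed.

End Lp_spaces.

(** * The wavelet transform *)

Section wavelet.
Context {R : realType}.
Local Notation mu := (@lebesgue_measure R).
Local Notation nc := (@Normc.normc R).
Variables (A B C D p q : R).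
Hypothesis hB : B != 0.
Variable zeta : R.
Hypothesis zeta0 : 0 < zeta.
Local Notation L := (SaftParams A B C D p q).
Local Notation K := (saft_kernel L).
Local Notation saft := (saft_integral L [set: R]).
Local Notation kb := (nc (saft_KB L)).
Local Notation wav psi t x := (sa_wavelet L psi t zeta x).
Local Notation Psi psi := (fun x => sa_Psi L psi x zeta).

Let kz : R := kb / Num.sqrt zeta.

Let kz0 : 0 <= kz. Proof. by rewrite divr_ge0 ?normc_ge0 ?sqrtr_ge0. Qed.

Lemma sa_waveletE psi t x : wav psi t x =
  saft_KB L / (Num.sqrt zeta)%:C * psi ((x - t) / zeta) * expi (A * x * (t - x) / B).
Proof. by []. Qed.

Lemma normc_wavelet psi t x : nc (wav psi t x) = kz * nc (psi ((x - t) / zeta)).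
Proof.
rewrite sa_waveletE Normc.normcM normc_expi mulr1.
rewrite Normc.normcM Normc.normcM Normc.normcV normc_real.
by rewrite (ger0_norm (sqrtr_ge0 _)).
Qed.

Lemma cmeasurable_wavelet psi : cmeasurable psi ->
  cmeasurable (fun z : R * R => wav psi z.1 z.2).
Proof.
move=> mpsi; apply: cmeasurableM; first apply: cmeasurableM.
- exact: cmeasurable_cst.
- apply: (cmeasurableT_comp mpsi); apply: measurable_funM => //.
  exact: measurable_funB.
- apply: cmeasurable_expi; apply: measurable_funM => //.
  apply: measurable_funM; last exact: measurable_funB.
  exact: measurable_funM.
Qed.

Lemma cmeasurable_wavelet1 psi x : cmeasurable psi -> cmeasurable (fun t => wav psi t x).
Proof.
move=> mpsi; exact: (cmeasurableT_comp (cmeasurable_wavelet mpsi) (measurable_pair2 x)).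
Qed.

Lemma cmeasurable_wavelet2 psi t : cmeasurable psi -> cmeasurable (fun x => wav psi t x).
Proof.
move=> mpsi; exact: (cmeasurableT_comp (cmeasurable_wavelet mpsi) (measurable_pair1 t)).
Qed.

Let zV0 : zeta^-1 != 0. Proof. by rewrite invr_eq0 gt_eqF. Qed.
Let NzV0 : - zeta^-1 != 0. Proof. by rewrite oppr_eq0. Qed.

(** The modulus depends on [x - t] only, so integrating in [t] or in [x] gives the same value. The
    integral in [t] bounds [eta] uniformly, the one in [x] makes it integrable. *)
Lemma integral_wavelet1 psi x : cmeasurable psi ->
  (\int[mu]_t (nc (wav psi t x))%:E = (kz * zeta)%:E * \int[mu]_y (nc (psi y))%:E)%E.
Proof.
move=> mpsi; under eq_integral do rewrite normc_wavelet.
have mn : measurable_fun [set: R] (fun y => (nc (psi y))%:E).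
  by apply/measurable_EFinP; exact: measurable_normc.
have -> : (\int[mu]_t (kz * nc (psi ((x - t) / zeta)))%:E =
    kz%:E * \int[mu]_t (nc (psi (- zeta^-1 * t + x / zeta)))%:E)%E.
  rewrite -integral_cst_normc//; last first.
    exact: (cmeasurableT_comp mpsi (measurable_affine _ _)).
  apply: eq_integral => t _; congr (_ * nc (psi _))%:E.
  by field; rewrite gt_eqF.
rewrite (ge0_integral_affine _ NzV0 mn); last by move=> y; rewrite lee_fin normc_ge0.
by rewrite normrN normfV invrK gtr0_norm// muleA -EFinM.
Qed.

Lemma integral_wavelet2 psi t : cmeasurable psi ->
  (\int[mu]_x (nc (wav psi t x))%:E = (kz * zeta)%:E * \int[mu]_y (nc (psi y))%:E)%E.
Proof.
move=> mpsi; under eq_integral do rewrite normc_wavelet.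
have mn : measurable_fun [set: R] (fun y => (nc (psi y))%:E).
  by apply/measurable_EFinP; exact: measurable_normc.
have -> : (\int[mu]_x (kz * nc (psi ((x - t) / zeta)))%:E =
    kz%:E * \int[mu]_x (nc (psi (zeta^-1 * x + (- t / zeta))))%:E)%E.
  rewrite -integral_cst_normc//; last first.
    exact: (cmeasurableT_comp mpsi (measurable_affine _ _)).
  apply: eq_integral => x _; congr (_ * nc (psi _))%:E.
  by field; rewrite gt_eqF.
rewrite (ge0_integral_affine _ zV0 mn); last by move=> y; rewrite lee_fin normc_ge0.
by rewrite normfV invrK gtr0_norm// muleA -EFinM.
Qed.

Lemma cintegrable_wavelet1 psi x : cintegrable psi -> cintegrable (fun t => wav psi t x).
Proof.
move=> [mpsi ipsi]; split; first exact: cmeasurable_wavelet1.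
rewrite integral_wavelet1//; apply: lte_mul_pinfty => //.
by rewrite lee_fin mulr_ge0// ltW.
Qed.

Lemma cintegrable_wavelet2 psi t : cintegrable psi -> cintegrable (fun x => wav psi t x).
Proof.
move=> [mpsi ipsi]; split; first exact: cmeasurable_wavelet2.
rewrite integral_wavelet2//; apply: lte_mul_pinfty => //.
by rewrite lee_fin mulr_ge0// ltW.
Qed.

Lemma sqr_cintegrable_wavelet psi t : sqr_cintegrable psi ->
  sqr_cintegrable (fun x => wav psi t x) /\
  (\int[mu]_x (nc (wav psi t x) ^+ 2)%:E =
   (kz ^+ 2 * zeta)%:E * \int[mu]_y (nc (psi y) ^+ 2)%:E)%E.
Proof.
move=> [mpsi ipsi].
have mn : measurable_fun [set: R] (fun y => (nc (psi y) ^+ 2)%:E).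
  by apply/measurable_EFinP; apply: measurable_funX; exact: measurable_normc.
suff e : (\int[mu]_x (nc (wav psi t x) ^+ 2)%:E =
   (kz ^+ 2 * zeta)%:E * \int[mu]_y (nc (psi y) ^+ 2)%:E)%E.
  split => //; split; first exact: cmeasurable_wavelet2.
  by rewrite e lte_mul_pinfty// lee_fin mulr_ge0 ?sqr_ge0// ltW.
have h := ge0_integral_affine (- t / zeta) zV0 mn.
rewrite normfV invrK gtr0_norm// in h.
rewrite EFinM -muleA -h; last by move=> y; rewrite lee_fin sqr_ge0.
rewrite -ge0_integralZl//; first last.
- by rewrite lee_fin sqr_ge0.
- by move=> y _; rewrite lee_fin sqr_ge0.
- exact: (measurableT_comp mn (measurable_affine _ _)).
apply: eq_integral => x _; rewrite normc_wavelet exprMn -EFinM; congr (_ * nc (psi _) ^+ 2)%:E.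
by field; rewrite gt_eqF.
Qed.

Lemma sa_PsiE psi x : sa_Psi L psi x zeta =
  expi ((2 * B)^-1 * (A * x ^+ 2 * (zeta ^+ 2 - 1) + 2 * x * p * (zeta - 1)))
  * conjc (psi (- x)).
Proof. by []. Qed.

Lemma normc_Psi psi x : nc (sa_Psi L psi x zeta) = nc (psi (- x)).
Proof. by rewrite sa_PsiE Normc.normcM normc_expi mul1r normc_conj. Qed.

Lemma cmeasurable_Psi psi : cmeasurable psi -> cmeasurable (Psi psi).
Proof.
move=> mpsi; apply: cmeasurableM; last first.
  by apply: cmeasurable_conj; exact: (cmeasurableT_comp mpsi).
apply: cmeasurable_expi; apply: measurable_funM => //; apply: measurable_funD.
  by apply: measurable_funM => //; apply: measurable_funM => //; exact: measurable_funX.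
by apply: measurable_funM => //; apply: measurable_funM => //; exact: measurable_funM.
Qed.

Let N1 : (-1 : R) != 0. Proof. by rewrite oppr_eq0 oner_eq0. Qed.

Lemma cintegrable_Psi psi : cintegrable psi -> cintegrable (Psi psi).
Proof.
move=> ipsi; split; first exact: cmeasurable_Psi ipsi.1.
rewrite [X in (X < _)%E](_ : _ = \int[mu]_x (nc (psi (-1 * x + 0)))%:E)%E.
  exact: (cintegrable_affine 0 N1 ipsi).2.
by apply: eq_integral => x _; rewrite normc_Psi mulN1r addr0.
Qed.

Lemma sqr_cintegrable_Psi psi : sqr_cintegrable psi -> sqr_cintegrable (Psi psi).
Proof.
move=> ipsi; split; first exact: cmeasurable_Psi ipsi.1.
rewrite [X in (X < _)%E](_ : _ = \int[mu]_x (nc (psi (-1 * x + 0)) ^+ 2)%:E)%E.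
  exact: (sqr_cintegrable_affine 0 N1 ipsi).2.
by apply: eq_integral => x _; rewrite normc_Psi mulN1r addr0.
Qed.

Definition saft_multiplier (w : R) : R[i] := (Num.sqrt zeta)%:C *
  expi ((2 * B)^-1 * (2 * w * zeta * (D * p - B * q) - D * w ^+ 2 * zeta ^+ 2)).

Local Notation M := saft_multiplier.

(** After the substitution [x = t - zeta * y], the chirp of the wavelet cancels the cross term in
    [t * y], which lets [K t w] come out. The phase of [sa_Psi] makes up the difference between the
    chirps in [zeta * y] and in [y], and the phase of the multiplier cancels the chirp in [w] of the
    kernel at [zeta * w]. The Jacobian [zeta] against the normalisation by the square root leaves
    that square root. *)
Lemma saft_wavelet psi t w : cintegrable psi ->
  saft (fun x => wav psi t x) w = K t w * conjc (M w * saft (Psi psi) (zeta * w)).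
Proof.
move=> ipsi.
have iP : cintegrable (fun y => sa_Psi L psi y zeta * K y (zeta * w)).
  exact: (cintegrableM_kernel hB _ (cintegrable_Psi ipsi)).
have i1 : cintegrable (fun x => wav psi t x * K x w).
  exact: (cintegrableM_kernel hB w (cintegrable_wavelet2 t ipsi)).
have Nz0 : - zeta != 0 by rewrite oppr_eq0 gt_eqF.
have := cintegral_affine t Nz0 i1; rewrite normrN gtr0_norm// => e.
have -> : saft (fun x => wav psi t x) w = zeta%:C * ((zeta^-1)%:C *
    cintegral setT (fun x => wav psi t x * K x w)).
  by rewrite mulrA -rmorphM mulfV ?gt_eqF// mul1r.
rewrite -e conjcM /saft_integral -cintegral_conj// mulrA -!cintegralZl//; last 2 first.
- exact: cintegrable_conj.
- exact: (cintegrable_affine t Nz0 i1).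
congr cintegral; apply/funext => y.
rewrite sa_waveletE sa_PsiE !(saft_kernelE hB) /saft_multiplier !conjcM !num_conjE !conjcK !conjc_expi.
rewrite !conjc_real.
have -> : (- zeta * y + t - t) / zeta = - y by field; rewrite gt_eqF.
have s0 : Num.sqrt zeta != 0 by rewrite gt_eqF// sqrtr_gt0.
have zE : zeta%:C = (Num.sqrt zeta)%:C * (Num.sqrt zeta)%:C.
  by rewrite -rmorphM -expr2 sqr_sqrtr ?ltW.
have sC0 : (Num.sqrt zeta)%:C != 0 by rewrite fmorph_eq0.
pose x := - zeta * y + t; rewrite -/x.
have phase : expi (A * x * (t - x) / B) * expi (chirpx A B p x) *
    expi (chirpw B D p q w) * expi (- (x * w / B)) =
  expi (chirpx A B p t) * expi (chirpw B D p q w) * expi (- (t * w / B)) *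
  expi (- ((2 * B)^-1 *
     (2 * w * zeta * (D * p - B * q) - D * w ^+ 2 * zeta ^+ 2))) *
  (expi (- ((2 * B)^-1 * (A * y ^+ 2 * (zeta ^+ 2 - 1) + 2 * y * p * (zeta - 1)))) *
    (expi (- chirpx A B p y) * expi (- chirpw B D p q (zeta * w)) *
     expi (- - (y * (zeta * w) / B)))).
  by rewrite -!expiD; congr expi; rewrite /x /chirpx /chirpw; field.
transitivity ((Num.sqrt zeta)%:C * saft_KB L * conjc (saft_KB L) * psi (- y) *
   (expi (A * x * (t - x) / B) * expi (chirpx A B p x) * expi (chirpw B D p q w) *
    expi (- (x * w / B)))).
  by rewrite zE; field.
rewrite phase; move: (expi _) (expi _) (expi _) (expi _) (expi _) (expi _) (expi _) (expi _).
move: (saft_KB L) (conjc _) => ? ? *; ring.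
Qed.

Section transform_bounds.
Variables (f psi : R -> R[i]).
Hypotheses (hf : sqr_cintegrable f) (hpsi : sqr_cintegrable psi).

Local Notation W := (fun t => sa_wavelet_transform L psi f t zeta).

Lemma cintegrable_transform t : cintegrable (fun x => f x * conjc (wav psi t x)) /\
  (\int[mu]_x (nc (f x * conjc (wav psi t x)))%:E <= \int[mu]_x (nc (f x) ^+ 2)%:E +
   (kz ^+ 2 * zeta)%:E * \int[mu]_y (nc (psi y) ^+ 2)%:E)%E.
Proof.
have [h1 h2] := sqr_cintegrable_wavelet t hpsi.
have h3 : sqr_cintegrable (fun x => conjc (wav psi t x)).
  apply: (sqr_cintegrable_normc_eq _ _ h1); first exact: cmeasurable_conj h1.1.
  by move=> x; rewrite normc_conj.
have [i1 i2] := cintegrableM_L2 hf h3; split => //.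
apply: le_trans i2 _; rewrite -h2 leeD2l// le_eqVlt; apply/orP; left; apply/eqP.
by apply: eq_integral => x _; rewrite normc_conj.
Qed.

Definition transform_bound : R := fine (\int[mu]_x (nc (f x) ^+ 2)%:E +
   (kz ^+ 2 * zeta)%:E * \int[mu]_y (nc (psi y) ^+ 2)%:E)%E.

Lemma le_transform_bound t :
  (\int[mu]_x (nc (f x * conjc (wav psi t x)))%:E <= transform_bound%:E)%E.
Proof.
have [_] := cintegrable_transform t; rewrite /transform_bound fineK//.
rewrite fin_numD; apply/andP; split.
  rewrite ge0_fin_numE; first exact: hf.2.
  by apply: integral_ge0 => x _; rewrite lee_fin sqr_ge0.
rewrite fin_numM// ge0_fin_numE; first exact: hpsi.2.
by apply: integral_ge0 => x _; rewrite lee_fin sqr_ge0.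
Qed.

Lemma normc_transform_le t : nc (W t) <= transform_bound.
Proof.
rewrite -lee_fin; apply: le_trans (le_transform_bound t).
exact: normc_cintegral_le (cintegrable_transform t).1.
Qed.

Lemma cmeasurable_transform_integrand :
  cmeasurable (fun z : R * R => f z.2 * conjc (wav psi z.1 z.2)).
Proof.
apply: cmeasurableM; first exact: (cmeasurableT_comp hf.1).
by apply: cmeasurable_conj; exact: cmeasurable_wavelet hpsi.1.
Qed.

Lemma cmeasurable_transform : cmeasurable W.
Proof. exact: (cmeasurable_cintegral_prod cmeasurable_transform_integrand). Qed.

End transform_bounds.

End wavelet.
Arguments saft_wavelet {R A B C D p q} hB {zeta} zeta0 {psi} t w.
Arguments normc_transform_le {R A B C D p q zeta} zeta0 {f psi} hf hpsi t.
Arguments le_transform_bound {R A B C D p q zeta} zeta0 {f psi} hf hpsi t.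
Arguments cmeasurable_transform {R A B C D p q zeta f psi} hf hpsi.
Arguments cintegrable_transform {R A B C D p q zeta} zeta0 {f psi} hf hpsi t.

(** * Parseval formula for an integrable wavelet *)

Section wavelet_parseval.
Context {R : realType}.
Local Notation mu := (@lebesgue_measure R).
Local Notation nc := (@Normc.normc R).
Variables (A B C D p q : R).
Hypothesis hB : B != 0.
Variable zeta : R.
Hypothesis zeta0 : 0 < zeta.
Local Notation L := (SaftParams A B C D p q).
Local Notation K := (saft_kernel L).
Local Notation saft := (saft_integral L [set: R]).
Local Notation kb := (nc (saft_KB L)).
Local Notation wav psi t x := (sa_wavelet L psi t zeta x).
Local Notation Psi psi := (fun x => sa_Psi L psi x zeta).
Local Notation M := (saft_multiplier B D p q zeta).
Local Notation W f psi := (fun t => sa_wavelet_transform L psi f t zeta).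

Variables (f fhat : R -> R[i]).
Hypotheses (hf : sqr_cintegrable f) (hfhat : sqr_cintegrable fhat).
Hypothesis f_parseval : forall phi, saft_test L phi ->
  cinner f phi = cinner fhat (saft phi).

Section integrable_wavelet.
Variables (psi phi : R -> R[i]) (Mphi : R).
Hypotheses (ipsi : cintegrable psi) (hpsi : sqr_cintegrable psi).
Hypotheses (iphi : cintegrable phi) (bphi : forall x, nc (phi x) <= Mphi).
Hypothesis (iphihat : cintegrable (saft phi)).

(* The adjoint of the transform applied to [phi]; it is again a test function
   because [psi] is integrable. *)
Let eta x := cintegral setT (fun t => phi t * wav psi t x).

Let mwav : cmeasurable (fun z : R * R => wav psi z.1 z.2).
Proof. exact: cmeasurable_wavelet ipsi.1. Qed.

Let mpw : cmeasurable (fun z : R * R => phi z.1 * wav psi z.1 z.2).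
Proof. by apply: cmeasurableM => //; exact: (cmeasurableT_comp iphi.1). Qed.

Let mpws : cmeasurable (fun z : R * R => phi z.2 * wav psi z.2 z.1).
Proof. exact: (cmeasurableT_comp mpw (@measurable_swap _ _ _ _)). Qed.

Let wav_L1 : R := fine (\int[mu]_y (nc (wav psi 0 y))%:E)%E.

Let integral_wav2 t : (\int[mu]_x (nc (wav psi t x))%:E = wav_L1%:E)%E.
Proof.
rewrite /wav_L1 fineK; last first.
  exact: integrable_fin_num (integrable_normc (cintegrable_wavelet2 _ _ _ _ _ _ zeta0 _ ipsi)).
by rewrite !integral_wavelet2//; exact: ipsi.1.
Qed.

Let integral_wav1 x : (\int[mu]_t (nc (wav psi t x))%:E = wav_L1%:E)%E.
Proof.
rewrite -(integral_wav2 0) integral_wavelet1//; last exact: ipsi.1.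
by rewrite integral_wavelet2//; exact: ipsi.1.
Qed.

Let wav_L1_ge0 : 0 <= wav_L1.
Proof. by apply: fine_ge0; apply: integral_ge0 => y _; rewrite lee_fin normc_ge0. Qed.

Let ipw x : cintegrable (fun t => phi t * wav psi t x).
Proof.
rewrite (_ : (fun _ => _) = (fun t => wav psi t x * phi t)); last first.
  by apply/funext => t; rewrite mulrC.
apply: cintegrableM_bounded bphi _; first exact: iphi.1.
exact: cintegrable_wavelet1.
Qed.

Let ipw2 : (\int[mu]_t \int[mu]_x (nc (phi t * wav psi t x))%:E < +oo)%E.
Proof.
have e t : (\int[mu]_x (nc (phi t * wav psi t x))%:E = wav_L1%:E * (nc (phi t))%:E)%E.
  rewrite -(integral_wav2 t) muleC -integral_cst_normc ?normc_ge0//.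
    by apply: eq_integral => x _; rewrite Normc.normcM.
  exact: (cintegrable_wavelet2 _ _ _ _ _ _ zeta0 _ ipsi).1.
under eq_integral do rewrite e.
rewrite ge0_integralZl//.
- by apply: lte_mul_pinfty => //; exact: iphi.2.
- by apply/measurable_EFinP; exact: measurable_normc iphi.1.
- by move=> t _; rewrite lee_fin normc_ge0.
Qed.

Let ieta : cintegrable eta.
Proof.
have i : (\int[mu]_x \int[mu]_t (nc (phi t * wav psi t x))%:E < +oo)%E.
  by rewrite -(normc_tonelli mpw).
exact: (cintegrable_cintegral_prod mpws i).
Qed.

Let beta x : nc (eta x) <= Mphi * wav_L1.
Proof.
have M0 : 0 <= Mphi by apply: le_trans (bphi 0); exact: normc_ge0.
rewrite -lee_fin; apply: le_trans (normc_cintegral_le (ipw x)) _.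
rewrite EFinM -(integral_wav1 x) -integral_cst_normc//; last first.
  exact: cmeasurable_wavelet1 ipsi.1.
apply: ge0_le_integral => //.
- by move=> t _; rewrite lee_fin normc_ge0.
- by apply/measurable_EFinP; exact: measurable_normc (ipw x).1.
- apply/measurable_EFinP; apply: measurable_funM => //.
  exact: measurable_normc (cmeasurable_wavelet1 _ _ _ _ _ _ _ _ ipsi.1).
- by move=> t _; rewrite lee_fin Normc.normcM ler_wpM2r ?normc_ge0.
Qed.

Let saft_eta w : saft eta w = conjc (M w * saft (Psi psi) (zeta * w)) * saft phi w.
Proof.
have m3 : cmeasurable (fun z : R * R => phi z.2 * wav psi z.2 z.1 * K z.1 w).
  apply: cmeasurableM => //.
  exact: (cmeasurableT_comp (cmeasurable_kernel1 hB w) measurable_fst).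
have m3s : cmeasurable (fun z : R * R => phi z.1 * wav psi z.1 z.2 * K z.2 w).
  exact: (cmeasurableT_comp m3 (@measurable_swap _ _ _ _)).
have i3 : (\int[mu]_x \int[mu]_t (nc (phi t * wav psi t x * K x w))%:E < +oo)%E.
  rewrite -(normc_tonelli m3s).
  have e t : (\int[mu]_x (nc (phi t * wav psi t x * K x w))%:E =
      kb%:E * \int[mu]_x (nc (phi t * wav psi t x))%:E)%E.
    rewrite -integral_cst_normc ?normc_ge0//.
      apply: eq_integral => x _; rewrite (Normc.normcM (phi t * _)) (normc_kernel hB).
      by rewrite mulrC.
    exact: (cmeasurableT_comp mpw (measurable_pair1 t)).
  under eq_integral do rewrite e.
  rewrite ge0_integralZl//.
  - by apply: lte_mul_pinfty => //; rewrite lee_fin normc_ge0.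
  - apply: (@measurable_ge0_integral_prod _ (fun z => (nc (phi z.1 * wav psi z.1 z.2))%:E)).
      by apply/measurable_EFinP; exact: measurable_normc mpw.
    by move=> z; rewrite lee_fin normc_ge0.
  - by move=> t _; apply: integral_ge0 => x _; rewrite lee_fin normc_ge0.
  - by rewrite lee_fin normc_ge0.
transitivity (cintegral setT (fun x => cintegral setT (fun t => phi t * wav psi t x * K x w))).
  congr cintegral; apply/funext => x; rewrite mulrC -cintegralZl; last exact: ipw.
  by congr cintegral; apply/funext => t; rewrite mulrC.
rewrite (cintegral_fubini m3)//.
rewrite -cintegralZl; last exact: (cintegrableM_kernel hB).
congr cintegral; apply/funext => t.
rewrite [RHS]mulrCA [X in phi t * X]mulrC -(saft_wavelet hB zeta0)//.
rewrite -cintegralZl; last first.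
  exact: (cintegrableM_kernel hB _ (cintegrable_wavelet2 _ _ _ _ _ _ zeta0 _ ipsi)).
by congr cintegral; apply/funext => x; rewrite mulrA.
Qed.

Let bsaft w : nc (conjc (M w * saft (Psi psi) (zeta * w))) <=
  Num.sqrt zeta * (kb * fine (\int[mu]_x (nc (sa_Psi L psi x zeta))%:E)%E).
Proof.
rewrite normc_conj Normc.normcM /saft_multiplier Normc.normcM normc_expi mulr1.
rewrite normc_real (ger0_norm (sqrtr_ge0 _)) ler_wpM2l ?sqrtr_ge0//.
have iP := cintegrable_Psi A B C D p q zeta ipsi.
rewrite -lee_fin EFinM fineK; first exact: (normc_saft_le hB).
exact: integrable_fin_num (integrable_normc iP).
Qed.

(** Integrability of [psi] bounds the SAFT of [Psi], so that [saft eta], a bounded multiple of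
    [saft phi], inherits its integrability. *)
Let saft_test_eta : saft_test L eta.
Proof.
split; first exact/cLp1P.
  by exists (Mphi * wav_L1).
apply/cLp1P.
rewrite (_ : saft eta = (fun w => saft phi w * conjc (M w * saft (Psi psi) (zeta * w)))).
  apply: cintegrableM_bounded bsaft iphihat.
  apply: cmeasurable_conj; apply: cmeasurableM.
    apply: cmeasurableM; first exact: cmeasurable_cst.
    apply: cmeasurable_expi; apply: measurable_funM => //; apply: measurable_funB.
      by apply: measurable_funM => //; apply: measurable_funM => //; exact: measurable_funM.
    by apply: measurable_funM => //; apply: measurable_funM => //; exact: measurable_funX.
  have iP := cintegrable_Psi A B C D p q zeta ipsi.
  apply: (cmeasurableT_comp (cmeasurable_saft hB iP.1)).
  exact: mulrl_measurable.
by apply/funext => w; rewrite saft_eta mulrC.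
Qed.

Lemma transform_parseval_L1 : cinner (W f psi) phi =
  cinner (fun w => M w * fhat w * saft (Psi psi) (zeta * w)) (saft phi).
Proof.
transitivity (cinner f eta); last first.
  rewrite (f_parseval saft_test_eta) /cinner.
  congr (cintegral _ _); apply/funext => w.
  rewrite saft_eta !num_conjE (conjcM (conjc _)) conjcK.
  by move: (M w) (saft _ _) (conjc _) => m s v; ring.
pose F (z : R * R) := f z.2 * conjc (wav psi z.1 z.2) * conjc (phi z.1).
have mF : cmeasurable F.
  apply: cmeasurableM; first exact: cmeasurable_transform_integrand hpsi.
  by apply: cmeasurable_conj; exact: (cmeasurableT_comp iphi.1).
(* The integral over [x] of the transform's integrand is bounded by [TB] uniformly in [t], so
   integrability of [phi] suffices. *)
have iF : (\int[mu]_t \int[mu]_x (nc (F (t, x)))%:E < +oo)%E.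
  pose TB := transform_bound A B C D p q zeta f psi.
  have TB0 : 0 <= TB.
    by apply: le_trans (normc_transform_le zeta0 hf hpsi 0); exact: normc_ge0.
  have ht t : (\int[mu]_x (nc (F (t, x)))%:E <= TB%:E * (nc (phi t))%:E)%E.
    rewrite muleC; apply: le_trans (lee_wpmul2l _ (le_transform_bound zeta0 hf hpsi t)).
      rewrite -integral_cst_normc ?normc_ge0//; last exact: (cintegrable_transform zeta0 hf hpsi t).1.1.
      rewrite le_eqVlt; apply/orP; left; apply/eqP; apply: eq_integral => x _.
      by rewrite /F [LHS]/= Normc.normcM normc_conj mulrC.
    by rewrite lee_fin normc_ge0.
  have mph : measurable_fun [set: R] (fun t => (nc (phi t))%:E).
    by apply/measurable_EFinP; exact: measurable_normc iphi.1.
  apply: (@le_lt_trans _ _ (\int[mu]_t (TB%:E * (nc (phi t))%:E))%E).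
    apply: ge0_le_integral => //.
    - by move=> t _; apply: integral_ge0 => x _; rewrite lee_fin normc_ge0.
    - apply: (@measurable_ge0_integral_prod _ (fun z => (nc (F z))%:E)).
        by apply/measurable_EFinP; exact: measurable_normc mF.
      by move=> z; rewrite lee_fin normc_ge0.
    - exact: emeasurable_funM.
  rewrite ge0_integralZl//.
  - by apply: lte_mul_pinfty => //; exact: iphi.2.
  - by move=> t _; rewrite lee_fin normc_ge0.
transitivity (cintegral setT (fun t => cintegral setT (fun x => F (t, x)))).
  congr cintegral; apply/funext => t; rewrite num_conjE mulrC.
  rewrite -cintegralZl; last exact: (cintegrable_transform zeta0 hf hpsi t).1.
  by congr cintegral; apply/funext => x; rewrite mulrC.
rewrite (cintegral_fubini mF)//; congr cintegral; apply/funext => x.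
rewrite num_conjE -cintegral_conj; last exact: ipw.
rewrite -cintegralZl; last exact/cintegrable_conj/ipw.
congr cintegral; apply/funext => t.
by rewrite (conjcM (phi t)) [conjc (phi t) * _]mulrC mulrA.
Qed.

End integrable_wavelet.

End wavelet_parseval.

(** * Truncation to bounded intervals *)

Section truncation.
Context {R : realType}.
Local Notation mu := (@lebesgue_measure R).
Local Notation nc := (@Normc.normc R).

(** A sharp cutoff, unlike [tent], to reproduce the integrals over [[- n, n]] in the limit in the
    mean. *)
Definition cutoff (n : nat) (x : R) : R := \1_(`[- n%:R, n%:R]%classic : set R) x.

Lemma cutoff01 n x : 0 <= cutoff n x <= 1.
Proof. by rewrite /cutoff indicE; case: (_ \in _); rewrite ?ler01 ?lexx. Qed.

Lemma cutoffN n x : cutoff n (- x) = cutoff n x.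
Proof.
rewrite /cutoff !indicE !mem_setE /= !in_itv/= lerNl opprK [- x <= _]lerNl.
by rewrite andbC.
Qed.

Lemma measurable_cutoff n : measurable_fun setT (cutoff n).
Proof. by apply: measurable_indic; exact: measurable_itv. Qed.

Lemma cvg_cutoff (x : R) : cutoff n x @[n --> \oo] --> (1 : R).
Proof.
apply: cvg_near_cst.
have xb : `|x| <= (Num.bound `|x|)%:R by apply/ltW/archi_boundP.
near=> n; rewrite /cutoff indicE mem_set//= in_itv/= -ler_norml.
apply: (le_trans xb); rewrite ler_nat; near: n; exact: nbhs_infty_ge.
Unshelve. all: by end_near. Qed.

Lemma integral_cutoff_lty n : (\int[mu]_x (cutoff n x)%:E < +oo)%E.
Proof.
have mE : measurable (`[- n%:R, n%:R]%classic : set R) by exact: measurable_itv.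
rewrite integral_indic// setIT; have := lebesgue_measure_itv `[- n%:R : R, n%:R] => /= ->.
by case: ifP => _; rewrite -?EFinB ltry.
Qed.

Definition truncate (n : nat) (h : R -> R[i]) (x : R) : R[i] := h x * (cutoff n x)%:C.

Lemma normc_truncate n h x : nc (truncate n h x) = nc (h x) * cutoff n x.
Proof.
have /andP[c0 _] := cutoff01 n x.
by rewrite /truncate Normc.normcM normc_real ger0_norm.
Qed.

Lemma normc_truncate_le n h x : nc (truncate n h x) <= nc (h x).
Proof.
have /andP[_ c1] := cutoff01 n x.
by rewrite normc_truncate ler_piMr// normc_ge0.
Qed.

Lemma cmeasurable_truncate n h : cmeasurable h -> cmeasurable (truncate n h).
Proof.
move=> mh; apply: cmeasurableM => //; apply: cmeasurable_real.
exact: measurable_cutoff.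
Qed.

Lemma sqr_cintegrable_truncate n h : sqr_cintegrable h -> sqr_cintegrable (truncate n h).
Proof.
move=> [mh ih]; split; first exact: cmeasurable_truncate.
apply: le_lt_trans ih; apply: ge0_le_integral => //.
- by move=> x _; rewrite lee_fin sqr_ge0.
- apply/measurable_EFinP; apply: measurable_funX.
  exact: measurable_normc (cmeasurable_truncate n mh).
- by apply/measurable_EFinP; apply: measurable_funX; exact: measurable_normc mh.
- by move=> x _; rewrite lee_fin ler_pXn2r ?nnegrE ?normc_ge0// normc_truncate_le.
Qed.

(** On the bounded interval [nc (h x) <= nc (h x) ^+ 2 + 1], and both terms are integrable there. *)
Lemma cintegrable_truncate n h : sqr_cintegrable h -> cintegrable (truncate n h).
Proof.
move=> [mh ih].
have m1 : measurable_fun [set: R] (fun x => nc (h x) ^+ 2).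
  by apply: measurable_funX; exact: measurable_normc.
apply: (@le_cintegrable _ _ (fun x => nc (h x) ^+ 2 + cutoff n x)).
- exact: cmeasurable_truncate.
- by apply: measurable_funD => //; exact: measurable_cutoff.
- move=> x; rewrite normc_truncate /cutoff indicE; case: (_ \in _) => /=.
    by rewrite mulr1; have := normc_ge0 (h x); nra.
  by rewrite mulr0 addr0 sqr_ge0.
under eq_integral do rewrite EFinD.
rewrite ge0_integralD//.
- by apply: lte_add_pinfty => //; exact: integral_cutoff_lty.
- by move=> x _; rewrite lee_fin sqr_ge0.
- exact/measurable_EFinP.
- by move=> x _; rewrite lee_fin; have /andP[] := cutoff01 n x.
- by apply/measurable_EFinP; exact: measurable_cutoff.
Qed.

Lemma normc_truncateB n h x : nc (truncate n h x - h x) = nc (h x) * (1 - cutoff n x).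
Proof.
have /andP[_ c1] := cutoff01 n x.
rewrite /truncate -[X in _ - X]mulr1 -mulrBr Normc.normcM.
have -> : (cutoff n x)%:C - 1 = (cutoff n x - 1)%:C by rewrite rmorphB.
by rewrite normc_real ler0_norm ?subr_le0// opprB.
Qed.

End truncation.

(** * Parseval formula for a square-integrable wavelet, and the pointwise and L2 readings *)

Section transform_parseval.
Context {R : realType}.
Local Notation mu := (@lebesgue_measure R).
Local Notation nc := (@Normc.normc R).
Variables (A B C D p q : R).
Hypothesis hB : B != 0.
Variable zeta : R.
Hypothesis zeta0 : 0 < zeta.
Local Notation L := (SaftParams A B C D p q).
Local Notation K := (saft_kernel L).
Local Notation saft := (saft_integral L [set: R]).
Local Notation kb := (nc (saft_KB L)).
Local Notation wav psi t x := (sa_wavelet L psi t zeta x).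
Local Notation Psi psi := (fun x => sa_Psi L psi x zeta).
Local Notation M := (saft_multiplier B D p q zeta).
Local Notation W f psi := (fun t => sa_wavelet_transform L psi f t zeta).
Local Notation saftn n := (saft_integral L `[- n%:R, n%:R]).

Lemma saft_truncate h n w : saftn n h w = saft (truncate n h) w.
Proof.
rewrite /saft_integral cintegral_mkcond; congr cintegral; apply/funext => x.
by rewrite /truncate mulrAC.
Qed.

(** The reflection in [sa_Psi] is harmless because the cutoff is even. Thus the SAFT for the
    truncated wavelet is exactly the sequence converging to [Psihat] in L2. *)
Lemma Psi_truncate psi n : Psi (truncate n psi) = truncate n (Psi psi).
Proof.
apply/funext => x; rewrite sa_PsiE /truncate sa_PsiE conjcM conjc_real cutoffN.
by rewrite mulrA.
Qed.

Lemma wavelet_truncateB psi n t x : wav (truncate n psi) t x - wav psi t x =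
  wav (fun y => truncate n psi y - psi y) t x.
Proof. by rewrite !sa_waveletE; ring. Qed.

Variables (f fhat psi Psihat : R -> R[i]).
Hypotheses (hf : sqr_cintegrable f) (hfhat : sqr_cintegrable fhat).
Hypotheses (hpsi : sqr_cintegrable psi) (hPsihat : sqr_cintegrable Psihat).
Hypothesis f_parseval : forall phi, saft_test L phi ->
  cinner f phi = cinner fhat (saft phi).
Hypothesis Psihat_lim : (\int[mu]_w (nc (Psihat w - saftn n (Psi psi) w) ^+ 2)%:E)%E
  @[n --> \oo] --> (0 : \bar R).

Local Notation G := (fun w => M w * fhat w * Psihat (zeta * w)).

Lemma normc_multiplier w : nc (M w) = Num.sqrt zeta.
Proof.
by rewrite /saft_multiplier Normc.normcM normc_expi mulr1 normc_real ger0_norm ?sqrtr_ge0.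
Qed.

Lemma cmeasurable_multiplier : cmeasurable M.
Proof.
apply: cmeasurableM; first exact: cmeasurable_cst.
apply: cmeasurable_expi; apply: measurable_funM => //; apply: measurable_funB.
  by apply: measurable_funM => //; apply: measurable_funM => //; exact: measurable_funM.
by apply: measurable_funM => //; apply: measurable_funM => //; exact: measurable_funX.
Qed.

Let cintegrable_product (k : R -> R[i]) : sqr_cintegrable k ->
  cintegrable (fun w => M w * fhat w * k (zeta * w)).
Proof.
move=> hk; rewrite (_ : (fun _ => _) = (fun w => (fhat w * k (zeta * w + 0)) * M w)).
  apply: (@cintegrableM_bounded _ _ _ (Num.sqrt zeta)).
  - exact: cmeasurable_multiplier.
  - by move=> w; rewrite normc_multiplier.
  - apply: (cintegrableM_L2 hfhat (sqr_cintegrable_affine 0 _ hk)).1.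
    by rewrite gt_eqF.
by apply/funext => w; rewrite addr0; ring.
Qed.

Lemma cintegrable_transform_saft : cintegrable G.
Proof. exact: cintegrable_product. Qed.

Section test.
Variables (phi : R -> R[i]) (Mphi : R).
Hypotheses (iphi : cintegrable phi) (bphi : forall x, nc (phi x) <= Mphi).
Hypothesis (iphihat : cintegrable (saft phi)).

Let phihat_bound : exists c, forall w, nc (saft phi w) <= c.
Proof.
exists (kb * fine (\int[mu]_x (nc (phi x))%:E)%E) => w.
rewrite -lee_fin EFinM fineK; first exact: (normc_saft_le hB).
exact: integrable_fin_num (integrable_normc iphi).
Qed.

Lemma cintegrable_transform_test : cintegrable (fun t => W f psi t * conjc (phi t)).
Proof.
rewrite (_ : (fun _ => _) = (fun t => conjc (phi t) * W f psi t)); last first.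
  by apply/funext => t; rewrite mulrC.
apply: (cintegrableM_bounded _ (normc_transform_le zeta0 hf hpsi)).
  exact: cmeasurable_transform.
exact: cintegrable_conj.
Qed.

Let cintegrableM_phihat h : cintegrable h -> cintegrable (fun w => h w * conjc (saft phi w)).
Proof.
move=> ih; have [c bc] := phihat_bound.
apply: (@cintegrableM_bounded _ _ _ c) ih.
  by apply: cmeasurable_conj; exact: iphihat.1.
by move=> w; rewrite normc_conj.
Qed.

Lemma cintegrable_transform_saft_test : cintegrable (fun w => G w * conjc (saft phi w)).
Proof. exact/cintegrableM_phihat/cintegrable_transform_saft. Qed.

Let cinner_dist (h k r : R -> R[i]) : cintegrable (fun x => h x * conjc (r x)) ->
  cintegrable (fun x => k x * conjc (r x)) ->
  ((nc (cinner h r - cinner k r))%:E <= \int[mu]_x (nc ((h x - k x) * conjc (r x)))%:E)%E.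
Proof.
move=> ih ik; rewrite /cinner -[X in nc X](cintegralB ih ik).
apply: le_trans (normc_cintegral_le (cintegrableB ih ik)) _.
rewrite le_eqVlt; apply/orP; left; apply/eqP; apply: eq_integral => x _.
by rewrite mulrBl.
Qed.

(** Dominated convergence twice: in [x] for fixed [t], then in [t] under [(TB + TB) * nc (phi t)].
    Truncating [psi] only lowers the modulus of the integrand, so one constant [TB] serves every
    [n]. *)
Let transform_lim : (nc (cinner (W f (truncate n psi)) phi - cinner (W f psi) phi))%:E
  @[n --> \oo] --> (0 : \bar R).
Proof.
have hpsin n := sqr_cintegrable_truncate n hpsi.
have iWn n : cintegrable (fun t => W f (truncate n psi) t * conjc (phi t)).
  rewrite (_ : (fun _ => _) = (fun t => conjc (phi t) * W f (truncate n psi) t)); last first.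
    by apply/funext => t; rewrite mulrC.
  apply: (cintegrableM_bounded _ (normc_transform_le zeta0 hf (hpsin n))).
    exact: cmeasurable_transform.
  exact: cintegrable_conj.
apply: (squeeze_cvge0 _ (fun n => cinner_dist (iWn n) cintegrable_transform_test)).
  by move=> n; rewrite lee_fin normc_ge0.
pose TB := transform_bound A B C D p q zeta f psi.
have TBn n t : nc (W f (truncate n psi) t) <= TB.
  rewrite -lee_fin; apply: le_trans (normc_cintegral_le (cintegrable_transform zeta0 hf (hpsin n) t).1) _.
  apply: le_trans (le_transform_bound zeta0 hf hpsi t).
  apply: ge0_le_integral => //.
  - by move=> x _; rewrite lee_fin normc_ge0.
  - apply/measurable_EFinP.
    exact: measurable_normc (cintegrable_transform zeta0 hf (hpsin n) t).1.1.
  - apply/measurable_EFinP.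
    exact: measurable_normc (cintegrable_transform zeta0 hf hpsi t).1.1.
  - move=> x _; rewrite lee_fin !(Normc.normcM (f x)) ler_wpM2l ?normc_ge0// !normc_conj.
    rewrite !normc_wavelet ler_wpM2l ?divr_ge0 ?normc_ge0 ?sqrtr_ge0//.
    exact: normc_truncate_le.
have cW t : nc (W f (truncate n psi) t - W f psi t) @[n --> \oo] --> (0 : R).
  suff : (nc (W f (truncate n psi) t - W f psi t))%:E @[n --> \oo] --> (0 : \bar R).
    by move=> /fine_cvgP[_].
  pose u n x := f x * conjc (wav (truncate n psi) t x).
  have iu n : cintegrable (u n) := (cintegrable_transform zeta0 hf (hpsin n) t).1.
  have iv : cintegrable (fun x => f x * conjc (wav psi t x)).
    exact: (cintegrable_transform zeta0 hf hpsi t).1.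
  have uE n x : nc (u n x - f x * conjc (wav psi t x)) =
      nc (f x * conjc (wav psi t x)) * (1 - cutoff n ((x - t) / zeta)).
    rewrite /u -mulrBr !(Normc.normcM (f x)).
    have -> : conjc (wav (truncate n psi) t x) - conjc (wav psi t x) =
        conjc (wav (truncate n psi) t x - wav psi t x).
      by case: (wav (truncate n psi) t x) (wav psi t x) => a b [c d]; simpc; congr Complex; ring.
    by rewrite !normc_conj wavelet_truncateB !normc_wavelet normc_truncateB !mulrA.
  have := @cdominated_convergence R u _ (fun x => nc (f x * conjc (wav psi t x)))
    (fun n => (iu n).1) iv.1 (integrable_normc iv).
  move=> h; apply: (squeeze_cvge0 _ _ (h _ _)).
  - by move=> n; rewrite lee_fin normc_ge0.
  - move=> n; rewrite [X in nc X](_ : _ = cintegral setT (fun x => u n x - f x * conjc (wav psi t x))).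
      exact: normc_cintegral_le (cintegrableB (iu n) iv).
    by rewrite cintegralB.
  - move=> n x; rewrite uE ler_piMr ?normc_ge0// gerDl oppr_le0.
    by have /andP[] := cutoff01 n ((x - t) / zeta).
  - move=> x; rewrite (_ : (fun n => _) = (fun n => nc (f x * conjc (wav psi t x)) *
        (1 - cutoff n ((x - t) / zeta)))); last by apply/funext => n; exact: uE.
    rewrite -[X in _ --> X](mulr0 (nc (f x * conjc (wav psi t x)))); apply: cvgMr.
    rewrite -[X in _ --> X](subrr 1); apply: cvgB; first exact: cvg_cst.
    exact: cvg_cutoff.
have := @cdominated_convergence R (fun n t => (W f (truncate n psi) t - W f psi t) * conjc (phi t))
  (fun=> 0) (fun t => (TB + TB) * nc (phi t)).
set v := (fun n => (\int[mu]_x (nc (_ - 0))%:E)%E).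
have -> : v = (fun n => (\int[mu]_x (nc ((W f (truncate n psi) x - W f psi x) * conjc (phi x)))%:E)%E).
  by apply/funext => n; apply: eq_integral => x _; rewrite subr0.
apply.
- move=> n; apply: cmeasurableM; last exact: cmeasurable_conj iphi.1.
  by apply: cmeasurableB; exact: cmeasurable_transform.
- exact: cmeasurable_cst.
- exact: (@integrableZl _ _ _ mu setT measurableT (TB + TB) _ (integrable_normc iphi)).
- move=> n t; rewrite subr0 Normc.normcM normc_conj ler_wpM2r ?normc_ge0//.
  apply: le_trans (normcB_le _ _) _; apply: lerD; first exact: TBn.
  exact: normc_transform_le.
- move=> t; rewrite (_ : (fun n => _) = (fun n => nc (W f (truncate n psi) t - W f psi t) * nc (phi t))).
    by rewrite -[X in _ --> X](mul0r (nc (phi t))); apply: cvgMl.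
  by apply/funext => n; rewrite subr0 Normc.normcM normc_conj.
Qed.

(** Dilation by [zeta] preserves the L2 convergence to [Psihat], pairing with the fixed [fhat] turns
    it into L1 convergence, and the multiplier and [saft phi] are bounded. *)
Let saft_side_lim : (nc (cinner (fun w => M w * fhat w * saft (Psi (truncate n psi)) (zeta * w)) (saft phi)
    - cinner G (saft phi)))%:E @[n --> \oo] --> (0 : \bar R).
Proof.
have [c bc] := phihat_bound.
have c0 : 0 <= c by apply: le_trans (bc 0); exact: normc_ge0.
have iPsin n : cintegrable (Psi (truncate n psi)).
  exact: cintegrable_Psi (cintegrable_truncate n hpsi).
have iGn n : cintegrable (fun w => M w * fhat w * saft (Psi (truncate n psi)) (zeta * w)).
  have mS : cmeasurable (fun w => saft (Psi (truncate n psi)) (zeta * w)).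
    apply: (cmeasurableT_comp (cmeasurable_saft hB (iPsin n).1)).
    exact: mulrl_measurable.
  apply: cintegrable_product; split; first exact: (cmeasurable_saft hB (iPsin n).1).
  (* Plancherel's inequality makes the SAFT of the truncation square-integrable, hence its product
     with [fhat] integrable. *)
  apply: le_lt_trans (plancherel_le hB (iPsin n)) _.
  exact: (sqr_cintegrable_Psi _ _ _ _ _ _ _ (sqr_cintegrable_truncate n hpsi)).2.
pose d n w := saft (Psi (truncate n psi)) w - Psihat w.
have md n : cmeasurable (d n).
  by apply: cmeasurableB; [exact: (cmeasurable_saft hB (iPsin n).1)|exact: hPsihat.1].
pose k n w := d n (zeta * w + 0).
have mk n : cmeasurable (k n) := cmeasurableT_comp (md n) (measurable_affine zeta 0).
have ck : (\int[mu]_w (nc (k n w) ^+ 2)%:E)%E @[n --> \oo] --> (0 : \bar R).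
  rewrite (_ : (fun n => _) = (fun n => `|zeta|^-1%:E *
      \int[mu]_w (nc (Psihat w - saftn n (Psi psi) w) ^+ 2)%:E)%E).
    by rewrite -[X in _ --> X](mule0 (`|zeta|^-1)%:E); apply: cvgeMl.
  apply/funext => n.
  rewrite (ge0_integral_affine 0 (lt0r_neq0 zeta0) (f := fun w => (nc (d n w) ^+ 2)%:E)).
  - congr (_ * _)%E; apply: eq_integral => w _.
    by rewrite /d Psi_truncate -saft_truncate normcBC.
  - apply/measurable_EFinP; apply: measurable_funX; exact: measurable_normc (md n).
  - by move=> w; rewrite lee_fin sqr_ge0.
have cp := cvg_L2_pairing hfhat mk ck.
have sc0 : 0 <= Num.sqrt zeta * c by rewrite mulr_ge0// sqrtr_ge0.
have bound n : ((nc (cinner (fun w => M w * fhat w * saft (Psi (truncate n psi)) (zeta * w)) (saft phi)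
    - cinner G (saft phi)))%:E <= (Num.sqrt zeta * c)%:E * \int[mu]_w (nc (fhat w * k n w))%:E)%E.
  apply: le_trans (cinner_dist (cintegrableM_phihat (iGn n)) cintegrable_transform_saft_test) _.
  have mfk : cmeasurable (fun w => fhat w * k n w) := cmeasurableM hfhat.1 (mk n).
  have iD := cintegrableM_phihat (cintegrableB (iGn n) cintegrable_transform_saft).
  rewrite -integral_cst_normc//; apply: ge0_le_integral => //.
  - by move=> w _; rewrite lee_fin normc_ge0.
  - by apply/measurable_EFinP; exact: measurable_normc iD.1.
  - apply/measurable_EFinP; apply: measurable_funM => //.
    exact: measurable_normc mfk.
  - move=> w _; rewrite lee_fin -mulrBr Normc.normcM normc_conj.
    rewrite -mulrA (Normc.normcM (M w)) normc_multiplier /k /d addr0 mulrAC.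
    apply: ler_wpM2r; first exact: normc_ge0.
    by apply: ler_wpM2l; [exact: sqrtr_ge0|exact: bc].
apply: (squeeze_cvge0 _ bound); first by move=> n; rewrite lee_fin normc_ge0.
by rewrite -[X in _ --> X](mule0 (Num.sqrt zeta * c)%:E); apply: cvgeMl.
Qed.

Lemma transform_parseval : cinner (W f psi) phi = cinner G (saft phi).
Proof.
pose X := cinner (W f psi) phi - cinner G (saft phi).
pose u n := (nc (cinner (W f (truncate n psi)) phi - cinner (W f psi) phi))%:E.
pose v n := (nc (cinner (fun w => M w * fhat w * saft (Psi (truncate n psi)) (zeta * w)) (saft phi)
    - cinner G (saft phi)))%:E.
have u0 n : (0 <= u n)%E by rewrite lee_fin normc_ge0.
have v0 n : (0 <= v n)%E by rewrite lee_fin normc_ge0.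
have Xuv n : ((nc X)%:E <= u n + v n)%E.
  rewrite /u /v -EFinD lee_fin.
  rewrite (transform_parseval_L1 hB zeta0 hf f_parseval (cintegrable_truncate n hpsi)
    (sqr_cintegrable_truncate n hpsi) iphi bphi iphihat).
  by rewrite (normcBC _ (cinner (W f psi) phi)); exact: normc_sum3.
have c0 := cvge0D u0 v0 transform_lim saft_side_lim.
have : ((nc X)%:E <= 0)%E.
  rewrite -(cvg_lim _ c0)//; apply: lime_ge; first by apply/cvg_ex; exists 0%E.
  exact: nearW.
rewrite lee_fin => X0; apply/eqP; rewrite -subr_eq0 -/X; apply/eqP/normc_eq0.
by apply/eqP; rewrite eq_le X0 normc_ge0.
Qed.

End test.

Lemma saft_test_abel e a : 0 < e -> saft_test L (abel_test A B C D p q e a).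
Proof.
move=> e0; have ia := cintegrable_abel_test hB a e0.
split; first exact/cLp1P.
  exists kb => x; rewrite /abel_test Normc.normcM num_conjE normc_conj (normc_kernel hB).
  rewrite normc_real ger0_norm ?expabs_ge0// ler_piMl ?normc_ge0//.
  by apply: expabs_le1; rewrite ltW// abel_rate_gt0.
apply/cLp1P; rewrite (_ : saft _ = (fun w => (poisson e (1 * w - a))%:C *
    expi (chirpw B D p q w - chirpw B D p q a))).
  apply: (@cintegrableM_bounded _ _ _ 1).
  - apply: cmeasurable_expi; apply: measurable_funB => //; exact: measurable_chirpw.
  - by move=> w; rewrite normc_expi.
  - exact: (cintegrable_affine (- a) (oner_neq0 R) (cintegrable_poisson e0)).
by apply/funext => w; rewrite (saft_abel_test hB)// mul1r mulrC.
Qed.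

Lemma is_saft_transform : is_saft L (W f psi) G.
Proof.
have mW := cmeasurable_transform (A := A) (B := B) (C := C) (D := D) (p := p) (q := q)
  (zeta := zeta) hf hpsi.
have bW := normc_transform_le (A := A) (B := B) (C := C) (D := D) (p := p) (q := q)
  zeta0 hf hpsi.
have iG := cintegrable_transform_saft.
have WG e a : 0 < e -> cinner (W f psi) (abel_test A B C D p q e a) =
    cinner G (saft (abel_test A B C D p q e a)).
  move=> e0; have [/cLp1P ia [m bm] /cLp1P iah] := saft_test_abel a e0.
  exact: (transform_parseval ia bm iah).
split.
- by move=> /cLp1P; exact: (ae_eq_saft hB mW bW iG WG).
- move=> /cLp2P[_ W2].
  (* With the cutoff function 0, [saft_cutoff_le] bounds the L2 norm of [G] by that of the
     transform. *)
  have G2 : sqr_cintegrable G.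
    split; first exact: iG.1.
    have z : (fun x => W f psi x * (0 : R)%:C) = (fun=> 0).
      by apply/funext => x; rewrite mulr0.
    have i0 : cintegrable (fun x => W f psi x * (0 : R)%:C).
      rewrite z; split; first exact: cmeasurable_cst.
      by under eq_integral do rewrite Normc.normc0; rewrite integral0.
    have := saft_cutoff_le hB mW bW iG WG W2 (measurable_cst (0 : R)) _ i0.
    have z0 w : saft (fun x => W f psi x * (0 : R)%:C) w = 0.
      rewrite z /saft_integral /cintegral.
      rewrite (_ : _ \o _ = fun=> 0); last by apply/funext => x /=; rewrite mul0r.
      rewrite [X in _ +i* Rintegral _ _ X](_ : _ = fun=> 0); last first.
        by apply/funext => x /=; rewrite mul0r.
      by rewrite /Rintegral integral0.
    move=> h; apply: le_lt_trans W2; move: h.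
    under eq_integral do rewrite z0 sub0r normcN.
    under [X in (_ <= X)%E]eq_integral do rewrite subr0 mulr1.
    by apply => x; rewrite lexx ler01.
  split; first exact/cLp2P.
  apply/(cvg_cLnorm2 (fun n w => G w - saftn n (W f psi) w)).
  have hW2 : sqr_cintegrable (W f psi) by [].
  (* With the indicator of [[- n, n]], the same inequality bounds the error of the limit in the mean
     by the L2 tail of the transform. *)
  have h1 n : (\int[mu]_w (nc (G w - saftn n (W f psi) w) ^+ 2)%:E <=
      \int[mu]_x ((nc (W f psi x) * (1 - cutoff n x)) ^+ 2)%:E)%E.
    have := saft_cutoff_le hB mW bW iG WG W2 (measurable_cutoff n) (cutoff01 n)
      (cintegrable_truncate n hW2).
    by under eq_integral do rewrite normcBC -(saft_truncate (W f psi)).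
  apply: (squeeze_cvge0 _ h1).
    by move=> n; apply: integral_ge0 => w _; rewrite lee_fin sqr_ge0.
  have mnW : measurable_fun [set: R] (fun x => nc (W f psi x)) := measurable_normc mW.
  pose r n x := (nc (W f psi x) * (1 - cutoff n x)) ^+ 2.
  have r0 n x : nc ((r n x)%:C - 0) = r n x.
    by rewrite subr0 normc_real ger0_norm ?sqr_ge0.
  rewrite (_ : (fun n => _) = (fun n => (\int[mu]_x (nc ((r n x)%:C - 0))%:E)%E)); last first.
    by apply/funext => n; apply: eq_integral => x _; rewrite r0.
  apply: (@cdominated_convergence R _ _ (fun x => nc (W f psi x) ^+ 2)).
  - move=> n; apply: cmeasurable_real; apply: measurable_funX; apply: measurable_funM => //.
    by apply: measurable_funB => //; exact: measurable_cutoff.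
  - exact: cmeasurable_cst.
  - apply/integrableP; split; first by apply/measurable_EFinP; exact: measurable_funX.
    by under eq_integral do rewrite gee0_abs ?lee_fin ?sqr_ge0//.
  - move=> n x; rewrite r0 /r exprMn ler_piMr ?sqr_ge0//.
    have /andP[c0 c1] := cutoff01 n x.
    by rewrite expr_le1// ?subr_ge0// lerBlDr lerDl.
  - move=> x; rewrite (_ : (fun n => _) = r^~ x); last by apply/funext => n; exact: r0.
    have h : nc (W f psi x) * (1 - cutoff n x) @[n --> \oo] --> (0 : R).
      rewrite -[X in _ --> X](mulr0 (nc (W f psi x))); apply: cvgMr.
      rewrite -[X in _ --> X](subrr 1); apply: cvgB; first exact: cvg_cst.
      exact: cvg_cutoff.
    by rewrite -[X in _ --> X](mulr0 0); apply: cvgM.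
- move=> phi [/cLp1P iphi [m bphi] /cLp1P iphihat] /=; split.
  + exact/cLp1P/cintegrable_transform_test.
  + by apply/cLp1P; exact: (cintegrable_transform_saft_test iphi iphihat).
  + exact: (transform_parseval iphi bphi iphihat).
Qed.

End transform_parseval.

Theorem theorem2p5 (R : realType) (A B C D p q : R)
    (hdet : A * D - B * C = 1) (hB : B != 0)
    (f psi : R -> R[i]) (hf : cLp 2%:E f) (hpsi : cLp 2%:E psi)
    (zeta : R) (hzeta : 0 < zeta)
    (fhat Psihat : R -> R[i])
    (hfhat : is_saft (SaftParams A B C D p q) f fhat)
    (hPsihat : is_saft (SaftParams A B C D p q)
       (fun x => sa_Psi (SaftParams A B C D p q) psi x zeta) Psihat) :
  is_saft (SaftParams A B C D p q)
    (fun t => sa_wavelet_transform (SaftParams A B C D p q) psi f t zeta)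
    (fun w => (Num.sqrt zeta)%:C *
       expi ((2 * B)^-1 *
         (2 * w * zeta * (D * p - B * q) - D * w ^+ 2 * zeta ^+ 2)) *
       fhat w * Psihat (zeta * w)).
Proof.
(* [fhat] enters through its square integrability and the Parseval formula, [Psihat] through the
   limit in the mean, which matches the truncations of [psi]. *)
move: hfhat hPsihat => [_ + f_parseval] [_ + _].
move=> /(_ hf)[/cLp2P hfhat2 _].
move: hf hpsi => /cLp2P hf2 /cLp2P hpsi2.
have /cLp2P hPsi2 := sqr_cintegrable_Psi A B C D p q zeta hpsi2.
move=> /(_ hPsi2)[/cLp2P hPsihat2 /cvg_cLnorm2 Psihat_lim].
apply: (is_saft_transform hB hzeta hf2 hfhat2 hpsi2 hPsihat2 _ Psihat_lim).
by move=> phi /f_parseval[].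
Qed.
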